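(* Let $(\Sigma,\sigma)$ be a topologically mixing countable Markov shift, let $\tau:\Sigma\to\mathbb{R}^+$ be a positive roof function of summable variations with $\sum_{i=0}^\infty\tau(\sigma^ix)=\infty$ for every $x\in\Sigma$, and let $(Y,\Phi)$ be the associated suspension semi-flow. Let $g:Y\to\mathbb{R}$ be a potential such that $\Delta_g:\Sigma\to\mathbb{R}$ is of summable variations and $P_\Phi(g)<\infty$. Then: (a) The definition of recurrence of $g$ is independent of the cylinder $C_{i_0}$. (b) $P_\Phi(g)=\lim_{n\to\infty}\frac1n\log Z_{n,\tau}(g,C_{i_0})$. (c) The potential $g$ is recurrent if and only if $\Delta_g-P_\Phi(g)\tau$ is recurrent and $P_\sigma(\Delta_g-P_\Phi(g)\tau)=0$. (d) If $g$ is recurrent then there exists a conservative measure $\nu_g$ which can be obtained as $R(\mu)$, where $\mu$ is the RPF measure for $\Delta_g-P_\Phi(g)\tau$.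
   Context: **Shift.** Let $B=(B(i,j))_{i,j\in\mathbb{N}_0}$ be a matrix of zeros and ones with no zero row or column. $\Sigma=\{(x_n)_{n\ge0}: B(x_n,x_{n+1})=1\ \forall n\}$, with $\sigma(x_0,x_1,\dots)=(x_1,x_2,\dots)$. Topologically mixing: for all $a,b\in\mathbb{N}_0$ there is $N$ such that for every $n>N$ there is an admissible word of length $n$ starting with $a$ and ending with $b$. $C_i=\{x\in\Sigma:x_0=i\}$. $V_n(\phi)=\sup\{|\phi(x)-\phi(y)|: x_i=y_i,\ 0\le i\le n-1\}$; $\phi$ has summable variations if $\sum_{n\ge1}V_n(\phi)<\infty$. **Pressure and recurrence on the base.** For $\phi$ of summable variations, $Z_n(\phi,C_i)=\sum_{\sigma^nx=x,\,x\in C_i}e^{\sum_{k=0}^{n-1}\phi(\sigma^kx)}$; the Gurevich pressure is $P_\sigma(\phi)=\lim_{n\to\infty}\frac1n\log Z_n(\phi,C_i)$ (independent of $i$). When $P_\sigma(\phi)=\log\lambda$ is finite, $\phi$ is recurrent if $\sum_n\lambda^{-n}Z_n(\phi,C_i)=\infty$ and transient otherwise. With $L_\phi u(x)=\sum_{\sigma y=x}e^{\phi(y)}u(y)$, for recurrent $\phi$ there are (Sarig) a conservative conformal measure $m$ and a continuous positive function $h$ with $L_\phi^*m=\lambda m$, $L_\phi h=\lambda h$; $h\,dm$ is the Ruelle–Perron–Frobenius (RPF) measure of $\phi$ (unique up to scaling, possibly infinite). A measure is conservative if every measurable wandering set has measure zero. **Suspension semi-flow.** $Y=\{(x,t)\in\Sigma\times\mathbb{R}:0\le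 t\le\tau(x)\}/\sim$ with $(x,\tau(x))\sim(\sigma(x),0)$, and $\Phi=(\varphi_t)_{t\ge0}$ is given by $\varphi_t(x,s)=(x,s+t)$ whenever $s+t\in[0,\tau(x)]$. The roof need not be bounded away from zero. $\Delta_g(x)=\int_0^{\tau(x)}g(x,t)\,dt$. With $\mathrm{Leb}$ denoting one-dimensional Lebesgue measure, $R(\mu)=(\mu\times \mathrm{Leb})|_Y/(\mu\times \mathrm{Leb})(Y)$ for a (possibly infinite, sigma-finite) $\sigma$-invariant $\mu$ with $\int\tau\,d\mu<\infty$; if $\int\tau\,d\mu=\infty$, $R(\mu)$ is understood as the infinite measure $(\mu\times \mathrm{Leb})|_Y$. **Pressure and recurrence on the flow.** $P_\Phi(g)=\inf\{t\in\mathbb{R}:P_\sigma(\Delta_g-t\tau)\le0\}$. For a symbol $i_0$, $$Z_{n,\tau}(g,C_{i_0})=\sum e^{\int_0^sg(\varphi_t(x,0))\,dt},$$ the sum being over all $x\in C_{i_0}$ and times $s$ with $n-1<s\le n$ and $\varphi_s(x,0)=(x,0)$. The potential $g$ is recurrent if $\sum_{n=1}^\infty Z_{n,\tau}(g-P_\Phi(g),C_{i_0})=\infty$, and transient otherwise.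
   Formalization: In (b) the limit is taken only along those n with Z_{n,τ}(g,C_{i_0}) ≠ 0, which are shown to be infinitely many; over all n the limit can fail to exist: for τ = 2 the sum is empty for every odd n. *)

(* Defs.v *)
From HB Require Import structures.
From mathcomp Require Import all_boot all_order all_algebra.
From mathcomp Require Import all_classical all_reals all_analysis.
From mathcomp Require Import measurable_realfun.

Set Implicit Arguments.
Unset Strict Implicit.
Unset Printing Implicit Defensive.

Import Order.TTheory GRing.Theory Num.Theory.
Import numFieldNormedType.Exports.

Local Open Scope classical_set_scope.
Local Open Scope ring_scope.
Local Open Scope ereal_scope.

(* The space of all sequences of symbols carries the product of the discrete
   topologies and its Borel sigma-algebra. Functions and measures on the Markov
   shift [Sigma B] are given on this ambient space, but only what they do on
   [Sigma B] matters. *)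
Notation nat_seqs := {ptws nat -> nat}.
Notation borel_seqs := (g_sigma_algebraType (@open nat_seqs)).

Definition left_shift (x : borel_seqs) : borel_seqs := fun n => x n.+1.

Definition Sigma (B : rel nat) : set borel_seqs :=
  [set x | forall n, B (x n) (x n.+1)].

Definition cylinder (B : rel nat) (i : nat) : set borel_seqs :=
  [set x | Sigma B x /\ x 0%N = i].

Definition no_zero_row_or_column (B : rel nat) : Prop :=
  (forall i, exists j, B i j) /\ (forall j, exists i, B i j).

Definition topologically_mixing (B : rel nat) : Prop :=
  forall a b : nat, exists N : nat, forall n : nat, (N < n)%N ->
    exists w : seq nat,
      [/\ size w = n, sorted B w, head 0%N w = a & last 0%N w = b].

Section base.
Context {R : realType}.
Implicit Types (B : rel nat) (phi : borel_seqs -> R).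

Definition birkhoff phi (n : nat) (x : borel_seqs) : R :=
  (\sum_(k < n) phi (iter k left_shift x))%R.

Definition var_n B phi (n : nat) : \bar R :=
  ereal_sup [set d | exists x y : borel_seqs,
    [/\ Sigma B x, Sigma B y, forall i, (i < n)%N -> x i = y i
      & d = `|phi x - phi y|%:E]].

Definition summable_variations B phi : Prop :=
  \sum_(1 <= n <oo) var_n B phi n < +oo.

Definition Zbase B phi (n : nat) (i : nat) : \bar R :=
  \esum_(x in [set x | cylinder B i x /\ iter n left_shift x = x])
    (expR (birkhoff phi n x))%:E.

(* For a topologically mixing [B] and [phi] of summable variations the limit
   exists and does not depend on the symbol; symbol 0 is used. *)
Definition gurevich_pressure B phi : \bar R :=
  limn (fun n => (n%:R^-1)%:E * lne (Zbase B phi n 0%N)).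

Definition recurrent_base B phi (i : nat) : Prop :=
  gurevich_pressure B phi \is a fin_num /\
  \sum_(1 <= n <oo)
    (expR (fine (gurevich_pressure B phi)) ^- n)%:E * Zbase B phi n i = +oo.

Definition transfer B phi (u : borel_seqs -> \bar R)
    (x : borel_seqs) : \bar R :=
  \esum_(y in [set y | Sigma B y /\ left_shift y = x])
    ((expR (phi y))%:E * u y).

(* [f] is considered as a self-map of [D]. *)
Definition wandering {d} {T : measurableType d} (D : set T) (f : T -> T)
    (W : set T) : Prop :=
  W `<=` D /\ trivIset setT (fun n : nat => D `&` (iter n f) @^-1` W).

Definition conservative {d} {T : measurableType d} (D : set T) (f : T -> T)
    (nu : set T -> \bar R) : Prop :=
  forall W, measurable W -> wandering D f W -> nu W = 0.

(* [L_phi^* m = lambda m], tested on nonnegative Borel functions. *)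
Definition conformal B phi (lambda : R)
    (m : {measure set borel_seqs -> \bar R}) : Prop :=
  forall u : borel_seqs -> \bar R,
    measurable_fun setT u -> (forall x, 0 <= u x) ->
    \int[m]_(x in Sigma B) transfer B phi u x =
    lambda%:E * \int[m]_(x in Sigma B) u x.

(* The conformal measure [m] is finite and positive on cylinders, as in Sarig's
   theorem; this excludes [m = 0] and makes [m] sigma-finite. *)
Definition is_RPF_measure B phi
    (mu : {measure set borel_seqs -> \bar R}) : Prop :=
  let lambda := expR (fine (gurevich_pressure B phi)) in
  exists (m : {measure set borel_seqs -> \bar R})
         (h : borel_seqs -> R),
    [/\ m (~` Sigma B) = 0 /\ (forall i, 0 < m (cylinder B i) < +oo),
        conservative (Sigma B) left_shift m,
        conformal B phi lambda m,
        [/\ {within (Sigma B : set nat_seqs), continuous (h : nat_seqs -> R)},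
            forall x, Sigma B x -> (0 < h x)%R &
            forall x, Sigma B x ->
              transfer B phi (EFin \o h) x = (lambda * h x)%:E]
      & forall A, measurable A ->
          mu A = \int[m]_(x in A `&` Sigma B) (h x)%:E].

End base.

Section suspension.
Context {R : realType}.
Implicit Types (B : rel nat) (tau : borel_seqs -> R).

Let phase : Type := (borel_seqs * measurableTypeR R)%type.
Implicit Types g : phase -> R.

(* The quotient of [{(x, t) | 0 <= t <= tau x}] by
   [(x, tau x) ~ (left_shift x, 0)], identified with its set of representatives
   [(x, t)] such that [t < tau x]. *)
Definition suspension B tau : set phase :=
  [set p | Sigma B p.1 /\ (0 <= p.2 < tau p.1)%R].

(* Number of times the roof is hit up to time [u] when starting at [(x, 0)]:
   existence uses the divergence of the Birkhoff sums of [tau], uniqueness its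
   positivity. *)
Definition hits tau (x : borel_seqs) (u : R) : nat :=
  xget 0%N [set n : nat | (birkhoff tau n x <= u < birkhoff tau n.+1 x)%R].

Definition flow tau (t : R) (p : phase) : phase :=
  let n := hits tau p.1 (p.2 + t)%R in
  (iter n left_shift p.1, (p.2 + t - birkhoff tau n p.1)%R).

Definition Delta tau g (x : borel_seqs) : R :=
  Rintegral lebesgue_measure `[0%R, tau x] (fun t => g (x, t)).

(* What it means for [Delta tau g] to be well defined on Sigma. *)
Definition fiber_integrable B tau g : Prop :=
  forall x, Sigma B x ->
    lebesgue_measure.-integrable `[0%R, tau x] (fun t => (g (x, t))%:E).

Definition flow_pressure B tau g : \bar R :=
  ereal_inf [set t%:E | t in
    [set t : R |
      gurevich_pressure B (fun x => Delta tau g x - t * tau x)%R <= 0]].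

Definition Zflow B tau g (n : nat) (i : nat) : \bar R :=
  \esum_(p in [set p : phase |
      [/\ cylinder B i p.1, (n%:R - 1 < p.2 <= n%:R)%R
        & flow tau p.2 (p.1, 0%R) = (p.1, 0%R)]])
    (expR (Rintegral lebesgue_measure `[0%R, p.2]
             (fun t => g (flow tau t (p.1, 0%R)))))%:E.

Definition recurrent_flow B tau g (i : nat) : Prop :=
  \sum_(1 <= n <oo)
    Zflow B tau (fun p => g p - fine (flow_pressure B tau g))%R n i = +oo.

Definition normalized_potential B tau g (x : borel_seqs) : R :=
  (Delta tau g x - fine (flow_pressure B tau g) * tau x)%R.

(* Here a set is wandering if its preimages under the iterates of some time-[t]
   map, [t > 0], are pairwise disjoint. Asking for disjointness of all the
   preimages [flow t @^-1` W], [t >= 0], would make every sigma-finite invariant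
   measure conservative. *)
Definition conservative_flow B tau (nu : set phase -> \bar R) : Prop :=
  forall t : R, (0 < t)%R -> conservative (suspension B tau) (flow tau t) nu.

Definition lift_measure B tau
    (mu : {measure set borel_seqs -> \bar R}) (A : set phase) : \bar R :=
  let mu_Leb := (mu \x (@lebesgue_measure R)) in
  let Y := suspension B tau in
  if \int[mu]_(x in Sigma B) (tau x)%:E < +oo
  then mu_Leb (A `&` Y) * ((fine (mu_Leb Y))^-1)%:E
  else mu_Leb (A `&` Y).

End suspension.

(* Main.v *)
(* Periodic points of the shift in C_i and closed orbits of the semi-flow through
   C_i are both encoded by loops: words w that start at i and may be followed by
   i. The period of the closed orbit is the Birkhoff sum T(w) of the roof. Hence,
   for p = P_Phi(g) and phi = Delta_g - p tau, the series defining recurrence of g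
   and of phi are both the sum of exp(S phi) over all loops, whose divergence does
   not depend on i. Its truncations to finitely many loops are continuous in the
   parameter t of Delta_g - t tau, so P_sigma(phi) <= 0, with equality when the
   sum diverges. This gives (a) and (c).

   For the upper bound in (b), the sum over all loops converges for t > p: loops
   factor into prime returns to a long cylinder, and each of these takes a time
   bounded from below, which provides a geometric gain. For the lower bound, if
   t < p some window of times carries a large weight of loops of the same number
   of symbols. Concatenations of these have almost the right period, and the
   remaining time is filled by a loop p^j q^(m-j), whose period moves in steps of
   T(p) - T(q) as j grows. These steps can be made smaller than 1 unless the
   periods lie in a discrete group, and then the nonempty windows are hit exactly.

   For (d), the potential phi is damped to phi - 1/(n+1) per symbol. The sums over
   words with a given prefix, normalized by the sum over loops, have ultralimits,
   and domination by the sum over prime loops rules out loss of mass. The limits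
   are an eigenfunction h and consistent masses of cylinders, which define the
   conformal measure m. It is conservative since the iterates of the transfer
   operator on the indicator of C_i sum up to infinity. If W is wandering for the
   time-t map, the orbit of each x spends a total time at most t in W; therefore
   the x whose fiber meets W in measure at least e are visited finitely often
   along each orbit, so that they are null for the shift-invariant measure h dm. *)
Require Import Defs.
From HB Require Import structures.
From mathcomp Require Import all_boot all_order all_algebra.
From mathcomp Require Import all_classical all_reals all_analysis.
From mathcomp Require Import measurable_realfun.
From mathcomp Require Import zify ring lra.
Import Order.TTheory GRing.Theory Num.Theory.
Import numFieldNormedType.Exports.
Local Open Scope classical_set_scope.
Local Open Scope ring_scope.
Local Open Scope ereal_scope.
Set Implicit Arguments.
Unset Strict Implicit.
Unset Printing Implicit Defensive.

(** * Words and loops *)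
Section words.
Variable B : rel nat.
Implicit Types (v w c : seq nat) (x y : borel_seqs).

(** Two obstacles shape the proof. The roof may come arbitrarily close to zero, so a window of times
    contains loops with any number of symbols, and neither quantity controls the other. Moreover,
    sums over words are multiplicative only up to distortion: each concatenation costs a factor up
    to [expR (2 * r 0)], where [r] comes from the tails of the variations and does not depend on the
    length of the words. In products of arbitrarily many factors this would cancel a small geometric
    gain. Loops whose periodic points start with a common long word [c] have distortion
    [2 * r (size c)], which can be made smaller than any gain fixed beforehand; this is why returns
    to a cylinder are used besides mere loops. Lower bounds for sums over products also require
    unique factorization, which comes either from prime factors or from factors with a common number
    of symbols. In (d), limits of sums over infinitely many letters give only inequalities as long
    as mass may escape to large letters; equalities follow because a letter at a suitable position
    belongs to a prime factor, and the sum over primes converges. *)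

Definition scons (a : nat) (x : borel_seqs) : borel_seqs :=
  fun n => if n is n'.+1 then x n' else a.

Fixpoint glue v x : borel_seqs := if v is a :: v' then scons a (glue v' x) else x.

Lemma glue_cat v w x : glue (v ++ w) x = glue v (glue w x).
Proof. by elim: v => //= a v ->. Qed.

Lemma glueE v x n :
  glue v x n = if (n < size v)%N then nth 0%N v n else x (n - size v)%N.
Proof.
by elim: v n => [|a v IH] [|n] //=.
Qed.

Lemma iter_shiftE k x n : iter k left_shift x n = x (n + k)%N.
Proof.
by elim: k n => [|k IH] n /=; rewrite ?addn0// /left_shift IH addSnnS.
Qed.

Lemma iter_shift_glue v x : iter (size v) left_shift (glue v x) = x.
Proof.
apply/funext => n; rewrite iter_shiftE glueE ltnNge leq_addl /= addnK//.
Qed.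

Lemma scons_shift x : scons (x 0%N) (left_shift x) = x.
Proof. by apply/funext => -[|n]. Qed.

Lemma glue_mkseq x n : glue (mkseq x n) (iter n left_shift x) = x.
Proof.
apply/funext => k; rewrite glueE size_mkseq; case: ltnP => h.
  by rewrite nth_mkseq.
by rewrite iter_shiftE subnK.
Qed.

Lemma Sigma_scons a x : Sigma B (scons a x) <-> B a (x 0%N) /\ Sigma B x.
Proof.
split=> [h|[h1 h2] [|n]//=].
by split=> [|n]; [exact: (h 0%N)|exact: (h n.+1)].
Qed.

Lemma Sigma_shift x : Sigma B x -> Sigma B (left_shift x).
Proof. by move=> h n; exact: h. Qed.

Lemma Sigma_iter k x : Sigma B x -> Sigma B (iter k left_shift x).
Proof. by move=> h; elim: k => //= k IH; exact: Sigma_shift. Qed.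

Lemma Sigma_glue v x : Sigma B (glue v x) -> Sigma B x.
Proof. by elim: v => //= a v IH /Sigma_scons[_ /IH]. Qed.

Lemma Sigma_glue_path a v x :
  Sigma B (glue (a :: v) x) <-> path B a (rcons v (x 0%N)) /\ Sigma B x.
Proof.
elim: v a => [|b v IH] a; first by rewrite /= andbT; exact: Sigma_scons.
have := IH b; rewrite /= => {}IH.
rewrite Sigma_scons IH /=; split.
  by move=> [-> [-> ?]].
by move=> [/andP[-> ->] ?].
Qed.

Lemma Sigma_glueS v x y : Sigma B (glue v x) -> x 0%N = y 0%N -> Sigma B y ->
  Sigma B (glue v y).
Proof.
case: v => [//|a v] /Sigma_glue_path[h _] e hy.
by apply/Sigma_glue_path; rewrite -e.
Qed.

Definition per w : borel_seqs := fun n => nth 0%N w (n %% size w).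

Lemma glue_per w : glue w (per w) = per w.
Proof.
apply/funext => n; rewrite glueE /per; case: ltnP => h.
  by rewrite modn_small.
by rewrite -[in RHS](subnK h) modnDr.
Qed.

Lemma iter_shift_per w : iter (size w) left_shift (per w) = per w.
Proof. by rewrite -{1}[per w]glue_per iter_shift_glue. Qed.

Lemma per_uniq w x : w != [::] -> glue w x = x -> x = per w.
Proof.
move=> w0 e; apply/funext => n; have [m] := ubnP n; elim: m n => // m IH n hn.
rewrite -{1}e -glue_per !glueE; case: ifP => // /negbT; rewrite -leqNgt => h.
apply: IH; apply: leq_trans (_ : n <= m)%N; last by [].
by rewrite ltn_subrL lt0n size_eq0 w0 (leq_trans _ h)// lt0n size_eq0.
Qed.

Lemma per_catC v w : v ++ w != [::] -> glue v (per (w ++ v)) = per (v ++ w).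
Proof.
move=> h; apply: per_uniq => //.
by rewrite -glue_cat -catA glue_cat glue_per.
Qed.

(* [w] starts at [a] and may be followed by [b] (which is not part of [w]), so
   that walks compose by concatenation. *)
Definition walk (a b : nat) w : bool :=
  (ohead w == Some a) && path B a (rcons (behead w) b).

Definition loop (i : nat) w : bool := walk i i w.

Lemma walk_cat a b d v w : walk a b v -> walk b d w -> walk a d (v ++ w).
Proof.
case: v => [//|a' v]; case: w => [//|b' w].
move=> /andP[/eqP[->] hv] /andP[/eqP[->] hw].
rewrite /walk /= eqxx /= rcons_cat /= -cat_rcons cat_path hv /=.
by rewrite last_rcons.
Qed.

Lemma walk_glue a b w x : walk a b w -> cylinder B b x -> cylinder B a (glue w x).
Proof.
case: w => [//|a' w] /andP[/eqP[->] /= hp] [hx x0]; split=> //.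
by apply/Sigma_glue_path; rewrite x0.
Qed.

Lemma mixing_walk a b : topologically_mixing B -> exists w, walk a b w.
Proof.
move=> /(_ a b)[N /(_ N.+2)[]]; first by lia.
case=> [|a' w] [sw pw h l]; first by [].
move: h sw pw l => /= -> [].
elim/last_ind: w => [//|w b' _] _ pw; rewrite last_rcons => <-.
by exists (a :: w); rewrite /walk eqxx.
Qed.

Lemma loop_neq0 i w : loop i w -> w != [::]. Proof. by case: w. Qed.

Lemma loop_size i w : loop i w -> (0 < size w)%N. Proof. by case: w. Qed.

Lemma loop_cat i v w : loop i v -> loop i w -> loop i (v ++ w).
Proof. exact: walk_cat. Qed.

Lemma loop_Sigma i w : loop i w -> Sigma B (per w).
Proof.
case: w => [//|a w] /andP[/eqP[->]] /= hp n.
have kp : (0 < (size w).+1)%N by [].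
have /(pathP 0%N) := hp => /(_ (n %% (size w).+1)%N).
rewrite size_rcons ltn_pmod// => /(_ erefl).
rewrite -[i :: rcons w i]/(rcons (i :: w) i) !nth_rcons /= ltn_pmod//.
rewrite /per /=.
have -> : (n.+1 %% (size w).+1 = (n %% (size w).+1).+1 %% (size w).+1)%N.
  by rewrite -(addn1 (n %% _)) -(addn1 n) modnDml.
set m := (n %% _)%N.
have hm : (m < (size w).+1)%N by rewrite ltn_pmod.
case: (ltnP m (size w)) => h.
  by rewrite modn_small.
have -> : m = size w by lia.
by rewrite eqxx modnn.
Qed.

Lemma per0 i w : loop i w -> per w 0%N = i.
Proof. by case: w => [//|a w] /andP[/eqP[->]] _; rewrite /per mod0n. Qed.

Lemma cylinder_per i w : loop i w -> cylinder B i (per w).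
Proof. by move=> h; split; [exact: loop_Sigma h|exact: per0]. Qed.

Lemma loop_glue i w x : loop i w -> cylinder B i x -> cylinder B i (glue w x).
Proof. exact: walk_glue. Qed.

Lemma loop_mkseq x n i : cylinder B i x -> (0 < n)%N -> iter n left_shift x = x ->
  loop i (mkseq x n) /\ per (mkseq x n) = x.
Proof.
move=> [hx x0] n0 e; have g0 := glue_mkseq x n; rewrite e in g0.
split; last first.
  apply/esym/per_uniq => //.
  by rewrite -size_eq0 size_mkseq -lt0n.
case: n n0 {e} g0 => // n _ g.
have : Sigma B (glue (x 0%N :: map x (iota 1 n)) x) by move: hx; rewrite -{1}g.
by move=> /Sigma_glue_path[+ _]; rewrite /loop /walk /= x0 eqxx.
Qed.

Section potential.
Context {R : realType}.
Implicit Types f : borel_seqs -> R.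

(** The Birkhoff sum of [f] over the first [size v] points of the orbit of [glue v x]. The
    continuation [x] is a separate argument because distortion compares one word with different
    continuations. *)
Fixpoint wsum f v x : R :=
  if v is a :: v' then (f (glue v x) + wsum f v' x)%R else 0%R.

Definition lsum f w : R := wsum f w (per w).

Lemma wsum_cat f v w x : wsum f (v ++ w) x = (wsum f v (glue w x) + wsum f w x)%R.
Proof. by elim: v => [|a v IH] /=; rewrite ?add0r// IH glue_cat addrA. Qed.

Lemma birkhoffS f n x : birkhoff f n.+1 x = (f x + birkhoff f n (left_shift x))%R.
Proof.
rewrite /birkhoff big_ord_recl /=; congr (_ + _)%R.
by apply: eq_bigr => k _ /=; rewrite -iterSr.
Qed.

Lemma birkhoffD f m n x :
  birkhoff f (m + n) x = (birkhoff f m x + birkhoff f n (iter m left_shift x))%R.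
Proof.
elim: m x => [|m IH] x; first by rewrite /birkhoff big_ord0 add0r.
by rewrite addSn !birkhoffS IH -iterSr addrA.
Qed.

Lemma birkhoff_wsum f v x : birkhoff f (size v) (glue v x) = wsum f v x.
Proof.
elim: v => [|a v IH] /=; first by rewrite /birkhoff big_ord0.
by rewrite birkhoffS -IH.
Qed.

Lemma lsum_birkhoff f w : lsum f w = birkhoff f (size w) (per w).
Proof. by rewrite /lsum -birkhoff_wsum glue_per. Qed.

Lemma wsumB f g t v x :
  wsum (fun z => f z - t * g z)%R v x = (wsum f v x - t * wsum g v x)%R.
Proof. by elim: v => [|a v IH] /=; rewrite ?mulr0 ?subr0// IH; ring. Qed.

Lemma lsumB f g t v :
  lsum (fun z => f z - t * g z)%R v = (lsum f v - t * lsum g v)%R.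
Proof. exact: wsumB. Qed.

(* The bound [r L] is uniform in the length of the word [v]. *)
Definition walters f (r : nat -> R) := [/\ r @ \oo --> (0 : R)%R,
  forall L, (0 <= r L)%R &
  forall v x y L, Sigma B (glue v x) -> Sigma B (glue v y) ->
   (forall j, (j < L)%N -> x j = y j) -> (`|wsum f v x - wsum f v y| <= r L)%R].

Lemma waltersB f g r s t : walters f r -> walters g s ->
  walters (fun z => f z - t * g z)%R (fun L => r L + `|t| * s L)%R.
Proof.
move=> [r0 rp hr] [s0 sp hs]; split.
- rewrite -[X in _ --> X](addr0 (0:R)%R) -[X in (_ + X)%R](mulr0 `|t|%R).
  by apply: cvgD => //; apply: cvgM => //; exact: cvg_cst.
- by move=> L; rewrite addr_ge0// mulr_ge0.
move=> v x y L hx hy e; rewrite !wsumB.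
have -> : (wsum f v x - t * wsum g v x - (wsum f v y - t * wsum g v y) =
  (wsum f v x - wsum f v y) - t * (wsum g v x - wsum g v y))%R by ring.
rewrite (le_trans (ler_normB _ _))// lerD ?hr// normrM ler_wpM2l// hs//.
Qed.

Lemma var_n_ge0 f n : Sigma B !=set0 -> 0 <= var_n B f n.
Proof.
move=> [z hz]; apply: ereal_sup_ubound; exists z, z; split=> //.
by rewrite subrr normr0.
Qed.

(** The [k]-th shifts of [glue v x] and [glue v y] agree in their first [L + size v - k]
    coordinates, so the sums differ by at most the tail of the variations beyond [L], however long
    [v] is. *)
Lemma summable_variations_walters f : Sigma B !=set0 ->
  summable_variations B f -> exists r, walters f r.
Proof.
move=> hne hf; pose V n : \bar R := var_n B f n.
have V0 n : 0 <= V n by exact: var_n_ge0.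
pose T L := \sum_(L.+1 <= n <oo) V n.
have T0 L : 0 <= T L by apply: nneseries_ge0.
have TS L : T L = V L.+1 + T L.+1.
  by rewrite /T (nneseries_split _ 1)// addn1 big_nat1.
have Tfin L : T L \is a fin_num.
  have : T L < +oo.
    elim: L => [|L IH]; first exact: hf.
    by apply: le_lt_trans IH; rewrite [leRHS]TS leeDr.
  by move=> h; rewrite ge0_fin_numE.
exists (fine \o T); split.
- have TE L : T L = \sum_(L <= k <oo) V k.+1.
    rewrite /T -(nneseries_addn L.+1)// -(@nneseries_addn _ (fun k => V k.+1) L)//.
    by apply: eq_eseriesr => i _; rewrite addnS.
  apply: fine_cvg; rewrite (_ : T = fun L => \sum_(L <= k <oo) V k.+1); last exact/funext.
  apply: nneseries_tail_cvg => [|k _]; last exact: V0.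
  by rewrite -TE; exact: hf.
- by move=> L; rewrite /= fine_ge0.
move=> v x y L hx hy e.
(* The bound is sharpened to a finite part of the tail, since the induction on [v] adds one
   variation per letter and has to record which ones are used up. *)
suff : (`|wsum f v x - wsum f v y|%:E <= T L - T (L + size v)%N).
  rewrite /= -(fineK (Tfin L)) -(fineK (Tfin (L + _)%N)) -EFinB lee_fin.
  by move/le_trans; apply; rewrite gerBl fine_ge0.
elim: v hx hy => [|a v IH] /= hx hy.
  by rewrite subrr normr0 addn0 subee.
have [_ hx'] := (Sigma_scons a _).1 hx; have [_ hy'] := (Sigma_scons a _).1 hy.
have {}IH := IH hx' hy'.
have hV : (`|f (scons a (glue v x)) - f (scons a (glue v y))|%:E <= V (L + size v).+1).
  apply: ereal_sup_ubound; exists (scons a (glue v x)), (scons a (glue v y)).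
  split=> // -[|i] //= hi; rewrite !glueE; case: ltnP => // h.
  by apply: e; lia.
apply: (@le_trans _ _ (V (L + size v).+1 + (T L - T (L + size v)%N))).
  apply: le_trans (leeD hV IH); rewrite -EFinD lee_fin.
  apply: le_trans (ler_normD _ _).
  by rewrite le_eqVlt; apply/orP; left; apply/eqP; congr (`|_|%R); ring.
rewrite (TS (L + _)%N) addnS.
have Vf : V (L + size v).+1 \is a fin_num.
  rewrite ge0_fin_numE//; apply: le_lt_trans (_ : T (L + size v)%N < +oo).
    by rewrite TS leeDl.
  by rewrite ltey_eq Tfin.
move: (Tfin L) Vf (Tfin (L + size v).+1).
move: (T L) (V _) (T _.+1) => [t| |] [u| |] [w| |] // _ _ _.
by rewrite lee_fin; lra.
Qed.

End potential.
End words.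

Section returns.
Implicit Types (c u v w : seq nat).

(* That is, [per u] starts with [c], which may be longer than [u]. *)
Definition ret c u : bool := prefix c (u ++ c).

Lemma ret_nil c : ret c [::]. Proof. exact: prefix_refl. Qed.

Lemma ret_cat c u v : ret c u -> ret c v -> ret c (u ++ v).
Proof.
rewrite /ret => hu hv; apply: (prefix_trans hu).
by rewrite -catA prefix_catr// eqxx.
Qed.

Lemma prefix_nth {c w j} : prefix c w -> (j < size c)%N -> nth 0%N w j = nth 0%N c j.
Proof. by move=> /prefixP[d ->] h; rewrite nth_cat h. Qed.

Lemma ret_per c u j : u != [::] -> ret c u -> (j < size c)%N -> per u j = nth 0%N c j.
Proof.
move=> u0 hu; have [m] := ubnP j; elim: m j => // m IH j hm hj.
rewrite -(prefix_nth (w := u ++ c) hu hj) nth_cat -glue_per glueE; case: ltnP => // h.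
have su : (0 < size u)%N by rewrite lt0n size_eq0.
by rewrite IH //; lia.
Qed.

Lemma ret_catl c c' u : ret (c ++ c') u -> ret c u.
Proof.
rewrite /ret => h.
have : prefix c (u ++ c ++ c') by exact: (prefix_trans (prefix_prefix _ _) h).
move=> /prefixP[d e]; apply/prefixP; exists (take (size u) d).
have -> : u ++ c = take (size u + size c) (u ++ c ++ c').
  by rewrite catA -size_cat take_size_cat.
rewrite e take_cat.
case: ltnP => h'; last by rewrite addnK.
have : size u = 0%N by lia.
by move=> ->; rewrite add0n take_size take0 cats0.
Qed.

Lemma ret_self c u : ret c (c ++ u).
Proof. by rewrite /ret -catA prefix_prefix. Qed.

Definition wpow w k := flatten (nseq k w).

Lemma wpow0 w : wpow w 0 = [::]. Proof. by []. Qed.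
Lemma wpowS w k : wpow w k.+1 = w ++ wpow w k. Proof. by []. Qed.
Lemma wpowD w j k : wpow w (j + k) = wpow w j ++ wpow w k.
Proof. by elim: j => // j IH; rewrite addSn !wpowS IH catA. Qed.
Lemma wpow1 w : wpow w 1 = w. Proof. exact: cats0. Qed.
Lemma wpowSr w k : wpow w k.+1 = wpow w k ++ w.
Proof. by rewrite -addn1 wpowD wpow1. Qed.
Lemma size_wpow w k : size (wpow w k) = (k * size w)%N.
Proof. by elim: k => // k IH; rewrite wpowS size_cat IH mulSn. Qed.

Lemma ret_wpow c u k : ret c u -> ret c (wpow u k).
Proof. by move=> h; elim: k => [|k IH]; [exact: ret_nil|exact: ret_cat]. Qed.

Lemma ret_wpow_self u k : ret (wpow u k) u.
Proof. by rewrite /ret -wpowS wpowSr prefix_prefix. Qed.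

Variable B : rel nat.

Lemma loop_ret i w : loop B i w -> ret [:: i] w.
Proof.
by case: w => // a w /andP[/eqP[->]] _; rewrite /ret /= eqxx prefix0s.
Qed.

Lemma loop_wpow i w k : loop B i w -> loop B i (wpow w k.+1).
Proof.
move=> h; elim: k => [|k IH]; first by rewrite wpow1.
by rewrite wpowS loop_cat.
Qed.

Context {R : realType}.
Implicit Types f : borel_seqs -> R.

Lemma lsum_cat2 f v w : v ++ w != [::] ->
  lsum f (v ++ w) = (wsum f v (per (w ++ v)) + wsum f w (per (v ++ w)))%R.
Proof.
move=> h; rewrite /lsum wsum_cat per_catC //.
by case: v w h => [|a v] [|b w].
Qed.

(** Both sides sum over the same periodic orbit, started at different points. *)
Lemma lsum_catC f v w : lsum f (v ++ w) = lsum f (w ++ v).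
Proof.
case: v w => [|a v] [|b w]; rewrite ?cats0//.
by rewrite !lsum_cat2 // addrC.
Qed.

Lemma per_wpow w k : w != [::] -> per (wpow w k.+1) = per w.
Proof.
move=> h; apply/esym/per_uniq; first by case: w h.
by elim: k => [|k IH]; rewrite ?wpow1 ?glue_per// wpowS glue_cat IH glue_per.
Qed.

Lemma lsum_nil f : lsum f [::] = 0%R. Proof. by []. Qed.

Lemma lsum_wpow f w k : lsum f (wpow w k) = (k%:R * lsum f w)%R.
Proof.
case: k => [|k]; first by rewrite mul0r.
case: w => [|a w]; first by rewrite (_ : wpow [::] _ = [::]) ?mulr0//; elim: k.
rewrite /lsum per_wpow//.
elim: (k.+1) => [|m IH]; first by rewrite mul0r.
rewrite wpowSr wsum_cat glue_per IH.
by rewrite -natr1 mulrDl mul1r.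
Qed.

Section distortion.
Variables (f : borel_seqs -> R) (r : nat -> R) (W : walters B f r).

(** In [v ++ w] the letters of [v] are followed by [per (w ++ v)], in the loop [v] alone by [per v].
    Both continuations start with [c], and likewise for [w], so each of the two parts contributes
    one error [r (size c)]. *)
Lemma lsum_dist i c v w : loop B i v -> loop B i w -> ret c v -> ret c w ->
  (`|lsum f (v ++ w) - (lsum f v + lsum f w)| <= 2 * r (size c))%R.
Proof.
move=> lv lw cv word_weight; have [_ _ hr] := W.
have v0 := loop_neq0 lv; have w0 := loop_neq0 lw.
have vw0 : v ++ w != [::] by case: v v0 {lv cv}.
have wv0 : w ++ v != [::] by case: w w0 {lw word_weight vw0}.
have lvw := loop_Sigma (loop_cat lv lw); have lwv := loop_Sigma (loop_cat lw lv).
rewrite lsum_cat2 //.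
have h1 : (`|wsum f v (per (w ++ v)) - lsum f v| <= r (size c))%R.
  apply: hr; rewrite ?per_catC ?glue_per//; first exact: loop_Sigma lv.
  by move=> j hj; rewrite !(ret_per _ _ hj)//; exact: ret_cat.
have h2 : (`|wsum f w (per (v ++ w)) - lsum f w| <= r (size c))%R.
  apply: hr; rewrite ?per_catC ?glue_per//; first exact: loop_Sigma lw.
  by move=> j hj; rewrite !(ret_per _ _ hj)//; exact: ret_cat.
have -> (a b d e : R) : (a + b - (d + e) = (a - d) + (b - e))%R by ring.
by rewrite (le_trans (ler_normD _ _))// mulrDl mul1r lerD.
Qed.

Lemma lsum_dist0 i v w : loop B i v -> loop B i w ->
  (`|lsum f (v ++ w) - (lsum f v + lsum f w)| <= 2 * r 0)%R.
Proof. by move=> lv lw; apply: (@lsum_dist i [::]); rewrite // /ret prefix0s. Qed.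

End distortion.

Lemma wsum_gt0 f v x : (forall y, Sigma B y -> (0 < f y)%R) ->
  v != [::] -> Sigma B (glue v x) -> (0 < wsum f v x)%R.
Proof.
move=> fp; elim: v => // a v IH _ /= h.
rewrite ltr_wpDr ?fp//; case: v IH h => // b v IH h.
by apply/ltW/IH => //; move/Sigma_scons: h => [].
Qed.

Lemma lsum_gt0 f i v : (forall y, Sigma B y -> (0 < f y)%R) ->
  loop B i v -> (0 < lsum f v)%R.
Proof.
move=> fp lv; apply: wsum_gt0 => //; first exact: loop_neq0 lv.
by rewrite glue_per; exact: loop_Sigma lv.
Qed.

End returns.

(** * Gurevich pressure *)

Section esum_extra.
Context {R : realType}.

Lemma sub_esum {T : choiceType} (I J : set T) (a : T -> \bar R) :
  I `<=` J -> \esum_(i in I) a i <= \esum_(i in J) a i.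
Proof.
move=> IJ; apply: ge_ereal_sup => _ [X [fX XI] <-].
by apply: ereal_sup_ubound; exists X => //; split=> // t /XI /IJ.
Qed.

Lemma esum_ge1 {T : choiceType} (I : set T) (a : T -> \bar R) i :
  I i -> (forall j, I j -> 0 <= a j) -> a i <= \esum_(j in I) a j.
Proof.
move=> Ii a0; rewrite -[leLHS](esum_set1 (t := i)); last exact: a0.
by apply: sub_esum => _ ->.
Qed.

Lemma esumZl {T : choiceType} (I : set T) (a : T -> \bar R) (c : \bar R) :
  0 <= c -> (forall i, I i -> 0 <= a i) ->
  \esum_(i in I) (c * a i) = c * \esum_(i in I) a i.
Proof.
move=> c0 a0; case: c c0 => [c| |]// c0.
  rewrite /esum -ereal_supZl//; last first.
    by apply/set0P; exists (\sum_(x \in set0) a x), set0 => //; exact: fsets_set0.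
  have E X : fsets I X -> \sum_(x \in X) (c%:E * a x) = c%:E * \sum_(x \in X) a x.
    move=> [fX XI]; have h x : x \in X -> a x = `|a x|.
      by rewrite inE => /XI /a0 /gee0_abs ->.
    rewrite [in RHS](eq_fsbigr (fun x => `|a x|))//.
    rewrite ge0_mule_fsumr; last by move=> i; exact: abse_ge0.
    by apply: eq_fsbigr => x /h <-.
  congr ereal_sup; apply/seteqP; split=> [_ [X hX <-]|_ [_ [X hX <-] <-]] /=.
    by exists (\sum_(x \in X) a x); [exists X|rewrite E].
  by exists X => //; rewrite E.
have [h|/existsNP[i /not_implyP[Ii ai]]] := pselect (forall i, I i -> a i = 0).
  by rewrite [in RHS]esum1 ?mule0 ?esum1 // => i /h ->; rewrite mule0.
have aip : 0 < a i by rewrite lt0e a0// andbT; apply/eqP.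
have pe : 0 < \esum_(i0 in I) a i0 by apply: (lt_le_trans aip); exact: esum_ge1.
rewrite gt0_mulye//; apply/eqP; rewrite -leye_eq.
apply: (@le_trans _ _ (+oo * a i)); first by rewrite gt0_mulye.
by apply: (@esum_ge1 _ _ (fun j => +oo * a j)) => // j Ij; rewrite mule_ge0// a0.
Qed.

Lemma esumZr {T : choiceType} (I : set T) (a : T -> \bar R) (c : \bar R) :
  0 <= c -> (forall i, I i -> 0 <= a i) ->
  \esum_(i in I) (a i * c) = (\esum_(i in I) a i) * c.
Proof.
move=> c0 a0; rewrite muleC -esumZl//; apply: eq_esum => i _; exact: muleC.
Qed.

Lemma esum_prod {S T : choiceType} (I : set S) (J : set T)
    (a : S -> \bar R) (b : T -> \bar R) :
  (forall i, I i -> 0 <= a i) -> (forall j, J j -> 0 <= b j) ->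
  \esum_(k in I `*` J) (a k.1 * b k.2) = (\esum_(i in I) a i) * \esum_(j in J) b j.
Proof.
move=> a0 b0; rewrite -esumZr//; last exact: esum_ge0.
transitivity (\esum_(i in I) \esum_(j in J) (a i * b j)); last first.
  by apply: eq_esum => i Ii; rewrite esumZl// a0.
by rewrite esum_esum// => i j Ii Jj; rewrite mule_ge0 ?a0 ?b0.
Qed.

(** Concatenation of loops is not injective in general. Choosing one preimage for each point of the
    image gives an injection, which is enough for an upper bound. *)
Lemma esum_image_le {S T : choiceType} (P : set S) (e : S -> T) (a : T -> \bar R) :
  (forall j, 0 <= a j) ->
  \esum_(j in e @` P) a j <= \esum_(i in P) a (e i).
Proof.
move=> a0.
have [->|/set0P[p0 _]] := eqVneq P set0; first by rewrite image_set0 !esum_set0.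
pose s t := xget p0 [set i | P i /\ e i = t].
have sP t : (e @` P) t -> P (s t) /\ e (s t) = t.
  by move=> [i Pi et]; rewrite /s; case: xgetP => [z _ //|/(_ i)]; case.
have -> : \esum_(j in e @` P) a j = \esum_(j in e @` P) a (e (s j)).
  by apply: eq_esum => j /sP[_ ->].
rewrite -(esum_image _ s (fun i => a (e i))); last first.
  by move=> x y; rewrite !inE => /sP[_ hx] /sP[_ hy] h; rewrite -hx -hy h.
by apply: sub_esum => _ [t /sP[h _] <-].
Qed.

Lemma esum_gt_fset {T : choiceType} (I : set T) (a : T -> \bar R) (x : \bar R) :
  x < \esum_(i in I) a i ->
  exists2 X : set T, finite_set X /\ X `<=` I & x < \esum_(i in X) a i.
Proof.
rewrite /esum => /ereal_sup_gt[_ [X [fX XI] <-] h]; exists X => //.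
by apply: (lt_le_trans h); apply: ereal_sup_ubound; exists X => //; exact: fsets_self.
Qed.

End esum_extra.

Section loop_sums.
Context {R : realType}.
Variable B : rel nat.
Implicit Types (f : borel_seqs -> R) (u v w : seq nat).

Definition loop_weight f w : \bar R := (expR (lsum f w))%:E.

Lemma loop_weight_ge0 f w : 0 <= loop_weight f w. Proof. by rewrite lee_fin expR_ge0. Qed.
Lemma loop_weight_gt0 f w : 0 < loop_weight f w. Proof. by rewrite lte_fin expR_gt0. Qed.

Definition loops (i : nat) : set (seq nat) := [set w | loop B i w].

Definition loopsn (i n : nat) : set (seq nat) := [set w | loop B i w /\ size w = n].

(** A word is recovered from its periodic point once its length [n] is known. For [n = 0] every
    point would count as periodic. *)
Lemma ZbaseE f n i : (0 < n)%N -> Zbase B f n i = \esum_(w in loopsn i n) loop_weight f w.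
Proof.
move=> n0; rewrite /Zbase (reindex_esum (loopsn i n) _ per).
  by apply: eq_esum => w [lw <-]; rewrite /loop_weight lsum_birkhoff.
split.
- by move=> w [lw <-]; split; [exact: cylinder_per|exact: iter_shift_per].
- move=> v w; rewrite !inE => -[lv sv] [lw sw] e.
  have h u : loop B i u -> size u = n -> u = mkseq (per u) n.
    move=> lu <-; apply: (@eq_from_nth _ 0%N); rewrite ?size_mkseq// => k hk.
    by rewrite nth_mkseq// -glue_per glueE hk.
  by rewrite (h v)// (h w)// e.
- move=> x [cx ex]; have [l e] := loop_mkseq cx n0 ex.
  exists (mkseq x n) => //; split=> //; exact: size_mkseq.
Qed.

Lemma Zbase_series f i : \sum_(1 <= n <oo) Zbase B f n i = \esum_(w in loops i) loop_weight f w.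
Proof.
have -> : loops i = \bigcup_n loopsn i n.
  by apply/seteqP; split=> [w lw|w [n _ []]//]; exists (size w).
rewrite nneseries_sum_bigcup; last exact: loop_weight_ge0; last first.
  by apply/trivIsetP => m n _ _ mn; rewrite -subset0 => w [[_ sm] [_ sn]];
    move: mn; rewrite -sm sn eqxx.
rewrite nneseries_recl//; last by move=> k _; apply: esum_ge0 => w _; exact: loop_weight_ge0.
rewrite [X in _ = X + _](_ : _ = 0) ?add0e; last first.
  by apply: esum1 => w [+ /size0nil e]; rewrite e.
rewrite -!(@nneseries_addn _ _ 1)//; last 2 first.
- by move=> k; apply: esum_ge0 => w _; exact: loop_weight_ge0.
- by move=> k; apply: esum_ge0 => w _; rewrite lee_fin expR_ge0.
by apply: eq_eseriesr => k _; rewrite addn1 ZbaseE.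
Qed.

Definition catset (G H : set (seq nat)) : set (seq nat) :=
  (fun p => p.1 ++ p.2) @` (G `*` H).

Lemma esum_catset_le f G H (C : R) :
  (forall v w, G v -> H w -> lsum f (v ++ w) <= lsum f v + lsum f w + C)%R ->
  \esum_(w in catset G H) loop_weight f w <=
    (expR C)%:E * ((\esum_(w in G) loop_weight f w) * \esum_(w in H) loop_weight f w).
Proof.
move=> hC; apply: (le_trans (esum_image_le _ _ _)); first by move=> j; exact: loop_weight_ge0.
rewrite -esum_prod; [|by move=> *; exact: loop_weight_ge0..].
rewrite -esumZl//; last by move=> *; rewrite mule_ge0 ?loop_weight_ge0.
apply: le_esum => -[v w] [/= Gv Hw].
by rewrite -!EFinM lee_fin -!expRD ler_expR addrC hC.
Qed.

(** In contrast to the upper bound, a word that arises from several pairs would be counted too often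
    on the left, so factorizations must be unique. *)
Lemma esum_catset_ge f G H (C : R) :
  (forall v w, G v -> H w -> lsum f v + lsum f w - C <= lsum f (v ++ w))%R ->
  (forall v w v' w', G v -> H w -> G v' -> H w' -> v ++ w = v' ++ w' -> v = v' /\ w = w') ->
  (expR (- C))%:E * ((\esum_(w in G) loop_weight f w) * \esum_(w in H) loop_weight f w) <=
    \esum_(w in catset G H) loop_weight f w.
Proof.
move=> hC inj; rewrite /catset esum_image; last first.
  move=> [v w] [v' w']; rewrite !inE => -[/= Gv Hw] [/= Gv' Hw'] e.
  by have [-> ->] := inj _ _ _ _ Gv Hw Gv' Hw' e.
rewrite -esum_prod; [|by move=> *; exact: loop_weight_ge0..].
rewrite -esumZl//; last by move=> *; rewrite mule_ge0 ?loop_weight_ge0.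
apply: le_esum => -[v w] [/= Gv Hw].
by rewrite -!EFinM lee_fin -!expRD ler_expR addrC hC.
Qed.

Lemma esum_map_le f (G H : set (seq nat)) (e : seq nat -> seq nat) (C : R) :
  (forall w, G w -> H (e w)) -> set_inj G e ->
  (forall w, G w -> lsum f w - C <= lsum f (e w))%R ->
  (expR (- C))%:E * (\esum_(w in G) loop_weight f w) <= \esum_(w in H) loop_weight f w.
Proof.
move=> GH inj hC; apply: (@le_trans _ _ (\esum_(w in e @` G) loop_weight f w)); last first.
  by apply: sub_esum => _ [w /GH h <-].
rewrite esum_image// -esumZl//; last by move=> *; exact: loop_weight_ge0.
apply: le_esum => w Gw.
by rewrite -!EFinM lee_fin -!expRD ler_expR addrC hC.
Qed.

Lemma catset_loops i G H : G `<=` loops i -> H `<=` loops i -> catset G H `<=` loops i.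
Proof. by move=> hG hH _ [[v w] [/= /hG hv /hH hw] <-]; exact: loop_cat. Qed.

End loop_sums.

(** * Growth rates of supermultiplicative sequences *)

Section growth_rates.
Context {R : realType}.

(** Order cuts treat finite and infinite limits alike. *)
Lemma cvge_cuts {T : Type} (F : set_system T) {FF : Filter F} (u : T -> \bar R)
    (l : \bar R) :
  (forall a : R, a%:E < l -> \forall x \near F, a%:E < u x) ->
  (forall a : R, l < a%:E -> \forall x \near F, u x < a%:E) ->
  u @ F --> l.
Proof.
case: l => [l| |] hl hu.
- apply/fine_cvgP; have hl1 : (l - 1)%:E < l%:E by rewrite lte_fin ltrBlDr ltrDl.
  have hu1 : l%:E < (l + 1)%:E by rewrite lte_fin ltrDl.
  split.
    near=> x.
    have h1 : (l - 1)%:E < u x by near: x; exact: hl.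
    have h2 : u x < (l + 1)%:E by near: x; exact: hu.
    by rewrite fin_real// (lt_trans (ltNyr _) h1)/= (lt_trans h2 (ltry _)).
  apply/cvgrPdist_lt => e e0; near=> x.
  have : (l - e)%:E < u x by near: x; apply: hl; rewrite lte_fin ltrBlDr ltrDl.
  have : u x < (l + e)%:E by near: x; apply: hu; rewrite lte_fin ltrDl.
  rewrite /=; case: (u x) => [r| |]//=; rewrite !lte_fin ltr_distlC.
  by move=> -> ->.
- by apply/cvgeyPgt => a; apply: hl; rewrite ltry.
- by apply/cvgeNyPlt => a; apply: hu; rewrite ltNyr.
Unshelve. all: by end_near. Qed.

Lemma lt_scaled_lne (n : nat) (z : \bar R) (a : R) : (0 < n)%N -> 0 <= z ->
  (a%:E < (n%:R^-1)%:E * lne z) = ((expR (a * n%:R))%:E < z).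
Proof.
move=> n0 z0; rewrite lte_pdivlMl ?ltr0n// -EFinM mulrC.
rewrite -[X in _ = (X < _)]/(expeR (a * n%:R)%:E) -[X in X < lne _]expeRK.
by rewrite lte_lne// in_itv/= leey andbT// lee_fin expR_ge0.
Qed.

Lemma scaled_lne_lt (n : nat) (z : \bar R) (a : R) : (0 < n)%N -> 0 <= z ->
  ((n%:R^-1)%:E * lne z < a%:E) = (z < (expR (a * n%:R))%:E).
Proof.
move=> n0 z0; rewrite lte_pdivrMl ?ltr0n// -EFinM mulrC.
rewrite -[X in _ = (_ < X)]/(expeR (a * n%:R)%:E) -[X in lne _ < X]expeRK.
by rewrite lte_lne// in_itv/= leey andbT// lee_fin expR_ge0.
Qed.

Lemma cvge_gt {T : Type} (F : set_system T) {FF : Filter F} (u : T -> \bar R)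
    (l a : \bar R) : u @ F --> l -> a < l -> \forall x \near F, a < u x.
Proof. by move=> h al; exact: (h _ (open_ereal_gt' al)). Qed.

Lemma cvge_lt {T : Type} (F : set_system T) {FF : Filter F} (u : T -> \bar R)
    (l a : \bar R) : u @ F --> l -> l < a -> \forall x \near F, u x < a.
Proof. by move=> h al; exact: (h _ (open_ereal_lt' al)). Qed.

Section fekete.
Variables (z : nat -> \bar R) (N : nat).
Hypotheses (z0 : forall n, 0 <= z n)
  (zM : forall m n, (0 < m)%N -> (0 < n)%N -> z m * z n <= z (m + n)%N)
  (zpos : forall n, (N < n)%N -> 0 < z n).

Lemma fekete_pow (a : R) k s q : (0 <= a)%R -> a%:E <= z k -> (0 < k)%N -> (0 < s)%N ->
  (a ^+ q)%:E * z s <= z (q * k + s)%N.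
Proof.
move=> a0 ak k0 s0; elim: q => [|q IH]; first by rewrite expr0 mul1e.
rewrite exprS EFinM -muleA mulSn -addnA.
apply: le_trans (zM k0 _); last by lia.
by apply: lee_pmul => //; rewrite ?lee_fin// mule_ge0// lee_fin exprn_ge0.
Qed.

(** With [n = q * k + s], supermultiplicativity bounds [z n] from below by [z k ^+ q * z s]. The
    remainder [s] is taken in []N, N + k]] instead of [[0, k[], so that [z s] is positive. *)
Lemma fekete_gt (t t' : R) k : (0 < k)%N -> (expR (t * k%:R))%:E < z k ->
  (t' < t)%R -> \forall n \near \oo, (expR (t' * n%:R))%:E < z n.
Proof.
move=> k0 hk tt'.
(* Only finitely many remainders occur, so the factors [z s], some of which may be infinite, have a
   common positive lower bound. *)
have [c c0 hc] : exists2 c : R, (0 < c)%R &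
    forall s, (N < s <= N + k)%N -> (c%:E <= z s).
  elim: k {k0 hk} => [|k [c c0 hc]]; first by exists 1%R => // s; lia.
  have := zpos (ltn_addr k (ltnSn N)); rewrite addSn -addnS.
  have [zy|] := eqVneq (z (N + k.+1)%N) +oo.
    move=> _; exists c => // s hs; have [->|ns] := eqVneq s (N + k.+1)%N.
      by rewrite zy leey.
    by apply: hc; lia.
  move=> zy zp.
  have zf : z (N + k.+1)%N \is a fin_num by rewrite ge0_fin_numE// ltey.
  exists (Num.min c (fine (z (N + k.+1)%N))).
    by rewrite lt_min c0/= fine_gt0// zp/= ltey.
  move=> s hs; have [->|ns] := eqVneq s (N + k.+1)%N.
    by rewrite -[leRHS]fineK// lee_fin ge_min lexx orbT.
  apply: le_trans (hc s _); last by lia.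
  by rewrite lee_fin ge_min lexx.
(* [K] collects what does not grow with [n]: the part of the exponent lost to the remainder and the
   logarithm of [c]. The slack [(t - t') * n] eventually exceeds it. *)
pose K : R := (`|t| * (N + k)%:R + `|ln c| + 1)%R.
near=> n.
have nN : (N + k < n)%N by near: n; exists (N + k).+1.
have nK : (K < (t - t') * n%:R)%R.
  rewrite mulrC -ltr_pdivrMr ?subr_gt0//; near: n; exact: nbhs_infty_gtr.
pose q := ((n - N.+1) %/ k)%N; pose s := (n - q * k)%N.
have hq : (q * k <= n - N.+1 < q * k + k)%N.
  by rewrite leq_divM /= -mulSnr ltn_ceil.
have hs : (N < s <= N + k)%N by rewrite /s; lia.
have -> : n = (q * k + s)%N by rewrite /s; lia.
apply: lt_le_trans (fekete_pow _ (expR_ge0 _) (ltW hk) k0 _); last by lia.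
apply: (@lt_le_trans _ _ ((expR (t * k%:R) ^+ q)%:E * c%:E)); last first.
  by apply: lee_wpmul2l; [rewrite lee_fin exprn_ge0// expR_ge0|exact: hc].
rewrite -EFinM lte_fin -expRM_natl -(lnK c0) -expRD ltr_expR.
have -> : (q * k + s)%N = n by rewrite /s; lia.
have e : (q%:R * (t * k%:R) = t * n%:R - t * s%:R)%R.
  have -> : n%:R = (q%:R * k%:R + s%:R)%R :> R.
    by rewrite -natrM -natrD; congr _%:R; rewrite /s; lia.
  by ring.

rewrite e.
have h1 : (t * s%:R <= `|t| * (N + k)%:R)%R.
  apply: (le_trans (ler_norm _)); rewrite normrM ler_wpM2l// ger0_norm// ler_nat.
  by lia.
have h2 := ler_norm (- ln c); rewrite normrN in h2.
move: nK; rewrite /K mulrBl; lra.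
Unshelve. all: by end_near. Qed.

(** The limit is exhibited as a supremum over single indices because it then bounds every term and
    not only the asymptotic growth. The constant [C] disappears after division by [n]. *)
Lemma fekete_cvg (C : R) : (fun n : nat => (n%:R^-1)%:E * lne ((expR C)%:E * z n)) @ \oo -->
  ereal_sup [set t%:E | t in [set t : R | exists2 k, (0 < k)%N & (expR (t * k%:R))%:E < z k]].
Proof.
set S := [set t%:E | t in _].
apply: cvge_cuts => a.
- move=> /ereal_sup_gt[_ [t [k k0 hk] <-]]; rewrite lte_fin => at_.
  pose t' := ((a + t) / 2)%R.
  have t't : (t' < t)%R by rewrite /t'; lra.
  have at' : (a < t')%R by rewrite /t'; lra.
  have := fekete_gt k0 hk t't; apply: filterS2 (nbhs_infty_gtr (`|C| / (t' - a))%R) => n hn h.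
  have n0 : (0 < n)%N.
    by rewrite -(ltr0n R); apply: le_lt_trans hn; rewrite divr_ge0// subr_ge0 ltW.
  rewrite lt_scaled_lne// ?mule_ge0 ?lee_fin ?expR_ge0//.
  apply: (@le_lt_trans _ _ ((expR C)%:E * (expR (t' * n%:R))%:E)); last first.
    by rewrite lte_pmul2l// lte_fin expR_gt0.
  rewrite -EFinM lee_fin -expRD ler_expR.
  move: hn; rewrite ltr_pdivrMr ?subr_gt0// mulrBr => hn.
  have := ler_norm (- C); rewrite normrN => h2.
  rewrite (mulrC a) (mulrC t'); lra.
- move=> la.
  have [b lb ba] : exists2 b : R, ereal_sup S <= b%:E & (b < a)%R.
    move: la; case: (ereal_sup S) => [r| |]//; last by exists (a - 1)%R; rewrite ?leNye//; lra.
    by rewrite lte_fin => ra; exists r.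
  apply: filterS2 (nbhs_infty_gt 0) (nbhs_infty_gtr (`|C| / ((a - b) / 2))%R) => n n0 hn.
  rewrite scaled_lne_lt// ?mule_ge0 ?lee_fin ?expR_ge0//.
  apply: (@le_lt_trans _ _ ((expR C)%:E * (expR ((a + b) / 2 * n%:R))%:E)).
    rewrite lee_pmul2l// ?lte_fin ?expR_gt0// leNgt; apply/negP => h.
    have : ((a + b) / 2)%:E <= ereal_sup S.
      by apply: ereal_sup_ubound; exists ((a + b) / 2)%R => //; exists n.
    by move=> /le_trans/(_ lb); rewrite lee_fin; lra.
  rewrite -EFinM lte_fin -expRD ltr_expR.
  move: hn; rewrite ltr_pdivrMr; last by lra.
  by have := ler_norm C; rewrite (mulrC n%:R); lra.
Qed.

End fekete.
End growth_rates.

Lemma geometric_lty {R : realType} (q : R) : (0 <= q < 1)%R ->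
  \sum_(n <oo) (q ^+ n)%:E < +oo.
Proof.
move=> /andP[q0 q1]; apply: le_lt_trans (ltry (1 - q)^-1%R).
apply: lime_le; first by apply: is_cvg_nneseries => n _ _; rewrite lee_fin exprn_ge0.
apply: nearW => n; rewrite sumEFin lee_fin.
have q1' : (0 < 1 - q)%R by lra.
rewrite -[leRHS]mul1r ler_pdivlMr//.
have -> : ((\sum_(0 <= i < n) q ^+ i) * (1 - q) = 1 - q ^+ n)%R.
  elim: n => [|n IH]; first by rewrite big_nil mul0r expr0 subrr.
  by rewrite big_nat_recr//= mulrDl IH exprS; ring.
by rewrite gerBl exprn_ge0.
Qed.

Section pressure.
Context {R : realType}.
Variable B : rel nat.
Hypothesis hmix : topologically_mixing B.
Implicit Types (u v w : seq nat).

Lemma Zbase_ge0 (f : borel_seqs -> R) n i : 0 <= Zbase B f n i.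
Proof. by apply: esum_ge0 => x _; rewrite lee_fin expR_ge0. Qed.

Lemma loop_exists i : exists u, loop B i u.
Proof. exact: mixing_walk hmix. Qed.

Section one_potential.
Variables (f : borel_seqs -> R) (r : nat -> R) (W : walters B f r).

Lemma lsum_cat_le i v w : loop B i v -> loop B i w ->
  (lsum f (v ++ w) <= lsum f v + lsum f w + 2 * r 0)%R.
Proof. by move=> lv lw; have := lsum_dist0 W lv lw; rewrite ler_norml; lra. Qed.

Lemma lsum_cat_ge i v w : loop B i v -> loop B i w ->
  (lsum f v + lsum f w - 2 * r 0 <= lsum f (v ++ w))%R.
Proof. by move=> lv lw; have := lsum_dist0 W lv lw; rewrite ler_norml; lra. Qed.

Lemma Zbase_super i m n : (0 < m)%N -> (0 < n)%N ->
  (expR (- (2 * r 0)))%:E * (Zbase B f m i * Zbase B f n i) <= Zbase B f (m + n)%N i.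
Proof.
move=> m0 n0; rewrite !ZbaseE ?addn_gt0 ?m0//.
apply: le_trans (esum_catset_ge _ _) _; last first.
- by apply: sub_esum => _ [[v w] [/= [lv <-] [lw <-]] <-]; split; [exact: loop_cat|rewrite size_cat].
- move=> v w v' w' [_ sv] [_ sw] [_ sv'] [_ sw'] e.
  by move/eqP: e; rewrite eqseq_cat ?sv// => /andP[/eqP-> /eqP->].
- by move=> v w [lv _] [lw _]; exact: lsum_cat_ge lv lw.
Qed.

Lemma Zbase_gt0 i : exists N, forall n, (N < n)%N -> 0 < Zbase B f n i.
Proof.
have [N hN] := hmix i i; exists N => n nN.
have n0 : (0 < n)%N by lia.
(* The word has one letter more than the loop: its last letter is the [i] that follows the loop. *)
have [w [sw pw hw lw]] : exists w, [/\ size w = n.+1, sorted B w, head 0%N w = i & last 0%N w = i].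
  by apply: hN; lia.
rewrite ZbaseE//; case: w sw pw hw lw => // a w sw pw /= ha; subst a.
case/lastP: w sw pw => [|w b] sw pw; first by move: sw => /=; lia.
rewrite last_rcons => hb; subst b.
have lw : loop B i (i :: w) by rewrite /loop /walk eqxx.
apply: (lt_le_trans (loop_weight_gt0 f (i :: w))); apply: esum_ge1; last by move=> *; exact: loop_weight_ge0.
by split=> //; move: sw => /=; rewrite size_rcons => -[->].
Qed.

(** [Zbase] is supermultiplicative up to the distortion factor, which the rescaling to [z] absorbs.
    The last clause holds because a single [n] with [1 < z n] would already push the supremum above
    zero. *)
Lemma gurevich_cvg_ : exists l : \bar R,
  [/\ (fun n => (n%:R^-1)%:E * lne (Zbase B f n 0%N)) @ \oo --> l,
   gurevich_pressure B f = l &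
   (l <= 0 -> forall n, (0 < n)%N -> Zbase B f n 0%N <= (expR (2 * r 0))%:E)].
Proof.
pose C := (2 * r 0)%R.
pose z n := (expR (- C))%:E * Zbase B f n 0%N.
have zE n : Zbase B f n 0%N = (expR C)%:E * z n.
  by rewrite /z muleA -EFinM -expRD subrr expR0 mul1e.
have z0 n : 0 <= z n by rewrite mule_ge0 ?Zbase_ge0// lee_fin expR_ge0.
have zM m n : (0 < m)%N -> (0 < n)%N -> z m * z n <= z (m + n)%N.
  move=> m0 n0; rewrite /z muleACA -muleA; apply: lee_wpmul2l; first by rewrite lee_fin expR_ge0.
  exact: Zbase_super.
have [N hN] := Zbase_gt0 0%N.
have zp n : (N < n)%N -> 0 < z n by move=> /hN h; rewrite mule_gt0// lte_fin expR_gt0.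
have := fekete_cvg z0 zM zp C.
set l := ereal_sup _.
rewrite (_ : (fun n : nat => _) = (fun n => (n%:R^-1)%:E * lne (Zbase B f n 0%N))); last first.
  by apply/funext => n; rewrite zE.
move=> cl; exists l; split => //; first exact/cvg_lim.
move=> l0 n n0; rewrite leNgt; apply/negP => h.
have z1 : 1 < z n.
  by rewrite /z expRN lte_pdivlMl ?expR_gt0// mule1.
have [t t0 ht] : exists2 t : R, (0 < t)%R & (expR (t * n%:R))%:E < z n.
  case: (z n) z1 => [x| |]// x1; last by exists 1%R => //; rewrite ltry.
  rewrite lte_fin in x1.
  exists (ln x / (2 * n%:R))%R; first by rewrite divr_gt0 ?ln_gt0 ?mulr_gt0 ?ltr0n.
  have nn : (n%:R != 0 :> R)%R by rewrite pnatr_eq0; lia.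
  rewrite (_ : (_ * n%:R = ln x / 2)%R); last by field.
  rewrite lte_fin -[X in (_ < X)%R]lnK ?posrE; last by lra.
  by rewrite ltr_expR; have := ln_gt0 x1; lra.
have : t%:E <= l by apply: ereal_sup_ubound; exists t => //; exists n.
by move=> /le_trans/(_ l0); rewrite lee_fin; lra.
Qed.

Lemma gurevich_cvg :
  (fun n => (n%:R^-1)%:E * lne (Zbase B f n 0%N)) @ \oo --> gurevich_pressure B f.
Proof. by have [l [h -> _]] := gurevich_cvg_. Qed.

Lemma gurevich_le0 : gurevich_pressure B f <= 0 ->
  forall n, (0 < n)%N -> Zbase B f n 0%N <= (expR (2 * r 0))%:E.
Proof. by have [l [_ -> h]] := gurevich_cvg_. Qed.

Lemma lt_gurevich (a : R) : a%:E < gurevich_pressure B f ->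
  \forall n \near \oo, (expR (a * n%:R))%:E < Zbase B f n 0%N.
Proof.
move=> h; apply: filterS2 (cvge_gt gurevich_cvg h) (nbhs_infty_gt 0) => n hn n0.
by rewrite -lt_scaled_lne// Zbase_ge0.
Qed.

Lemma gurevich_lt (a : R) : gurevich_pressure B f < a%:E ->
  \forall n \near \oo, Zbase B f n 0%N < (expR (a * n%:R))%:E.
Proof.
move=> h; apply: filterS2 (cvge_lt gurevich_cvg h) (nbhs_infty_gt 0) => n hn n0.
by rewrite -scaled_lne_lt// Zbase_ge0.
Qed.

(** Together with [gurevich_le0], nonpositive pressure amounts to boundedness of [Zbase]. The bound
    there is explicit in the distortion, so it can be passed to limits in a parameter. *)
Lemma gurevich_bounded (K : R) : (forall n, (0 < n)%N -> Zbase B f n 0%N <= K%:E) ->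
  gurevich_pressure B f <= 0.
Proof.
move=> hK; rewrite leNgt; apply/negP => h.
have [a a0 ha] : exists2 a : R, (0 < a)%R & a%:E < gurevich_pressure B f.
  case: gurevich_pressure h => [x| |]// x0; last by exists 1%R; rewrite ?ltry.
  by rewrite lte_fin in x0; exists (x / 2)%R; rewrite ?lte_fin; lra.
near \oo => n.
have n0 : (0 < n)%N by near: n; exact: nbhs_infty_gt.
have h1 : (expR (a * n%:R))%:E < Zbase B f n 0%N by near: n; exact: lt_gurevich.
have h2 : (`|K| / a < n%:R)%R by near: n; exact: nbhs_infty_gtr.
have := lt_le_trans h1 (hK n n0); rewrite lte_fin.
apply/negP; rewrite -leNgt; apply: le_trans (ler_norm K) _.
have := expR_ge1Dx (a * n%:R).
by move: h2; rewrite ltr_pdivrMr// mulrC; lra.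
Unshelve. all: by end_near. Qed.

(* A loop at [j] is turned into a loop at [i] by inserting it in a fixed loop. *)
Lemma loop_transfer i j : exists (e : seq nat -> seq nat) (l : nat) (C : R),
  [/\ injective e, forall w, size (e w) = (size w + l)%N,
   forall w, loop B j w -> loop B i (e w) &
   forall w, loop B j w -> (lsum f w - C <= lsum f (e w))%R].
Proof.
have [a wa] := mixing_walk i j hmix; have [b wb] := mixing_walk j i hmix.
exists (fun w => a ++ w ++ b), (size a + size b)%N, (2 * r 0 - lsum f (b ++ a))%R; split.
- move=> v w /eqP; rewrite eqseq_cat// eqxx /= => /eqP e.
  have sv : size v = size w by move: (congr1 size e); rewrite !size_cat => /addIn.
  by move/eqP: e; rewrite eqseq_cat// => /andP[/eqP].
- by move=> w; rewrite !size_cat; lia.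
- by move=> w lw; exact: (walk_cat wa (walk_cat lw wb)).
move=> w lw; rewrite [lsum f (a ++ _)]lsum_catC -catA.
have := lsum_cat_ge lw (walk_cat wb wa); lra.
Qed.

Lemma Zbase_transfer i j : exists (l : nat) (C : R), forall n, (0 < n)%N ->
  (expR (- C))%:E * Zbase B f n j <= Zbase B f (n + l)%N i.
Proof.
have [e [l [C [ei es el eC]]]] := loop_transfer i j; exists l, C => n n0.
rewrite !ZbaseE ?addn_gt0 ?n0//.
apply: (@esum_map_le _ f _ _ e).
- by move=> w [lw sw]; split; [exact: el|rewrite es sw].
- by move=> v w _ _; exact: ei.
- by move=> w [lw _]; exact: eC.
Qed.

Lemma loops_transfer i j : exists C : R,
  (expR (- C))%:E * (\esum_(w in loops B j) loop_weight f w) <= \esum_(w in loops B i) loop_weight f w.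
Proof.
have [e [l [C [ei es el eC]]]] := loop_transfer i j; exists C.
by apply: (@esum_map_le _ f _ _ e) => // v w _ _; exact: ei.
Qed.

Lemma loops_infinite i j : \esum_(w in loops B i) loop_weight f w = +oo ->
  \esum_(w in loops B j) loop_weight f w = +oo.
Proof.
move=> h; have [C] := loops_transfer j i; rewrite h.
by rewrite gt0_muley ?lte_fin ?expR_gt0// leye_eq => /eqP.
Qed.

Lemma gurevich_lt0_summable : gurevich_pressure B f < 0 ->
  \esum_(w in loops B 0%N) loop_weight f w < +oo.
Proof.
move=> h.
have [a a0 ha] : exists2 a : R, (a < 0)%R & gurevich_pressure B f < a%:E.
  case: gurevich_pressure h => [x| |]// x0; last by exists (-1)%R; rewrite ?ltNyr//; lra.
  by rewrite lte_fin in x0; exists (x / 2)%R; rewrite ?lte_fin; lra.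
have [N _ hN] := gurevich_lt ha.
pose q := expR a; have q0 : (0 < q)%R by exact: expR_gt0.
have q1 : (q < 1)%R by rewrite -expR0 ltr_expR.
(* Before the exponential estimate sets in, the uniform bound [expR (2 * r 0)] is used; it is at
   most [expR (2 * r 0) / q ^+ N * q ^+ n] for [n <= N]. *)
pose K : R := (expR (2 * r 0) / q ^+ N + 1)%R.
have K0 : (0 <= K)%R by rewrite addr_ge0// divr_ge0 ?exprn_ge0 ?expR_ge0 // ltW.
have hK n : Zbase B f n.+1 0%N <= (K * q ^+ n.+1)%:E.
  have qn : (0 < q ^+ n.+1)%R by rewrite exprn_gt0.
  case: (leqP N n.+1) => h'.
    apply: (le_trans (ltW (hN n.+1 h'))); rewrite lee_fin expRM_natr -/q.
    by rewrite ler_peMl ?(ltW qn)// lerDr divr_ge0 ?expR_ge0 ?exprn_ge0// ltW.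
  apply: (le_trans (gurevich_le0 (ltW h) _)) => //; rewrite lee_fin /K [leRHS]mulrDl mul1r.
  apply: ler_wpDr; first exact: ltW.
  rewrite -mulrA ler_peMr ?expR_ge0// mulrC ler_pdivlMr ?exprn_gt0//.
  by rewrite mul1r; apply: ler_wiXn2l; rewrite ?(ltW q0) ?(ltW q1) ?(ltnW h').
rewrite -Zbase_series -(@nneseries_addn _ _ 1)//; last by move=> i; exact: Zbase_ge0.
apply: (@le_lt_trans _ _ (\sum_(n <oo) K%:E * (q ^+ n)%:E)).
  apply: lee_nneseries => n; first by move=> *; exact: Zbase_ge0.
  move=> _; rewrite addn1; apply: (le_trans (hK n)); rewrite EFinM.
  rewrite lee_wpmul2l// lee_fin exprS ler_piMl// ?exprn_ge0// ltW//.
rewrite nneseriesZl; last by move=> n _; rewrite lee_fin exprn_ge0// ltW.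
have G := geometric_lty (q := q); rewrite q1 ltW// in G.
apply: lte_mul_pinfty => //; exact: G.
Qed.

End one_potential.
End pressure.

(** * Prime returns *)

Section esum_union.
Context {R : realType}.

Lemma esumU_le {T : choiceType} (I J : set T) (a : T -> \bar R) :
  (forall i, 0 <= a i) ->
  \esum_(i in I `|` J) a i <= \esum_(i in I) a i + \esum_(i in J) a i.
Proof.
move=> a0; rewrite (@esumID _ _ I)//; apply: leeD; apply: sub_esum.
  by move=> i [].
by move=> i [[]].
Qed.

Lemma esum_bigcup_le {T : choiceType} (F : (set T)^nat) (a : T -> \bar R) :
  (forall i, 0 <= a i) ->
  \esum_(i in \bigcup_n F n) a i <= \sum_(n <oo) \esum_(i in F n) a i.
Proof.
move=> a0; rewrite seqDU_bigcup_eq nneseries_sum_bigcup//.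
apply: lee_nneseries => n; first by move=> *; exact: esum_ge0.
by move=> _; apply: sub_esum => x [].
Qed.

End esum_union.

Section primes.
Variable B : rel nat.
Variables (i : nat) (c : seq nat).
Implicit Types (p u v w : seq nat).

Definition returns : set (seq nat) := [set w | loop B i w /\ ret c w].

(** The indecomposable elements of the semigroup [returns], which is free on them. For [c = [:: i]]
    they are the loops that visit [i] only at their start. *)
Definition primes : set (seq nat) :=
  [set p | returns p /\ forall v w, returns v -> returns w -> p <> v ++ w].

Lemma returns_cat v w : returns v -> returns w -> returns (v ++ w).
Proof. by move=> [lv cv] [lw word_weight]; split; [exact: loop_cat|exact: ret_cat]. Qed.

Lemma returns_factor w : returns w ->
  primes w \/ exists p v, [/\ primes p, returns v & w = p ++ v].
Proof.
have [n] := ubnP (size w); elim: n w => // n IH w hn hw.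
have [hp|hp] := pselect (primes w); first by left.
right; have [u [v [hu hv e]]] : exists u v, [/\ returns u, returns v & w = u ++ v].
  apply: contrapT => h; apply: hp; split=> // u v hu hv e; apply: h.
  by exists u, v.
have [||pu|[p [v' [pp hv' e']]]] := IH u; [|by []|by exists u, v|].
  by have := loop_size hv.1; move: hn; rewrite e size_cat; lia.
by exists p, (v' ++ v); split=> //; [exact: returns_cat|rewrite e e' catA].
Qed.

Lemma prefix_catE x y : prefix c (x ++ y) -> (size c <= size x)%N -> prefix c x.
Proof.
move=> /prefixP[d e] h; apply/prefixP; exists (drop (size c) x).
have := congr1 (take (size c)) e; rewrite takel_cat// take_size_cat// => h'.
by rewrite -[in LHS](cat_take_drop (size c) x) h'.
Qed.

Lemma walk_catr a b u v : u != [::] -> v != [::] -> walk B a b (u ++ v) ->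
  walk B (head 0%N v) b v.
Proof.
case: u => // x u _; case: v => // y v _ /andP[_]; rewrite /walk /= eqxx /=.
by rewrite rcons_cat cat_path /= => /and3P[].
Qed.

(** Suppose [p' = p ++ b] with [b] nonempty. Then [v = b ++ v'] begins with [i], so [b] is a loop,
    and since [v ++ c] and [v' ++ c] both begin with [c], so does [b ++ c]. Thus [b] is a return,
    which contradicts that [p'] is prime. *)
Lemma primes_cat_inj p v p' v' : primes p -> primes p' ->
  (v = [::] \/ returns v) -> (v' = [::] \/ returns v') ->
  p ++ v = p' ++ v' -> p = p' /\ v = v'.
Proof.
wlog : p v p' v' / (size p <= size p')%N.
  move=> H hp hp' hv hv' e; have [h|h] := leqP (size p) (size p'); first exact: H.
  by have [-> ->] := H p' v' p v (ltnW h) hp' hp hv' hv (esym e).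
move=> h hp hp' hv hv' e.
have [b pb] : exists b, p' = p ++ b.
  exists (drop (size p) p'); rewrite -[LHS](cat_take_drop (size p)); congr (_ ++ _).
  by have := congr1 (take (size p)) e; rewrite take_size_cat// takel_cat.
have vb : v = b ++ v'.
  by move/eqP: e; rewrite pb -catA eqseq_cat// eqxx /= => /eqP.
have [b0|b0] := eqVneq b [::]; first by rewrite pb vb b0 cats0.
exfalso; have rv : returns v by case: hv => // v0; move: vb; rewrite v0; case: (b) b0.
have p0 : p != [::] by exact: loop_neq0 hp.1.1.
have rb : returns b; last by case: hp' => _ /(_ p b hp.1 rb).
split.
  have : loop B i (p ++ b) by rewrite -pb; exact: hp'.1.1.
  move=> /(walk_catr p0 b0); suff -> : head 0%N b = i by [].
  move: rv.1; rewrite vb; case: (b) b0 => // x y _ /=.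
  by rewrite /loop /walk /= => /andP[/eqP[]].
have : prefix c (b ++ (v' ++ c)) by rewrite catA -vb; exact: rv.2.
have [d ->] : exists d, v' ++ c = c ++ d.
  by apply/prefixP; case: hv' => [->|[_]//]; exact: prefix_refl.
by rewrite catA => /prefix_catE; apply; rewrite size_cat leq_addl.
Qed.

(** Products of [n.+1] factors; the empty product is avoided because it is not a loop. *)
Fixpoint catpow (X : set (seq nat)) (n : nat) : set (seq nat) :=
  if n is n'.+1 then catset X (catpow X n') else X.

Lemma catpow_returns X n : X `<=` returns -> catpow X n `<=` returns.
Proof.
move=> h; elim: n => // n IH _ [[v w] [/= /h hv /IH hw] <-].
exact: returns_cat.
Qed.

Lemma returns_catpow : returns `<=` \bigcup_n catpow primes n.
Proof.
move=> w hw; have [n] := ubnP (size w); elim: n w hw => // n IH w hw hn.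
have [pw|[p [v [pp hv e]]]] := returns_factor hw; first by exists 0%N.
have [|m _ hm] := IH v hv.
  by have := loop_size pp.1.1; move: hn; rewrite e size_cat; lia.
by exists m.+1 => //; exists (p, v).
Qed.

Context {R : realType}.
Variables (f : borel_seqs -> R) (r : nat -> R) (W : walters B f r).

Let eta : R := (2 * r (size c))%R.

Lemma returns_lsum v w : returns v -> returns w ->
  (lsum f v + lsum f w - eta <= lsum f (v ++ w) <= lsum f v + lsum f w + eta)%R.
Proof.
by move=> [lv cv] [lw word_weight]; have := lsum_dist W lv lw cv word_weight; rewrite ler_norml /eta; lra.
Qed.

Lemma esum_size_le (K : R) N : (0 <= K)%R ->
  (forall n, (0 < n)%N -> Zbase B f n i <= K%:E) ->
  \esum_(w in [set w | loop B i w /\ (size w <= N)%N]) loop_weight f w <= (K *+ N)%:E.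
Proof.
move=> K0 hK; elim: N => [|N IH].
  rewrite esum1 ?mulr0n// => w [+ h].
  by have -> : w = [::] by apply/size0nil/eqP; rewrite -leqn0.
apply: (@le_trans _ _ (\esum_(w in [set w | loop B i w /\ (size w <= N)%N] `|` loopsn B i N.+1) loop_weight f w)).
  apply: sub_esum => w [lw]; rewrite leq_eqVlt => /orP[/eqP h|h]; first by right.
  by left.
apply: le_trans (esumU_le _ _ _) _; first by move=> w; exact: loop_weight_ge0.
by rewrite mulrS EFinD addeC leeD// -ZbaseE// hK.
Qed.

Lemma real_between (x : R) (y : \bar R) : x%:E < y -> exists2 z : R, (x < z)%R & z%:E <= y.
Proof.
case: y => [y| |]//; first by rewrite lte_fin => h; exists y.
by move=> _; exists (x + 1)%R; rewrite ?leey//; lra.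
Qed.

(** If a finite set [X] of primes had a sum above [expR eta], the sums over products of [n.+1]
    factors from [X] would grow exponentially, by unique factorization. But these products have at
    most [n.+1 * M] symbols, and a bounded [Zbase] allows only linear growth in the number of
    symbols. *)
Lemma primes_le (K : R) : (forall n, (0 < n)%N -> Zbase B f n i <= K%:E) ->
  \esum_(w in primes) loop_weight f w <= (expR eta)%:E.
Proof.
move=> hK; rewrite leNgt; apply/negP => /esum_gt_fset[X [fX Xp] hX].
have K0 : (0 <= K)%R by have := le_trans (Zbase_ge0 B f 1 i) (hK 1%N isT); rewrite lee_fin.
have [th th1 hth] : exists2 th : R, (1 < th)%R & th%:E <= (expR (- eta))%:E * \esum_(w in X) loop_weight f w.
  by apply: real_between; rewrite expRN lte_pdivlMl ?expR_gt0// mule1.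
have [M hM] : exists M, forall w, X w -> (size w <= M)%N.
  move/finite_seqP: fX => [s ->]; exists (\max_(w <- s) size w).
  by move=> w /= ws; exact: leq_bigmax_seq.
have Xr : X `<=` returns by move=> w /Xp[].
have lower n : (th ^+ n)%:E <= \esum_(w in catpow X n) loop_weight f w.
  elim: n => [|n IH].
    rewrite expr0; apply: le_trans (ltW hX); rewrite lee_fin -expR0 ler_expR.
    by have [_ h _] := W; rewrite /eta mulr_ge0.
  rewrite exprS EFinM.
  apply: (@le_trans _ _ ((expR (- eta))%:E * ((\esum_(w in X) loop_weight f w) *
    \esum_(w in catpow X n) loop_weight f w))).
    rewrite muleA; apply: lee_pmul => //; rewrite ?lee_fin ?exprn_ge0//; lra.
  apply: esum_catset_ge => [v w hv hw|v w v' w' hv hw hv' hw'].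
    by have /andP[] := returns_lsum (Xr _ hv) (catpow_returns Xr hw).
  apply: primes_cat_inj; [exact: Xp|exact: Xp|right; exact: (catpow_returns Xr hw)|]; right; exact: (catpow_returns Xr hw').
have upper n : \esum_(w in catpow X n) loop_weight f w <= (K *+ (n.+1 * M))%:E.
  apply: le_trans (esum_size_le _ K0 hK); apply: sub_esum => w hw; split.
    exact: (catpow_returns Xr hw).1.
  elim: n w hw => [|n IH] w; first by rewrite mul1n; exact: hM.
  by move=> [[v w'] [/= /hM hv /IH hw'] <-]; rewrite size_cat (mulSn n.+1) leq_add.
(* Writing [th ^+ n] as the square of [expR (a * n)] and using [y <= expR y] gives quadratic growth,
   which beats the linear bound. *)
pose a := (ln th / 2)%R; have a0 : (0 < a)%R by rewrite divr_gt0// ln_gt0.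
have thE n : (th ^+ n = expR (a * n%:R) ^+ 2)%R.
  rewrite -expRM_natl -[in LHS](lnK (x := th)) ?posrE; last by lra.
  by rewrite -expRM_natr; congr expR; rewrite /a; field.
near \oo => n.
have n0 : (0 < n)%N by near: n; exact: nbhs_infty_gt.
have hn : (2 * K * M%:R / a ^+ 2 < n%:R)%R by near: n; exact: nbhs_infty_gtr.
have := le_trans (lower n) (upper n); rewrite lee_fin thE.
apply/negP; rewrite -ltNge.
have h1 : (a * n%:R <= expR (a * n%:R))%R by have := expR_ge1Dx (a * n%:R); lra.
have nn : (1 <= n%:R :> R)%R by rewrite ler1n.
apply: (@lt_le_trans _ _ ((a * n%:R) ^+ 2)%R); last first.
  by rewrite lerXn2r ?nnegrE ?expR_ge0// mulr_ge0// ltW.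
move: hn; rewrite ltr_pdivrMr ?exprn_gt0// => hn.
rewrite -[X in (X < _)%R]mulr_natr natrM -natr1 exprMn.
have KM : (0 <= K * M%:R)%R by rewrite mulr_ge0.
apply: (@le_lt_trans _ _ (n%:R * (2 * K * M%:R))%R); first by nra.
have -> : (a ^+ 2 * n%:R ^+ 2 = n%:R * (n%:R * a ^+ 2))%R by ring.
by rewrite ltr_pM2l ?ltr0n.
Unshelve. all: by end_near. Qed.

(** Every further prime factor contributes at most [expR (- b)] and the distortion [expR eta], so
    the sums over products decrease like the powers of [q < 1]. *)
Lemma returns_summable (b : R) : (eta < b)%R ->
  \esum_(w in primes) loop_weight f w <= (expR (- b))%:E ->
  \esum_(w in returns) loop_weight f w < +oo.
Proof.
move=> hb hp; pose q := expR (eta - b).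
have q01 : (0 <= q < 1)%R by rewrite expR_ge0 -expR0 ltr_expR; lra.
have h n : \esum_(w in catpow primes n) loop_weight f w <= ((expR (- b)) * q ^+ n)%:E.
  elim: n => [|n IH]; first by rewrite expr0 mulr1.
  apply: le_trans (esum_catset_le (C := eta) _) _.
    have pr : primes `<=` returns by move=> u [].
    by move=> v w [hv _] hw; have /andP[] := returns_lsum hv (catpow_returns pr hw).
  apply: (@le_trans _ _ ((expR eta)%:E * ((expR (- b))%:E * ((expR (- b)) * q ^+ n)%:E))).
    apply: lee_wpmul2l; first by rewrite lee_fin expR_ge0.
    by apply: lee_pmul => //; apply: esum_ge0 => *; exact: loop_weight_ge0.
  by rewrite -!EFinM lee_fin exprS /q expRD; rewrite le_eqVlt; apply/orP; left; apply/eqP; ring.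
apply: le_lt_trans (sub_esum _ returns_catpow) _.
apply: le_lt_trans (esum_bigcup_le _ _) _; first by move=> *; exact: loop_weight_ge0.
apply: (@le_lt_trans _ _ (\sum_(n <oo) (expR (- b))%:E * (q ^+ n)%:E)).
  apply: lee_nneseries => n; first by move=> *; apply: esum_ge0 => *; exact: loop_weight_ge0.
  by move=> _; rewrite -EFinM.
rewrite nneseriesZl; last by move=> n _; rewrite lee_fin exprn_ge0// expR_ge0.
by apply: lte_mul_pinfty; rewrite ?lee_fin ?expR_ge0//; exact: geometric_lty.
Qed.

End primes.

(** * Orbits of the semi-flow *)

Section translation.
Context {R : realType}.
Notation leb := (@lebesgue_measure R).

Definition shiftr (a : R) : measurableTypeR R -> measurableTypeR R := fun x => (x - a)%R.

Lemma measurable_shiftr a : measurable_fun setT (shiftr a).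
Proof. by apply: measurable_funB. Qed.

HB.instance Definition _ (a : R) :=
  isMeasurableFun.Build _ _ _ _ (shiftr a) (measurable_shiftr a).

Lemma lebesgue_shift (a : R) (A : set (measurableTypeR R)) : measurable A ->
  pushforward leb (shiftr a) A = leb A.
Proof.
move=> mA; apply/esym/lebesgue_measure_unique => //= _ [[u v]] _ <-.
rewrite /pushforward.
have -> : shiftr a @^-1` `]u, v]%classic = `](u + a)%R, (v + a)%R]%classic :> set R.
  by apply/seteqP; split=> x; rewrite /= !in_itv/= /shiftr ltrBrDr lerBlDr.
rewrite !lebesgue_measure_itv/= !lte_fin ltrD2r.
by case: ifP => // _; rewrite -!EFinB; congr EFin; ring.
Qed.

Lemma integral_shift (a : R) (D : set (measurableTypeR R))
    (f : measurableTypeR R -> \bar R) : measurable D -> measurable_fun D f ->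
  \int[leb]_(x in shiftr a @^-1` D) f (shiftr a x) = \int[leb]_(x in D) f x.
Proof.
move=> mD mf; have ms := measurable_shiftr a.
have ge0 (h : measurableTypeR R -> \bar R) : measurable_fun D h -> (forall x, 0 <= h x) ->
    \int[leb]_(x in shiftr a @^-1` D) h (shiftr a x) = \int[leb]_(x in D) h x.
  move=> mh h0; rewrite -(ge0_integral_pushforward ms)//.
  by apply: eq_measure_integral => A mA _; exact: lebesgue_shift.
rewrite [LHS]integralE [RHS]integralE; congr (_ - _).
  rewrite -(ge0 f^\+ (measurable_funepos mf) (funepos_ge0 f)).
  by apply: eq_integral => x _; rewrite !funeposE.
rewrite -(ge0 f^\- (measurable_funeneg mf) (funeneg_ge0 f)).
by apply: eq_integral => x _; rewrite !funenegE.
Qed.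

Lemma integrable_shift (a : R) (D : set (measurableTypeR R))
    (f : measurableTypeR R -> \bar R) : measurable D -> leb.-integrable D f ->
  leb.-integrable (shiftr a @^-1` D) (f \o shiftr a).
Proof.
move=> mD /integrableP[mf fi]; have ms := measurable_shiftr a; apply/integrableP; split.
  apply: (measurable_comp mD) => //; first by move=> _ [x Dx <-].
  exact: measurable_funTS.
have /= -> := @integral_shift a D (fun x => `|f x|) mD _ => //.
exact: measurableT_comp.
Qed.

Lemma integrable_setU (A D : set (measurableTypeR R)) (f : measurableTypeR R -> \bar R) :
  measurable A -> measurable D -> [disjoint A & D]%classic ->
  leb.-integrable A f -> leb.-integrable D f -> leb.-integrable (A `|` D) f.
Proof.
move=> mA mD dis /integrableP[fA iA] /integrableP[fD iD].
have mf : measurable_fun (A `|` D) f by apply/measurable_funU.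
apply/integrableP; split=> //; rewrite ge0_integral_setU//.
  exact: lte_add_pinfty.
exact: measurableT_comp.
Qed.

Lemma integrable_set1 (a : R) (f : measurableTypeR R -> \bar R) :
  leb.-integrable [set a] f.
Proof. by apply/integrableP; split; [exact: measurable_fun_set1|rewrite integral_set1]. Qed.

End translation.

Lemma birkhoffSr {R : realType} (f : borel_seqs -> R) x n :
  birkhoff f n.+1 x = (birkhoff f n x + f (iter n left_shift x))%R.
Proof. by rewrite /birkhoff big_ord_recr. Qed.

Section flow_orbits.
Context {R : realType}.
Variables (B : rel nat) (tau : borel_seqs -> R).
Hypotheses (tau_gt0 : forall x, Sigma B x -> (0 < tau x)%R)
  (tau_div : forall x, Sigma B x ->
    \sum_(0 <= i <oo) (tau (iter i left_shift x))%:E = +oo).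

Lemma birkhoff_nd x m n : Sigma B x -> (m <= n)%N -> (birkhoff tau m x <= birkhoff tau n x)%R.
Proof.
move=> hx /subnKC <-; rewrite birkhoffD lerDl.
by rewrite /birkhoff sumr_ge0// => k _; apply/ltW/tau_gt0/Sigma_iter/Sigma_iter.
Qed.

Lemma birkhoff0 x : birkhoff tau 0 x = 0%R. Proof. by rewrite /birkhoff big_ord0. Qed.

Lemma birkhoff_ltS x n : Sigma B x -> (birkhoff tau n x < birkhoff tau n.+1 x)%R.
Proof. by move=> hx; rewrite birkhoffSr ltrDl; apply/tau_gt0/Sigma_iter. Qed.

Lemma birkhoff_unbounded x (u : R) : Sigma B x -> exists n, (u < birkhoff tau n x)%R.
Proof.
move=> hx; apply: contrapT => /forallNP h.
have : \sum_(0 <= i <oo) (tau (iter i left_shift x))%:E <= u%:E; last by rewrite tau_div.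
apply: lime_le.
  by apply: is_cvg_nneseries => n _ _; rewrite lee_fin ltW//; apply/tau_gt0/Sigma_iter.
apply: nearW => n; rewrite sumEFin lee_fin big_mkord leNgt; apply/negP; exact: h.
Qed.

Lemma hits_unique x u n : Sigma B x ->
  (birkhoff tau n x <= u < birkhoff tau n.+1 x)%R -> hits tau x u = n.
Proof.
move=> hx /andP[h1 h2]; rewrite /hits.
apply: xget_unique => [|m /andP[h3 h4]]; first by rewrite /= h1.
apply/eqP; rewrite eqn_leq; apply/andP; split; rewrite leqNgt; apply/negP => /(birkhoff_nd hx); lra.
Qed.

Lemma hits_exists x u : Sigma B x -> (0 <= u)%R ->
  exists n, (birkhoff tau n x <= u < birkhoff tau n.+1 x)%R.
Proof.
move=> hx u0; have ex : exists n, (u < birkhoff tau n x)%R by exact: birkhoff_unbounded.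
case: (ex_minnP ex) => -[|n] hn hm; first by move: hn; rewrite birkhoff0; lra.
exists n; rewrite hn andbT leNgt; apply/negP => /hm; lia.
Qed.

Lemma flow_block x n u : Sigma B x -> (birkhoff tau n x <= u < birkhoff tau n.+1 x)%R ->
  flow tau u (x, 0%R) = (iter n left_shift x, (u - birkhoff tau n x)%R).
Proof. by move=> hx h; rewrite /flow /= add0r (hits_unique hx h). Qed.

Lemma flow_fst x u t : flow tau t (x, u) = flow tau (u + t)%R (x, 0%R).
Proof. by rewrite /flow /= add0r. Qed.

Lemma flow_add x s t : Sigma B x -> (0 <= s)%R -> (0 <= t)%R ->
  flow tau t (flow tau s (x, 0%R)) = flow tau (s + t)%R (x, 0%R).
Proof.
move=> hx s0 t0; have [n hn] := hits_exists hx s0.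
rewrite (flow_block hx hn) flow_fst.
set y := iter n left_shift x; have hy : Sigma B y by exact: Sigma_iter.
have u0 : (0 <= s - birkhoff tau n x + t)%R by move/andP: hn => [h _]; lra.
have [m hm] := hits_exists hy u0.
rewrite (flow_block hy hm) (@flow_block x (n + m)) //.
  by rewrite birkhoffD -/y; congr pair; [rewrite addnC iterD|ring].
move: hm; rewrite -addnS !birkhoffD -/y; lra.
Qed.

Lemma flow_iter x s t n : Sigma B x -> (0 <= s)%R -> (0 <= t)%R ->
  iter n (flow tau t) (flow tau s (x, 0%R)) = flow tau (s + n%:R * t)%R (x, 0%R).
Proof.
move=> hx s0 t0; elim: n => [|n IH]; first by rewrite mul0r addr0.
rewrite iterS IH flow_add//; last by rewrite addr_ge0// mulr_ge0.
by rewrite -natr1 mulrDl mul1r addrA.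
Qed.

Lemma flow_suspension x s : Sigma B x -> (0 <= s)%R -> suspension B tau (flow tau s (x, 0%R)).
Proof.
move=> hx s0; have [n hn] := hits_exists hx s0; rewrite (flow_block hx hn).
split; first exact: Sigma_iter.
by move: hn; rewrite birkhoffSr /=; lra.
Qed.

Lemma flow_periodic x s : Sigma B x -> (0 < s)%R ->
  flow tau s (x, 0%R) = (x, 0%R) <->
  exists n, [/\ (0 < n)%N, iter n left_shift x = x & birkhoff tau n x = s].
Proof.
move=> hx s0; split=> [|[n [n0 xn sn]]]; last first.
  by rewrite (@flow_block x n) ?sn ?subrr ?xn// lexx /= -sn; exact: birkhoff_ltS.
have [n hn] := hits_exists hx (ltW s0); rewrite (flow_block hx hn) => -[h1 h2].
exists n; split=> //; last by lra.
by case: n {hn h1} h2 => //; rewrite birkhoff0; lra.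
Qed.

Section integrals.
Variable g : borel_seqs * measurableTypeR R -> R.
Hypothesis g_int : fiber_integrable B tau g.
Notation leb := (@lebesgue_measure R).

(** Induction on the number of blocks: between two hits of the roof the flow is a translation along
    a fiber. At the end of a block the flow has already passed to the next fiber, so blocks are
    compared on open intervals and the endpoints are treated as null sets. *)
Lemma flow_integral x n : Sigma B x ->
  leb.-integrable `[0%R, birkhoff tau n x] (fun t => (g (flow tau t (x, 0%R)))%:E) /\
  Rintegral leb `[0%R, birkhoff tau n x] (fun t => g (flow tau t (x, 0%R))) =
    birkhoff (Delta tau g) n x.
Proof.
move=> hx; pose G t := g (flow tau t (x, 0%R)).
rewrite -/(Rintegral _ _ G).
elim: n => [|n [iG eG]].
  rewrite birkhoff0 set_itv1 /birkhoff big_ord0; split.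
    exact: integrable_set1.
  by rewrite Rintegral_set1.
set a := birkhoff tau n x in iG eG *; set y := iter n left_shift x.
have hy : Sigma B y by exact: Sigma_iter.
have ab : birkhoff tau n.+1 x = (a + tau y)%R by rewrite birkhoffSr.
have ty := tau_gt0 hy.
have a0 : (0 <= a)%R by have := birkhoff_nd hx (leq0n n); rewrite birkhoff0.
have oi : leb.-integrable `]0%R, tau y[ (fun t => (g (y, t))%:E).
  by apply: integrableS (g_int hy) => //; apply: subset_itv; rewrite bnd_simp.
have pre : shiftr a @^-1` `]0%R, tau y[%classic = `]a, (a + tau y)%R[%classic :> set R.
  by apply/seteqP; split=> t; rewrite /= !in_itv/= /shiftr subr_gt0 ltrBlDl.
have Geq t : t \in `]a, (a + tau y)%R[%classic -> G t = g (y, shiftr a t).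
  by rewrite inE/= in_itv/= => ht; rewrite /G (@flow_block x n)// -/a ab; lra.
have mo : measurable (`]0%R, tau y[%classic : set (measurableTypeR R)) by exact: measurable_itv.
have oG : leb.-integrable `]a, (a + tau y)%R[ (EFin \o G).
  have := integrable_shift a mo oi; rewrite pre.
  by apply: eq_integrable => // t ht /=; rewrite Geq.
have bE : `]a, (a + tau y)%R]%classic = `]a, (a + tau y)%R[%classic `|` [set (a + tau y)%R] :> set R.
  by rewrite setUitv1// bnd_simp; lra.
have cG : leb.-integrable `]a, (a + tau y)%R] (EFin \o G).
  rewrite bE; apply: integrable_setU; rewrite -?bE//; last exact: integrable_set1.
  by apply/disj_setPRL => z /= ->; rewrite in_itv/= ltxx andbF.
have U : `[0%R, birkhoff tau n.+1 x]%classic = `[0%R, a]%classic `|` `]a, (a + tau y)%R]%classic :> set R.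
  by rewrite ab; apply: itv_bndbnd_setU; rewrite bnd_simp//; lra.
have dis : [disjoint `[0%R, a]%classic & `]a, (a + tau y)%R]%classic]%classic.
  apply/disj_setPS => z []; rewrite /= !in_itv/= => /andP[_ h1] /andP[h2 _].
  by exfalso; lra.
have iU : leb.-integrable (`[0%R, a]%classic `|` `]a, (a + tau y)%R]%classic) (EFin \o G).
  by apply: integrable_setU.
rewrite U; split => //.
rewrite Rintegral_setU// eG birkhoffSr; congr (_ + _)%R.
rewrite -Rintegral_itv_bndo_bndc// /Delta.
have Dy : Rintegral leb `[0%R, tau y] (fun t => g (y, t)) =
    Rintegral leb `]0%R, tau y[ (fun t => g (y, t)).
  rewrite -Rintegral_itv_obnd_cbnd; last by apply: integrableS (g_int hy) => //; apply: subset_itv; rewrite bnd_simp.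
  by rewrite -Rintegral_itv_bndo_bndc.
rewrite -/y Dy /Rintegral; congr fine.
have /= <- := integral_shift a mo (measurable_int _ oi).
rewrite pre; apply: eq_integral => t ht /=; congr EFin; exact: Geq.
Qed.

End integrals.
End flow_orbits.

Section flow_sums.
Context {R : realType}.
Variables (B : rel nat) (tau : borel_seqs -> R).
Hypotheses (tau_gt0 : forall x, Sigma B x -> (0 < tau x)%R)
  (tau_div : forall x, Sigma B x ->
    \sum_(0 <= i <oo) (tau (iter i left_shift x))%:E = +oo).
Notation leb := (@lebesgue_measure R).
Implicit Types (g : borel_seqs * measurableTypeR R -> R).

Lemma eq_wsum (f1 f2 : borel_seqs -> R) v x : (forall y, Sigma B y -> f1 y = f2 y) ->
  Sigma B (glue v x) -> wsum f1 v x = wsum f2 v x.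
Proof.
move=> h; elim: v => //= a v IH hv; rewrite h//; congr (_ + _)%R; apply: IH.
by have [] := (Sigma_scons B _ _).1 hv.
Qed.

Lemma eq_lsum (f1 f2 : borel_seqs -> R) i w : (forall y, Sigma B y -> f1 y = f2 y) ->
  loop B i w -> lsum f1 w = lsum f2 w.
Proof.
by move=> h lw; apply: eq_wsum => //; rewrite glue_per; exact: loop_Sigma lw.
Qed.

Definition window (i n : nat) : set (seq nat) :=
  [set w | loop B i w /\ (n%:R - 1 < lsum tau w <= n%:R)%R].

Lemma per_inj i n v w : loop B i v -> loop B i w -> size v = n -> size w = n ->
  per v = per w -> v = w.
Proof.
have h u : size u = n -> u = mkseq (per u) n.
  move=> <-; apply: (@eq_from_nth _ 0%N); rewrite ?size_mkseq// => k hk.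
  by rewrite nth_mkseq// -glue_per glueE hk.
by move=> lv lw sv sw e; rewrite (h v)// (h w)// e.
Qed.

Lemma ZflowE g n i : fiber_integrable B tau g -> (0 < n)%N ->
  Zflow B tau g n i = \esum_(w in window i n) loop_weight (Delta tau g) w.
Proof.
move=> g_int n0.
have n1 : (0 <= n%:R - 1 :> R)%R by rewrite subr_ge0 ler1n.
rewrite /Zflow (reindex_esum (window i n) _ (fun w => (per w, lsum tau w))).
  apply: eq_esum => w [lw _] /=; rewrite /loop_weight !lsum_birkhoff.
  by rewrite (flow_integral tau_gt0 g_int _ (loop_Sigma lw)).2.
split.
- move=> w [lw hw] /=; split=> //; first exact: cylinder_per.
  have sx := loop_Sigma lw.
  apply/(flow_periodic tau_gt0 tau_div sx); first by move: hw; lra.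
  by exists (size w); rewrite (loop_size lw) iter_shift_per lsum_birkhoff.
(* The point and the period determine the number of symbols, because the Birkhoff sums of [tau]
   increase strictly; hence they determine the word. *)
- move=> v w; rewrite !inE => -[lv _] [lw _] [e1 e2].
  apply: (per_inj lv lw erefl _ e1).
  have sx := loop_Sigma lw.
  have H m1 m2 : birkhoff tau m1 (per w) = birkhoff tau m2 (per w) -> (m1 <= m2)%N.
    move=> h; rewrite leqNgt; apply/negP => /(birkhoff_nd tau_gt0 sx).
    by have := birkhoff_ltS tau_gt0 m2 sx; lra.
  rewrite !lsum_birkhoff e1 in e2.
  by apply/eqP; rewrite eqn_leq !H.
- move=> [x s] [/= cx hs fx].
  have s0 : (0 < s)%R by lra.
  have [m [m0 xm sm]] := (flow_periodic tau_gt0 tau_div cx.1 s0).1 fx.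
  have [l e] := loop_mkseq cx m0 xm.
  have ls : lsum tau (mkseq x m) = s by rewrite lsum_birkhoff size_mkseq e.
  by exists (mkseq x m); [split=> //; rewrite ls|rewrite e ls].
Qed.

Lemma window_cover i : loops B i = \bigcup_n window i n.
Proof.
apply/seteqP; split=> [w lw|w [n _ []]//].
have T0 := lsum_gt0 tau_gt0 lw.
have ex : exists n : nat, (lsum tau w <= n%:R)%R.
  exists (Num.truncn (lsum tau w)).+1; apply/ltW.
  by have /andP[] := Num.Theory.truncn_itv (ltW T0).
case: (ex_minnP ex) => n hn hm; exists n => //; split=> //; rewrite hn andbT.
rewrite ltNge; apply/negP => h; case: n hn hm h => [|n] hn hm h; first by lra.
have : (n.+1 <= n)%N by apply: hm; move: h; rewrite -natr1 addrK.
by rewrite ltnn.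
Qed.

Lemma window_triv i : trivIset setT (window i).
Proof.
have H m n w : window i m w -> window i n w -> (m <= n)%N.
  move=> [_ hm] [_ hn]; rewrite -ltnS -(ltr_nat R) -natr1; lra.
apply/trivIsetP => m n _ _ /eqP mn; rewrite -subset0 => w [wm wn].
by apply: mn; apply/eqP; rewrite eqn_leq !(H _ _ w).
Qed.

Lemma Zflow_series g i : fiber_integrable B tau g ->
  \sum_(1 <= n <oo) Zflow B tau g n i = \esum_(w in loops B i) loop_weight (Delta tau g) w.
Proof.
move=> g_int; rewrite window_cover nneseries_sum_bigcup; last exact: loop_weight_ge0; last first.
  exact: window_triv.
rewrite nneseries_recl//; last by move=> k _; apply: esum_ge0 => w _; exact: loop_weight_ge0.
rewrite [X in _ = X + _](_ : _ = 0) ?add0e; last first.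
  by apply: esum1 => w [lw hw]; exfalso; have := lsum_gt0 tau_gt0 lw; move: hw; lra.
rewrite -!(@nneseries_addn _ _ 1)//; last 2 first.
- by move=> k; apply: esum_ge0 => w _; exact: loop_weight_ge0.
- by move=> k; apply: esum_ge0 => w _; rewrite lee_fin expR_ge0.
by apply: eq_eseriesr => k _; rewrite addn1 ZflowE.
Qed.

Lemma integrable_cst_itv (t a : R) : leb.-integrable `[0%R, a] (fun _ => t%:E).
Proof.
apply/integrableP; split; first exact: measurable_cst.
rewrite integral_cst//= lebesgue_measure_itv/=.
by case: ifP => _; rewrite ?mule0 ?ltry// -EFinB -EFinM ltry.
Qed.

Lemma fiber_integrableB g (t : R) : fiber_integrable B tau g ->
  fiber_integrable B tau (fun p => g p - t)%R.
Proof.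
move=> hg x hx.
have mI : measurable (`[0%R, tau x]%classic : set (measurableTypeR R)) by exact: measurable_itv.
have := integrableB mI (hg x hx) (integrable_cst_itv t _).
by apply: eq_integrable => // u _; rewrite -EFinB.
Qed.

Lemma DeltaB g (t : R) x : fiber_integrable B tau g -> Sigma B x ->
  Delta tau (fun p => g p - t)%R x = (Delta tau g x - t * tau x)%R.
Proof.
move=> hg hx; rewrite /Delta RintegralB//; [|exact: hg|exact: integrable_cst_itv].
by rewrite Rintegral_cst//= lebesgue_measure_itv/= lte_fin tau_gt0//= subr0.
Qed.

End flow_sums.

(** * The pressure of the semi-flow in terms of the base *)

Section flow_pressure.
Context {R : realType}.
Variables (B : rel nat) (tau D : borel_seqs -> R).
Hypothesis hmix : topologically_mixing B.
Hypothesis (tau_gt0 : forall x, Sigma B x -> (0 < tau x)%R).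
Variables rT rD : nat -> R.
Hypotheses (WT : walters B tau rT) (WD : walters B D rD).

Let phi (t : R) := fun x => (D x - t * tau x)%R.
Let rt (t : R) := fun L => (rD L + `|t| * rT L)%R.
Let W t : walters B (phi t) (rt t) := waltersB t WD WT.

Let S := [set t : R | gurevich_pressure B (phi t) <= 0].

Lemma S_mono t t' : S t -> (t <= t')%R -> S t'.
Proof.
move=> St tt'; apply: (gurevich_bounded hmix (W t')) => n n0.
apply: le_trans (gurevich_le0 hmix (W t) St n0).
rewrite !ZbaseE//; apply: le_esum => w [lw _].
rewrite lee_fin ler_expR !lsumB lerB// ler_wpM2r//.
exact/ltW/(lsum_gt0 tau_gt0 lw).
Qed.

(** The [n]-th power of one loop [u] alone contributes the exponential of [n] times
    [lsum D u - t * lsum tau u] to [Zbase], which stays bounded only if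
    [lsum D u / lsum tau u <= t]. *)
Lemma S_bounded : exists b : R, forall t, S t -> (b <= t)%R.
Proof.
have [u lu] := loop_exists hmix 0; have T0 := lsum_gt0 tau_gt0 lu.
exists (lsum D u / lsum tau u)%R => t St.
rewrite ler_pdivrMr// leNgt; apply/negP => h.
pose d := (lsum D u - t * lsum tau u)%R; have d0 : (0 < d)%R by rewrite subr_gt0.
near \oo => n.
have hn : (2 * rt t 0 / d < n%:R)%R by near: n; exact: nbhs_infty_gtr.
have n0 : (0 < n)%N by near: n; exact: nbhs_infty_gt.
have sn : (0 < n * size u)%N by rewrite muln_gt0 n0 (loop_size lu).
have := gurevich_le0 hmix (W t) St sn; rewrite ZbaseE//.
apply/negP; rewrite -ltNge.
apply: (@lt_le_trans _ _ (loop_weight (phi t) (wpow u n))); last first.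
  apply: esum_ge1 => [|*]; last exact: loop_weight_ge0.
  by split; [case: (n) n0 => // m _; exact: loop_wpow|rewrite size_wpow].
rewrite lte_fin ltr_expR lsum_wpow lsumB -/d.
by move: hn; rewrite ltr_pdivrMr.
Unshelve. all: by end_near. Qed.

Hypothesis hP : ereal_inf [set t%:E | t in S] < +oo.

Lemma pressure_fin : ereal_inf [set t%:E | t in S] \is a fin_num.
Proof.
have [b hb] := S_bounded.
rewrite fin_real// hP andbT; apply: (lt_le_trans (ltNyr b)).
by apply: le_ereal_inf_tmp => _ [t St <-]; rewrite lee_fin hb.
Qed.

Let p := fine (ereal_inf [set t%:E | t in S]).

Lemma pressureE : p%:E = ereal_inf [set t%:E | t in S].
Proof. by rewrite /p fineK// pressure_fin. Qed.

Lemma gt_pressure t : (p < t)%R -> S t.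
Proof.
rewrite -lte_fin pressureE => /ereal_inf_lt[_ [s Ss <-]]; rewrite lte_fin => /ltW.
exact: S_mono.
Qed.

Lemma lt_pressure t : (t < p)%R -> 0 < gurevich_pressure B (phi t).
Proof.
move=> tp; rewrite ltNge; apply/negP => St.
have : p%:E <= t%:E by rewrite pressureE; apply: ereal_inf_lbound; exists t.
by rewrite lee_fin; lra.
Qed.

(* The sums at [p] over a finite set [X] of loops are compared with those at
   [p + s] for [s] so small that [s * lsum tau] is at most 1 on [X]. *)
Lemma S_pressure : S p.
Proof.
pose K := expR (1 + 2 * rt (`|p| + 1)%R 0).
apply: (gurevich_bounded hmix (W p) (K := K)) => n n0.
rewrite ZbaseE// leNgt; apply/negP => /esum_gt_fset[X [fX XI]].
apply/negP; rewrite -leNgt.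
have [M M0 hM] : exists2 M : R, (1 <= M)%R & forall w, X w -> (lsum tau w <= M)%R.
  move/finite_seqP: fX => [s ->]; elim: s => [|w s [M M1 hM]]; first by exists 1%R.
  exists (Num.max M (lsum tau w)); first by rewrite le_max M1.
  move=> v; rewrite /= inE => /orP[/eqP ->|/hM h]; first by rewrite le_max lexx orbT.
  by rewrite le_max h.
pose s := (M^-1)%R.
have s0 : (0 < s)%R by rewrite invr_gt0; lra.
have s1 : (s <= 1)%R by rewrite invf_le1; lra.
have Sp : S (p + s)%R by apply: gt_pressure; rewrite ltrDl.
have h := gurevich_le0 hmix (W (p + s)) Sp n0.
have hK : (2 * rt (p + s) 0 <= 2 * rt (`|p| + 1) 0)%R.
  rewrite ler_wpM2l// /rt lerD2l; have [_ r0 _] := WT; rewrite ler_wpM2r//.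
  rewrite (le_trans (ler_normD _ _))// (le_trans _ (ler_norm _))// lerD2l.
  by rewrite gtr0_norm.
apply: (@le_trans _ _ ((expR 1)%:E * \esum_(w in loopsn B 0 n) loop_weight (phi (p + s)) w)).
  rewrite -esumZl//; last by move=> *; exact: loop_weight_ge0.
  apply: (@le_trans _ _ (\esum_(w in X) ((expR 1)%:E * loop_weight (phi (p + s)) w))); last exact: sub_esum.
  apply: le_esum => w Xw; rewrite -EFinM lee_fin -expRD ler_expR !lsumB.
  have : (s * lsum tau w <= 1)%R by rewrite mulrC ler_pdivrMr ?mul1r ?hM//; lra.
  by rewrite mulrDl; lra.
rewrite -ZbaseE// /K expRD EFinM; apply: lee_wpmul2l; first by rewrite lee_fin expR_ge0.
by apply: (le_trans h); rewrite lee_fin ler_expR.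
Qed.

(** Negative pressure would make the sum over loops converge. *)
Lemma recurrent_gurevich i : \esum_(w in loops B i) loop_weight (phi p) w = +oo ->
  gurevich_pressure B (phi p) = 0.
Proof.
move=> h; apply/eqP; rewrite eq_le; apply/andP; split; first exact: S_pressure.
rewrite leNgt; apply/negP => /(gurevich_lt0_summable hmix (W p)).
by rewrite (loops_infinite hmix (W p) 0 h).
Qed.

Lemma recurrent_baseE (f : borel_seqs -> R) j : gurevich_pressure B f = 0 ->
  recurrent_base B f j <-> \esum_(w in loops B j) loop_weight f w = +oo.
Proof.
move=> h; rewrite /recurrent_base h /= expR0.
have -> : \sum_(1 <= n <oo) (1 ^- n)%:E * Zbase B f n j =
    \sum_(1 <= n <oo) Zbase B f n j.
  by apply: eq_eseriesr => n _; rewrite expr1n invr1 mul1e.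
by rewrite Zbase_series; split=> [[]//|].
Qed.

End flow_pressure.

(** * Growth of sums over loops of given length *)

Section return_times.
Context {R : realType}.
Variables (B : rel nat) (tau : borel_seqs -> R).
Hypothesis (tau_gt0 : forall x, Sigma B x -> (0 < tau x)%R).
Variable rT : nat -> R.
Hypothesis (WT : walters B tau rT).

Lemma walters_small f r (W : @walters B R f r) u (e : R) : u != [::] -> (0 < e)%R ->
  exists M0, forall M, (M0 <= M)%N -> (r (size (wpow u M)) < e)%R.
Proof.
move=> u0 e0; have [r0 rp _] := W.
have /cvgrPdist_lt/(_ e e0)[N _ hN] := r0.
exists N => M NM; have := hN (M * size u)%N; rewrite size_wpow /=.
rewrite sub0r normrN ger0_norm//; apply.
by apply: (leq_trans NM); rewrite leq_pmulr// lt0n size_eq0.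
Qed.

Lemma walters_prefix x y L : Sigma B x -> Sigma B y -> (forall j, (j < L.+1)%N -> x j = y j) ->
  (`|tau x - tau y| <= rT L)%R.
Proof.
move=> hx hy e; have [_ _ h] := WT.
have := h [:: x 0%N] (left_shift x) (left_shift y) L.
rewrite /= !addr0 scons_shift e// scons_shift; apply=> // j hj; exact: (e j.+1).
Qed.

(* Each return to a long cylinder [u^M] takes time at least [tau (per u) / 2]. *)
Lemma return_time i u : loop B i u -> exists M0, forall M, (M0 <= M)%N ->
  forall w, returns B i (wpow u M) w -> (tau (per u) / 2 <= lsum tau w)%R.
Proof.
move=> lu; have u0 := loop_neq0 lu; have su := loop_Sigma lu.
have d0 : (0 < tau (per u) / 2)%R by rewrite divr_gt0// tau_gt0.
have [r0 _ _] := WT.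
have /cvgrPdist_lt/(_ _ d0)[N _ hN] := r0.
exists N.+1 => M NM w [lw word_weight].
have sw := loop_Sigma lw.
have hs : (N.+1 <= size (wpow u M))%N.
  by rewrite size_wpow (leq_trans NM)// leq_pmulr// lt0n size_eq0.
have h : (`|tau (per w) - tau (per u)| <= rT (size (wpow u M)).-1)%R.
  apply: walters_prefix => // j hj; have hj' : (j < size (wpow u M))%N by lia.
  rewrite (ret_per (loop_neq0 lw) word_weight hj') (ret_per u0 _ hj')//.
  exact: ret_wpow_self.
have := hN (size (wpow u M)).-1; rewrite /= sub0r normrN => /(_ _)/= h'.
have {}h' : (`|rT (size (wpow u M)).-1| < tau (per u) / 2)%R by apply: h'; lia.
have h2 : (tau (per w) <= lsum tau w)%R.
  have w0 := loop_neq0 lw; move: (glue_per w) sw; rewrite /lsum.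
  move: (per w) => z; case: (w) w0 => // a v _ e sz; rewrite -{1}e /= lerDl.
  case: v e => // b v e; apply/ltW/(wsum_gt0 tau_gt0) => //.
  have h0 := Sigma_shift sz; rewrite -{1}e in h0.
  exact: h0.
have h3 := le_trans h (ler_norm _).
move: h3; rewrite ler_norml; lra.
Qed.

End return_times.

Section upper_bound.
Context {R : realType}.
Variables (B : rel nat) (tau D : borel_seqs -> R).
Hypothesis hmix : topologically_mixing B.
Hypothesis (tau_gt0 : forall x, Sigma B x -> (0 < tau x)%R).
Variables rT rD : nat -> R.
Hypotheses (WT : walters B tau rT) (WD : walters B D rD).

Let phi (t : R) := fun x => (D x - t * tau x)%R.
Let rt (t : R) := fun L => (rD L + `|t| * rT L)%R.
Let W t : walters B (phi t) (rt t) := waltersB t WD WT.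

(** Passing from [t] to [t'] gains the factor [expR (- ((t' - t) * lsum tau w))] on a loop [w]. As
    the roof has no positive lower bound, this gain is made uniform by restricting to returns to a
    cylinder around a fixed periodic point. *)
Lemma loops_summable i (t t' : R) : gurevich_pressure B (phi t) <= 0 -> (t < t')%R ->
  \esum_(w in loops B i) loop_weight (phi t') w < +oo.
Proof.
move=> St tt'.
have [u lu] := loop_exists hmix i; have u0 := loop_neq0 lu.
have [l [C hC]] := Zbase_transfer hmix (W t) 0 i.
have hK n : (0 < n)%N -> Zbase B (phi t) n i <= (expR (C + 2 * rt t 0))%:E.
  move=> n0; rewrite expRD EFinM -lee_pdivrMl ?expR_gt0// -expRN.
  by apply: (le_trans (hC n n0)); apply: (gurevich_le0 hmix (W t) St); rewrite addn_gt0 n0.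
have [M0 hM0] := return_time tau_gt0 WT lu.
pose d0 := (tau (per u) / 2)%R.
have d0p : (0 < d0)%R by rewrite /d0 divr_gt0// tau_gt0//; exact: loop_Sigma lu.
(* A quarter of the gain, since twice the distortion at [c] is lost in each of two places: in the
   bound for the primes at [t] and in their products at [t']. *)
have e0 : (0 < (t' - t) * d0 / 4)%R by rewrite divr_gt0// mulr_gt0// subr_gt0.
have [M1 hM1] := walters_small (W t) u0 e0.
have [M2 hM2] := walters_small (W t') u0 e0.
pose M := maxn 1 (maxn M0 (maxn M1 M2)).
pose c := wpow u M.
have r1 : (rt t (size c) < (t' - t) * d0 / 4)%R by apply: hM1; rewrite /M; lia.
have r2 : (rt t' (size c) < (t' - t) * d0 / 4)%R by apply: hM2; rewrite /M; lia.
have hT w : returns B i c w -> (d0 <= lsum tau w)%R by apply: hM0; rewrite /M; lia.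
pose b := ((t' - t) * d0 - 2 * rt t (size c))%R.
have hb : (2 * rt t' (size c) < b)%R by rewrite /b; lra.
have fin : \esum_(w in returns B i c) loop_weight (phi t') w < +oo.
  apply: (returns_summable (W t') hb).
  have h := primes_le c (W t) hK.
  apply: (@le_trans _ _ ((expR (- ((t' - t) * d0)))%:E * (\esum_(w in primes B i c) loop_weight (phi t) w))).
    rewrite -esumZl; [|by rewrite lee_fin expR_ge0|by move=> *; exact: loop_weight_ge0].
    apply: le_esum => w [hw _]; rewrite -EFinM lee_fin -expRD ler_expR !lsumB.
    have : (0 <= (t' - t) * (lsum tau w - d0))%R.
      by rewrite mulr_ge0 ?subr_ge0 ?(ltW tt')// hT.
    by lra.
  apply: (@le_trans _ _ ((expR (- ((t' - t) * d0)))%:E * (expR (2 * rt t (size c)))%:E)).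
    by apply: lee_wpmul2l => //; rewrite lee_fin expR_ge0.
  by rewrite -EFinM lee_fin -expRD ler_expR /b; lra.
have lc : loop B i c by rewrite /c /M; case: maxn (leq_maxl 1 (maxn M0 (maxn M1 M2))) => // m _; exact: loop_wpow.
(* Prefixing [c] turns every loop into a return at the price of a constant factor, so summability
   carries over from returns to all loops. *)
have h : (expR (- (2 * rt t' 0 - lsum (phi t') c)))%:E *
    (\esum_(w in loops B i) loop_weight (phi t') w) <= \esum_(w in returns B i c) loop_weight (phi t') w.
  apply: (@esum_map_le _ _ _ _ (fun w => c ++ w)).
  - by move=> w lw; split; [exact: loop_cat|exact: ret_self].
  - by move=> v w _ _ /eqP; rewrite eqseq_cat// => /andP[_ /eqP].
  - by move=> w lw; have := lsum_cat_ge (W t') lc lw; lra.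
move: (le_lt_trans h fin); rewrite -lte_pdivlMl ?expR_gt0//.
by move/lt_le_trans; apply; rewrite leey.
Qed.

End upper_bound.

(** * Gaps between the lengths of loops *)

Section length_spectrum.
Context {R : realType}.
Variables (B : rel nat) (tau : borel_seqs -> R) (i : nat).
Hypothesis hmix : topologically_mixing B.
Hypothesis (tau_gt0 : forall x, Sigma B x -> (0 < tau x)%R).
Variable rT : nat -> R.
Hypothesis (WT : walters B tau rT).
Notation T := (lsum tau).

(* Limits of differences of lengths of loops sharing an arbitrarily long
   cylinder. This is a subgroup of [R] that contains all lengths of loops. *)
Definition length_gaps : set R := [set g | forall c, loop B i c ->
  forall e : R, (0 < e)%R -> exists p q,
   [/\ returns B i c p, returns B i c q & (`|T p - T q - g| < e)%R]].

Lemma returns_dist c v w : returns B i c v -> returns B i c w ->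
  (`|T (v ++ w) - (T v + T w)| <= 2 * rT (size c))%R.
Proof. by move=> [lv cv] [lw word_weight]; exact: (lsum_dist WT lv lw cv word_weight). Qed.

(** Inserting one more copy of [x] into a high power of [x] changes the length by almost exactly
    [T x], since what follows the new copy agrees with [per x] over a long stretch. The prefix [c]
    makes both words returns to [c]. *)
Lemma length_gaps_loop x : loop B i x -> length_gaps (T x).
Proof.
move=> lx c lc e e0; have e2 : (0 < e / 2)%R by rewrite divr_gt0.
have [M0 hM] := walters_small WT (loop_neq0 lx) e2.
pose M := M0.+1.
have lxM : loop B i (wpow x M) by exact: loop_wpow.
exists (c ++ wpow x M.+1), (c ++ wpow x M); split.
- by split; [apply: loop_cat => //; exact: loop_wpow|exact: ret_self].
- by split; [exact: loop_cat|exact: ret_self].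
rewrite (lsum_catC _ c) (lsum_catC _ c) wpowS -catA.
have h : (`|T (x ++ (wpow x M ++ c)) - (T x + T (wpow x M ++ c))| <= 2 * rT (size (wpow x M)))%R.
  apply: returns_dist; split=> //; first exact: ret_wpow_self.
    exact: loop_cat.
  exact: ret_self.
have -> : (T (x ++ wpow x M ++ c) - T (wpow x M ++ c) - T x =
  T (x ++ (wpow x M ++ c)) - (T x + T (wpow x M ++ c)))%R by ring.
by apply: (le_lt_trans h); have := hM M (leqnSn _); lra.
Qed.

Lemma length_gapsN g : length_gaps g -> length_gaps (- g)%R.
Proof.
move=> h c lc e e0; have [p [q [hp hq hpq]]] := h c lc e e0.
exists q, p; split=> //; rewrite -normrN.
by have -> : (- (T q - T p - - g) = T p - T q - g)%R by ring.
Qed.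

Lemma length_gapsD g g' : length_gaps g -> length_gaps g' -> length_gaps (g + g')%R.
Proof.
move=> h h' c lc e e0; have e8 : (0 < e / 8)%R by rewrite divr_gt0.
have [M0 hM] := walters_small WT (loop_neq0 lc) e8.
(* Concatenating returns to [c] costs [2 * rT (size c)] in length, which need not be small. The two
   gaps are therefore realized by returns to a longer cylinder that starts with [c]. *)
pose c' := wpow c M0.+1; have lc' : loop B i c' by exact: loop_wpow.
have rc' : (rT (size c') < e / 8)%R by exact: hM.
have sub : returns B i c' `<=` returns B i c by move=> w [lw word_weight]; split=> //; exact: ret_catl word_weight.
have [p [q [hp hq hpq]]] := h c' lc' _ e8.
have [p' [q' [hp' hq' hpq']]] := h' c' lc' _ e8.
exists (p ++ p'), (q ++ q'); split; [exact/sub/returns_cat|exact/sub/returns_cat|].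
have h1 := returns_dist hp hp'; have h2 := returns_dist hq hq'.
move: h1 h2 hpq hpq'; rewrite !ler_norml !ltr_norml; lra.
Qed.

Lemma length_gapsB g g' : length_gaps g -> length_gaps g' -> length_gaps (g - g')%R.
Proof. by move=> h h'; apply: length_gapsD => //; exact: length_gapsN. Qed.

(* Either some gap lies in ]0, 1[ or the gaps form a discrete group. *)
Lemma length_gap_choice : exists g, [/\ length_gaps g, (0 < g)%R &
  (g < 1)%R \/ forall g', length_gaps g' -> (0 < g')%R -> (g <= g')%R].
Proof.
have [[g [hg g0 g1]]|h] := pselect (exists g, [/\ length_gaps g, (0 < g)%R & (g < 1)%R]).
  by exists g; split=> //; left.
have [u lu] := loop_exists hmix i.
pose P n := `[< exists g : R, [/\ length_gaps g, (0 < g)%R & (g < n%:R)%R] >].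
have ex : exists n, P n.
  exists (Num.truncn (T u)).+1; apply/asboolP; exists (T u); split.
  - exact: length_gaps_loop.
  - exact: lsum_gt0 tau_gt0 lu.
  - by have /andP[] := Num.Theory.truncn_itv (ltW (lsum_gt0 tau_gt0 lu)).
(* With [n] minimal, every positive gap is at least [n - 1], so a positive gap below [g < n] would
   differ from [g] by less than 1. That difference would be a gap in []0, 1[], which is excluded
   here. *)
case: (ex_minnP ex) => n /asboolP[g [hg g0 gn]] hn.
exists g; split=> //; right => g' hg' g'0; rewrite leNgt; apply/negP => g'g.
apply: h; exists (g - g')%R; split; [exact: length_gapsB|by lra|].
case: n gn hn => [|n] gn hn; first by lra.
have : ~~ P n by apply/negP => /hn; rewrite ltnn.
move/asboolPn => h2; have : (n%:R <= g')%R.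
  by rewrite leNgt; apply/negP => h3; apply: h2; exists g'.
by move: gn; rewrite -natr1; lra.
Qed.

Section filling.
Variables (f : borel_seqs -> R) (rf : nat -> R) (Wf : walters B f rf).

(* Words [p^j q^(m-j)] interpolate between [q^m] and [p^m] with small steps of
   length. *)
Definition interp (p q : seq nat) (m j : nat) := wpow p j ++ wpow q (m - j).

Lemma wpow_returns c p k : returns B i c p -> (0 < k)%N -> returns B i c (wpow p k).
Proof.
by move=> [lp cp]; case: k => // k _; split; [exact: loop_wpow|exact: ret_wpow].
Qed.

Lemma interp_returns c p q m j : returns B i c p -> returns B i c q ->
  (0 < m)%N -> (j <= m)%N -> returns B i c (interp p q m j).
Proof.
move=> hp hq m0 jm; rewrite /interp; case: (posnP j) => [->|j0].
  by rewrite wpow0 subn0; exact: wpow_returns.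
have [->|mj] := eqVneq m j; first by rewrite subnn wpow0 cats0; exact: wpow_returns.
by apply: returns_cat; apply: wpow_returns => //; lia.
Qed.

Lemma wpow_lower c p k : returns B i c p ->
  (- (k%:R * (`|lsum f p| + 2 * rf 0)) <= lsum f (wpow p k))%R.
Proof.
move=> [lp _]; rewrite lsum_wpow -mulrN ler_wpM2l//.
have := ler_norm (- lsum f p); rewrite normrN; have [_ h _] := Wf.
by have := h 0%N; lra.
Qed.

Lemma interp_lower c p q m j : returns B i c p -> returns B i c q ->
  (j <= m)%N ->
  (- (m%:R * (`|lsum f p| + `|lsum f q| + 2 * rf 0) + 2 * rf 0) <= lsum f (interp p q m j))%R.
Proof.
move=> hp hq jm; have [_ h _] := Wf; have rf0 := h 0%N.
have h1 := wpow_lower j hp; have h2 := wpow_lower (m - j) hq.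
have mE : m%:R = (j%:R + (m - j)%:R :> R)%R by rewrite -natrD subnKC.
have j0 : (0 <= j%:R :> R)%R by []. have mj0 : (0 <= (m - j)%:R :> R)%R by [].
have a1 := normr_ge0 (lsum f p); have a2 := normr_ge0 (lsum f q).
have hsum : (lsum f (wpow p j) + lsum f (wpow q (m - j)) - 2 * rf 0 <= lsum f (interp p q m j))%R.
  rewrite /interp; case: (posnP j) => [->|jp]; first by rewrite wpow0 /= lsum_nil; lra.
  case: (posnP (m - j)) => [->|mjp]; first by rewrite wpow0 cats0 lsum_nil; lra.
  exact: (lsum_cat_ge Wf (wpow_returns hp jp).1 (wpow_returns hq mjp).1).
rewrite mE; nra.
Qed.

(** Rotated to the front, the factor that changes from [q] to [p] is followed by the same return
    [E ++ A] both times, so the distortion enters only twice, whatever [m] and [j] are. *)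
Lemma interp_step c p q (w : seq nat) m j : returns B i c p -> returns B i c q ->
  returns B i c w -> (j < m)%N ->
  (`|T (w ++ interp p q m j.+1) - T (w ++ interp p q m j) - (T p - T q)| <=
     4 * rT (size c))%R.
Proof.
move=> hp hq hw jm.
pose A := w ++ wpow p j; pose E := wpow q (m - j.+1).
have -> : w ++ interp p q m j.+1 = A ++ p ++ E.
  by rewrite /interp wpowSr /A /E -!catA.
have -> : w ++ interp p q m j = A ++ q ++ E.
  by rewrite /interp /A /E (_ : m - j = (m - j.+1).+1)%N ?wpowS -?catA//; lia.
have hEA : returns B i c (E ++ A).
  have hA : returns B i c A.
    rewrite /A; case: (posnP j) => [->|j0]; first by rewrite wpow0 cats0.
    by apply: returns_cat => //; exact: wpow_returns.
  rewrite /E; case: (posnP (m - j.+1)) => [->|j0]; first by rewrite wpow0.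
  by apply: returns_cat => //; exact: wpow_returns.
rewrite (lsum_catC _ A) (lsum_catC _ A) -!catA.
have h1 := returns_dist hp hEA; have h2 := returns_dist hq hEA.
move: h1 h2; rewrite !ler_norml; lra.
Qed.

Lemma wpow_step c q (w : seq nat) m : returns B i c q -> returns B i c w ->
  (`|T (w ++ wpow q m.+1) - T (w ++ wpow q m) - T q| <= 2 * rT (size c))%R.
Proof.
move=> hq hw; rewrite wpowSr catA lsum_catC.
have hE : returns B i c (w ++ wpow q m).
  case: (posnP m) => [->|j0]; first by rewrite wpow0 cats0.
  by apply: returns_cat => //; exact: wpow_returns.
have h1 := returns_dist hq hE.
by have -> : (T (q ++ w ++ wpow q m) - T (w ++ wpow q m) - T q =
  T (q ++ (w ++ wpow q m)) - (T q + T (w ++ wpow q m)))%R by ring.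
Qed.

(** The filling is [interp p q m j]: first [m] is chosen maximal such that [w ++ wpow q m] does not
    pass a target time [t], then [j] is increased as long as [t] is not passed. The loss of weight
    is linear in the time that remains, with a slope [A] that depends neither on [w] nor on [n]. *)
Lemma fill_window : exists (c : seq nat) (M A : R),
  [/\ loop B i c, (0 <= M)%R, (0 <= A)%R &
  forall w n, returns B i c w -> (exists x, window B tau i n x) ->
  (T w + M <= n%:R)%R -> exists v,
  [/\ returns B i c v, window B tau i n (w ++ v) &
      (- (A * (n%:R - T w) + A) <= lsum f v)%R]].
Proof.
have [g [hg g0 hg1]] := length_gap_choice.
have [u lu] := loop_exists hmix i; have u0 := loop_neq0 lu.
pose d0 := (tau (per u) / 2)%R.
have d0p : (0 < d0)%R by rewrite /d0 divr_gt0// tau_gt0//; exact: loop_Sigma lu.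
(* One step in [j] deviates from [g] by less than [5 * e]: four [e] from distortion and one from the
   choice of [p] and [q]. This is at most [g / 2], and keeps a step below 1 if [g < 1]. The bound by
   [d0] makes [a] positive. *)
have [e [e0 eg ed e1]] : exists e : R, [/\ (0 < e)%R, (10 * e <= g)%R, (10 * e <= d0)%R &
    (g < 1 -> 10 * e <= 1 - g)%R].
  exists (Num.min (g / 10) (Num.min (d0 / 10) (if (g < 1)%R then (1 - g) / 10 else 1)))%R.
  set z := Num.min _ _; have z1 : (z <= g / 10)%R by rewrite ge_min lexx.
  have z2 : (z <= d0 / 10)%R by rewrite !ge_min lexx orbT.
  have z3 : (z <= (if g < 1 then (1 - g) / 10 else 1))%R by rewrite !ge_min lexx !orbT.
  split; [|by lra|by lra|by move=> h; rewrite h in z3; lra].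
  by rewrite !lt_min divr_gt0// divr_gt0//=; case: ifP => h; lra.
have [M0 hM0] := return_time tau_gt0 WT lu.
have [M1 hM1] := walters_small WT u0 e0.
pose K := (maxn M0 M1).+1; pose c := wpow u K.
have lc : loop B i c by exact: loop_wpow.
have rc : (rT (size c) < e)%R by apply: hM1; exact: leqW (leq_maxr _ _).
have hT w : returns B i c w -> (d0 <= T w)%R by apply: hM0; exact: leqW (leq_maxl _ _).
have [p [q [hp hq hpq]]] := hg c lc e e0.
have Tq := hT q hq.
pose a := (T q - 2 * e)%R; have a0 : (0 < a)%R by rewrite /a; lra.
pose b := (T q + 2 * e)%R; have b0 : (0 < b)%R by rewrite /b; lra.
pose s := (T p - T q)%R.
have sg : (`|s - g| < e)%R by exact: hpq.
(* This leaves time for at least [2 * b / g] copies of [q]. Then [m] steps of at least [g / 2] gain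
   at least [b], more than one further copy of [q] adds, so [t] is passed for some [j <= m]. *)
pose M := (b * (2 * b / g + 2) + 1)%R.
have bg0 : (0 <= 2 * b / g)%R.
  by apply: divr_ge0; [apply: mulr_ge0 => //|]; exact: ltW.
have M_0 : (1 <= M)%R by rewrite /M lerDr mulr_ge0 ?(ltW b0)// addr_ge0.
pose A1 := (`|lsum f p| + `|lsum f q| + 2 * rf 0)%R.
have [_ rfp _] := Wf; have rf0 := rfp 0%N.
have A10 : (0 <= A1)%R by rewrite !addr_ge0// mulr_ge0.
pose A := (A1 / a + 2 * rf 0)%R.
have A0 : (0 <= A)%R.
  by apply: addr_ge0; [apply: divr_ge0 => //; exact: ltW|exact: mulr_ge0].
exists c, M, A; split=> //; first by lra.
move=> w n hw [x hx] hn.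
(* If [g < 1], it suffices to end less than 1 before [n]. Otherwise lengths of loops lie in a
   discrete group, and the target is the length of an actual loop in the window. *)
have [t [tn hTt tcase]] : exists t : R, [/\ (n%:R - 1 < t <= n%:R)%R, (T w + (M - 1) <= t)%R &
    (g < 1)%R /\ t = n%:R \/ (forall g', length_gaps g' -> (0 < g')%R -> (g <= g')%R) /\
    length_gaps t].
  case: hg1 => h; first by exists n%:R; split; [lra|lra|left].
  exists (T x); case: hx => lx hx; split=> //; first by lra.
  by right; split=> //; exact: length_gaps_loop.
have hstep m := wpow_step m hq hw.
have grow m : (T w + m%:R * a <= T (w ++ wpow q m) <= T w + m%:R * b)%R.
  elim: m => [|m IH]; first by rewrite wpow0 cats0 !mul0r addr0 lexx.
  have := hstep m; move: IH; rewrite -natr1 !mulrDl !mul1r ler_norml /a /b; lra.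
clear bg0 d0p Tq hT.
have ex : exists m, (t < T (w ++ wpow q m))%R.
  near \oo => m; exists m; have /andP[h _] := grow m.
  apply: lt_le_trans h; rewrite -ltrBlDl -ltr_pdivrMr//.
  by near: m; exact: nbhs_infty_gtr.
case: (ex_minnP ex) => -[|m] hm hmin.
  by move: hm hTt M_0; rewrite wpow0 cats0; lra.
have hm' : (T (w ++ wpow q m) <= t)%R.
  by rewrite leNgt; apply/negP => /hmin; rewrite ltnn.
have mb : (2 * b / g + 2 < m.+1%:R)%R.
  have /andP[_ h] := grow m.+1.
  have : (M - 1 < m.+1%:R * b)%R by lra.
  by rewrite /M addrK mulrC ltr_pM2r.
have m2 : (2 * b / g <= m%:R)%R by move: mb; rewrite -natr1; lra.
have m0 : (0 < m)%N.
  rewrite -(ltr_nat R); apply: lt_le_trans m2; by rewrite divr_gt0// mulr_gt0.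
have ma : (m%:R * a <= t - T w)%R by have /andP[h _] := grow m; lra.
pose X j := T (w ++ interp p q m j).
have X0 : (X 0%N <= t)%R by rewrite /X /interp wpow0 subn0.
have stp j : (j < m)%N -> (`|X j.+1 - X j - g| < 5 * e)%R.
  move=> jm; have := interp_step hp hq hw jm; rewrite -/s -/(X j.+1) -/(X j).
  by move: sg; rewrite ltr_norml ler_norml ltr_norml; lra.
have Xm : (t < X m)%R.
  have H j : (j <= m)%N -> (X 0%N + j%:R * (g / 2) <= X j)%R.
    elim: j => [|j IH] jm; first by rewrite mul0r addr0.
    have := stp j jm; have := IH (ltnW jm).
    by rewrite -[j.+1%:R]natr1 mulrDl ltr_norml; lra.
  have h1 := H m (leqnn m).
  have h2 : (b <= m%:R * (g / 2))%R.
    by move: m2; rewrite ler_pdivrMr//; lra.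
  have h3 : (t < X 0%N + b)%R.
    have := hstep m; rewrite ler_norml /X /interp wpow0 subn0 cat0s /b; lra.
  lra.
have nT : (0 <= n%:R - T w)%R by lra.
clear hm hm' hmin mb m2 hTt hn M_0 grow hstep sg hpq ed b0 rc.
have exj : exists j, (t < X j)%R by exists m.
case: (ex_minnP exj) => -[|j] hj hjmin; first by lra.
have jm : (j < m)%N by rewrite -ltnS; apply: leq_ltn_trans (hjmin m Xm) _.
have hj' : (X j <= t)%R by rewrite leNgt; apply/negP => /hjmin; rewrite ltnn.
have hv : returns B i c (interp p q m j) by apply: interp_returns => //; exact: ltnW.
have lwv : loop B i (w ++ interp p q m j) by exact: (returns_cat hw hv).1.
have sj := stp j jm.
exists (interp p q m j); split=> //.
  split=> //; rewrite -/(X j).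
  case: tcase => [[g1 tE]|[gmin Dt]].
    by have := e1 g1; move: sj; rewrite ltr_norml; lra.
  (* Both [X j.+1 - X j] and [t - X j] lie in a group whose least positive element is [g]. The step
     is within [5 * e < g] of [g], hence equal to it, and [0 <= t - X j < g] leaves only zero. *)
  suff -> : X j = t by [].
  have lwv' : loop B i (w ++ interp p q m j.+1).
    by apply: (returns_cat hw (interp_returns hp hq m0 _)).1.
  have D1 : length_gaps (X j) by exact: length_gaps_loop.
  have D2 : length_gaps (X j.+1) by exact: length_gaps_loop.
  have hs : (X j.+1 - X j = g)%R.
    apply/eqP; rewrite eq_le; apply/andP; split; last first.
      by apply: gmin; [exact: (length_gapsB D2 D1)|move: sj; rewrite ltr_norml; lra].
    rewrite leNgt; apply/negP => h.
    have : (g <= X j.+1 - X j - g)%R.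
      by apply: gmin; [exact: (length_gapsB (length_gapsB D2 D1) hg)|lra].
    by move: sj; rewrite ltr_norml; lra.
  apply/eqP; rewrite eq_le hj' /= leNgt; apply/negP => h.
  have : (g <= t - X j)%R by apply: gmin; [exact: (length_gapsB Dt D1)|lra].
  by lra.
apply: le_trans (interp_lower hp hq (ltnW jm)).
rewrite lerN2 -/A1.
have : (m%:R * A1 <= A1 / a * (n%:R - T w))%R.
  rewrite mulrC -[X in (_ <= X)%R]mulrA ler_wpM2l//.
  rewrite ler_pdivlMl// mulrC; lra.
have : (0 <= A1 / a)%R by rewrite divr_ge0// ltW.
have : (0 <= 2 * rf 0 * (n%:R - T w))%R by rewrite mulr_ge0// mulr_ge0.
rewrite /A mulrDl; lra.
Unshelve. all: by end_near. Qed.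

End filling.
End length_spectrum.

(** * Lower bounds for windows *)

Section window_growth.
Context {R : realType}.
Variables (B : rel nat) (tau : borel_seqs -> R) (i : nat).
Hypothesis hmix : topologically_mixing B.
Hypothesis (tau_gt0 : forall x, Sigma B x -> (0 < tau x)%R).
Variable rT : nat -> R.
Hypothesis (WT : walters B tau rT).
Notation T := (lsum tau).
Variables (f : borel_seqs -> R) (rf : nat -> R) (Wf : walters B f rf).

(* Some window carries a large part of the sum over all loops of length [k]. *)
Lemma big_window (d K : R) : (0 < d)%R ->
  (forall L : R, exists2 k, (0 < k)%N & L%:E < Zbase B (fun x => f x - d * tau x)%R k i) ->
  exists k n, (0 < n)%N /\ K%:E < \esum_(w in window B tau i n `&` loopsn B i k) loop_weight f w.
Proof.
move=> d0 hL; pose q := expR (- d).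
have q01 : (0 <= q < 1)%R by rewrite expR_ge0 -expR0 ltr_expR; lra.
have Sq := geometric_lty q01.
have S0 : 0 <= \sum_(n <oo) (q ^+ n)%:E.
  by apply: nneseries_ge0 => n _ _; rewrite lee_fin exprn_ge0 ?expR_ge0.
have [s sE] : exists s : R, \sum_(n <oo) (q ^+ n)%:E = s%:E.
  by exists (fine (\sum_(n <oo) (q ^+ n)%:E)); rewrite fineK// ge0_fin_numE.
have [k k0 hk] := hL (`|K| * s)%R.
exists k; apply: contrapT => /forallNP h.
move: hk; apply/negP; rewrite -leNgt ZbaseE//.
have -> : loopsn B i k = \bigcup_n (window B tau i n.+1 `&` loopsn B i k).
  apply/seteqP; split=> [w [lw sw]|w [n _ []]//].
  have : loops B i w by []; rewrite (window_cover tau_gt0) => -[[|n] _ [_ hn]].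
    by exfalso; have := lsum_gt0 tau_gt0 lw; move: hn; lra.
  by exists n.
apply: le_trans (esum_bigcup_le _ _) _; first by move=> *; exact: loop_weight_ge0.
apply: (@le_trans _ _ (\sum_(n <oo) `|K|%:E * (q ^+ n)%:E)); last first.
  by rewrite nneseriesZl ?sE// => n _; rewrite lee_fin exprn_ge0 ?expR_ge0.
apply: lee_nneseries => n; first by move=> *; apply: esum_ge0 => *; exact: loop_weight_ge0.
move=> _; apply: (@le_trans _ _ ((q ^+ n)%:E * (\esum_(w in window B tau i n.+1 `&` loopsn B i k) loop_weight f w))).
  rewrite -esumZl; [|by rewrite lee_fin exprn_ge0 ?expR_ge0|by move=> *; exact: loop_weight_ge0].
  apply: le_esum => w [[lw hw] _]; rewrite -EFinM lee_fin -expRM_natr -expRD ler_expR lsumB.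
  have : (d * n%:R <= d * T w)%R by rewrite ler_pM2l//; move: hw; rewrite -natr1; lra.
  lra.
rewrite muleC; apply: lee_wpmul2r; first by rewrite lee_fin exprn_ge0 ?expR_ge0.
have : ~ K%:E < \esum_(w in window B tau i n.+1 `&` loopsn B i k) loop_weight f w.
  by move=> h'; apply: (h n.+1).
move/negP; rewrite -leNgt => /le_trans; apply; rewrite lee_fin; exact: ler_norm.
Qed.

(** A sum of at least [expR C] reproduces itself: a concatenation costs at most the factor
    [expR (- C)], which the sum over the added factor makes up for. The common size [k] gives unique
    factorization. *)
Lemma catpow_esum_ge c (G : set (seq nat)) (C : R) k n : (2 * rf 0 <= C)%R ->
  G `<=` returns B i c -> (forall w, G w -> size w = k) ->
  (expR C)%:E <= \esum_(w in G) loop_weight f w ->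
  (expR C)%:E <= \esum_(w in catpow G n) loop_weight f w.
Proof.
move=> hC Gr Gk hG; elim: n => // n IH.
apply: (@le_trans _ _ ((expR (- C))%:E * ((\esum_(w in G) loop_weight f w) *
    \esum_(w in catpow G n) loop_weight f w))).
  apply: (@le_trans _ _ ((expR (- C))%:E * ((expR C)%:E * (expR C)%:E))).
    by rewrite -!EFinM lee_fin -!expRD ler_expR; lra.
  apply: lee_wpmul2l; first by rewrite lee_fin expR_ge0.
  by apply: lee_pmul; rewrite ?lee_fin ?expR_ge0.
apply: esum_catset_ge => [v w hv hw|v w v' w' hv hw hv' hw'].
  by have := lsum_cat_ge Wf (Gr _ hv).1 (catpow_returns Gr hw).1; lra.
by move/eqP; rewrite eqseq_cat ?Gk// => /andP[/eqP -> /eqP ->].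
Qed.

Lemma catpow_size (G : set (seq nat)) k n w : (forall w, G w -> size w = k) ->
  catpow G n w -> size w = (n.+1 * k)%N.
Proof.
move=> Gk; elim: n w => [|n IH] w; first by rewrite mul1n; exact: Gk.
by move=> [[v w'] [/= /Gk hv /IH hw'] <-]; rewrite size_cat hv hw' (mulSn n.+1).
Qed.

Lemma catpow_length c (G : set (seq nat)) (C a b : R) n w : (2 * rT 0 <= C)%R ->
  G `<=` returns B i c -> (forall w, G w -> a <= T w <= b)%R ->
  catpow G n w -> (n.+1%:R * (a - C) <= T w <= n.+1%:R * (b + C))%R.
Proof.
move=> hC Gr Gab; have [_ rTp _] := WT; have rT0 := rTp 0%N.
elim: n w => [|n IH] w; first by move=> /Gab; rewrite !mul1r; lra.
move=> [[v w'] [/= hv hw'] <-].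
have h1 := Gab _ hv; have h2 := IH _ hw'.
have h3 := lsum_cat_ge WT (Gr _ hv).1 (catpow_returns Gr hw').1.
have h4 := lsum_cat_le WT (Gr _ hv).1 (catpow_returns Gr hw').1.
rewrite -[n.+2%:R]natr1 !(mulrDl n.+1%:R) !mul1r; lra.
Qed.

(** Products of blocks built from one heavy window fill most of the time up to [n], and
    [fill_window] supplies the rest. The difficulty is that the uncertainty in time grows with the
    number of blocks, while the total loss must stay within the rate [e]. *)
Lemma window_lower (d e : R) : (0 < d)%R -> (0 < e)%R ->
  (forall L : R, exists2 k, (0 < k)%N & L%:E < Zbase B (fun x => f x - d * tau x)%R k i) ->
  \forall n \near \oo, (exists x, window B tau i n x) ->
    (expR (- (e * n%:R)))%:E <= \esum_(w in window B tau i n) loop_weight f w.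
Proof.
move=> d0 e0 hL.
have [c [M [A [lc M0 A0 fill]]]] := fill_window i hmix tau_gt0 WT Wf.
have [_ rTp _] := WT; have rT0 := rTp 0%N.
have [_ rfp _] := Wf; have rf0 := rfp 0%N.
pose C := (2 * rT 0 + 2 * rf 0)%R; have C0 : (0 <= C)%R by rewrite /C; lra.
have Tc := lsum_gt0 tau_gt0 lc.
(* Each block has an uncertainty of [1 + 4 * C] in time, and filling it costs [A * (1 + 4 * C)].
   Starting each block with [Q] copies of [c] makes it so long that this is at most [e / 2] times
   the bound [H] for its length. *)
have [Q Q0 hQ] : exists2 Q, (0 < Q)%N & (2 * A * (1 + 4 * C) / e <= Q%:R * T c)%R.
  near \oo => Q; exists Q; first by near: Q; exact: nbhs_infty_gt.
  rewrite -ler_pdivrMr// ltW//; near: Q; exact: nbhs_infty_gtr.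
pose cQ := wpow c Q.
have lcQ : loop B i cQ by rewrite /cQ; case: (Q) Q0 => // m _; exact: loop_wpow.
have ccQ : ret c cQ by rewrite /cQ; case: (Q) Q0 => // m _; rewrite wpowS; exact: ret_self.
(* The weight of the window pays for the prefix [cQ] and the distortion of attaching it, and still
   leaves [expR C]. *)
have [k [n0 [n00 hk]]] := big_window (expR (2 * C - lsum f cQ)) d0 hL.
pose G0 := window B tau i n0 `&` loopsn B i k.
pose G := (fun w => cQ ++ w) @` G0.
have Gr : G `<=` returns B i c.
  move=> _ [w [[lw _] _] <-]; split; first exact: loop_cat.
  by rewrite /cQ; case: (Q) Q0 => // m _; rewrite wpowS -catA; exact: ret_self.
have Gk w : G w -> size w = (size cQ + k)%N by move=> [v [_ [_ <-]] <-]; rewrite size_cat.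
have TcQ : T cQ = (Q%:R * T c)%R by rewrite /cQ lsum_wpow.
pose H := (T cQ + n0%:R + 2 * C)%R.
have n01 : (1 <= n0%:R :> R)%R by rewrite ler1n.
have TcQ0 : (0 < T cQ)%R by exact: lsum_gt0 lcQ.
have H0 : (0 < H)%R by rewrite /H; lra.
have Gab w : G w -> (T cQ + n0%:R - 1 - C <= T w <= T cQ + n0%:R + C)%R.
  move=> [v [[lv hv] _] <-].
  have := lsum_cat_ge WT lcQ lv; have := lsum_cat_le WT lcQ lv.
  rewrite /C; move: hv; lra.
have GC : (expR C)%:E <= \esum_(w in G) loop_weight f w.
  rewrite esum_image; last by move=> v w _ _ /eqP; rewrite eqseq_cat// => /andP[_ /eqP].
  apply: (@le_trans _ _ ((expR (lsum f cQ - C))%:E * (\esum_(w in G0) loop_weight f w))).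
    apply: (@le_trans _ _ ((expR (lsum f cQ - C))%:E * (expR (2 * C - lsum f cQ))%:E)).
      by rewrite -EFinM lee_fin -expRD ler_expR; lra.
    by apply: lee_wpmul2l; [rewrite lee_fin expR_ge0|exact: ltW].
  rewrite -esumZl; [|by rewrite lee_fin expR_ge0|by move=> *; exact: loop_weight_ge0].
  apply: le_esum => w [[lw _] _]; rewrite -EFinM lee_fin -expRD ler_expR.
  by have := lsum_cat_ge Wf lcQ lw; rewrite /C; lra.
near=> n => hx.
have nbig : (M + H + 2 * (A * (M + H) + A) / e < n%:R)%R by near: n; exact: nbhs_infty_gtr.
have nMH : (M + H < n%:R)%R.
  apply: le_lt_trans nbig; rewrite lerDl divr_ge0 ?(ltW e0)// mulr_ge0// addr_ge0// mulr_ge0//.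
  by rewrite addr_ge0// ltW.
have nA : (A * (M + H) + A <= e / 2 * n%:R)%R.
  have : (2 * (A * (M + H) + A) / e < n%:R)%R by lra.
  by rewrite ltr_pdivrMr//; lra.
(* [r.+1] is the largest number of blocks that is sure to leave the time [M] which [fill_window]
   requires. *)
have [r hr1 hr2] : exists2 r : nat, (r.+1%:R * H <= n%:R - M)%R & (n%:R - M < r.+2%:R * H)%R.
  have z0 : (0 <= (n%:R - M) / H)%R by rewrite divr_ge0 ?(ltW H0)//; lra.
  have /andP[h1 h2] := Num.Theory.truncn_itv z0.
  case: (Num.truncn _) h1 h2 => [|r] h1 h2; last first.
    by exists r; [rewrite -ler_pdivlMr|rewrite -ltr_pdivrMr].
  by exfalso; move: h2; rewrite ltr_pdivrMr//; lra.
pose X := catpow G r.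
have Xr : X `<=` returns B i c by exact: catpow_returns.
have XT w : X w -> (r.+1%:R * (H - (1 + 4 * C)) <= T w <= r.+1%:R * H)%R.
  move=> Xw; have C1 : (2 * rT 0 <= C)%R by rewrite /C; lra.
  have := catpow_length C1 Gr Gab Xw.
  by rewrite (_ : (_ - 1 - C - C = H - (1 + 4 * C))%R) 1?(_ : (_ + C + C = H)%R)//; rewrite /H; ring.
have [v hv] : exists v : seq nat -> seq nat, forall w, X w ->
    [/\ returns B i c (v w), window B tau i n (w ++ v w) &
      (- (A * (n%:R - T w) + A) <= lsum f (v w))%R].
  have h w : exists v, X w -> [/\ returns B i c v, window B tau i n (w ++ v) &
      (- (A * (n%:R - T w) + A) <= lsum f v)%R].
    have [Xw|nXw] := pselect (X w); last by exists [::].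
    have [|v hv] := fill w n (Xr _ Xw) hx; last by exists v.
    by have := XT _ Xw; lra.
  by exists (fun w => projT1 (cid (h w))) => w; exact: (projT2 (cid (h w))).
have XC : (expR C)%:E <= \esum_(w in X) loop_weight f w.
  by apply: (catpow_esum_ge _ _ Gr Gk GC); rewrite /C; lra.
apply: (@le_trans _ _ ((expR (- (e * n%:R + C)))%:E * (expR C)%:E)).
  by rewrite -EFinM lee_fin -expRD ler_expR; lra.
apply: (@le_trans _ _ ((expR (- (e * n%:R + C)))%:E * (\esum_(w in X) loop_weight f w))).
  by apply: lee_wpmul2l => //; rewrite lee_fin expR_ge0.
apply: (@esum_map_le _ _ _ _ (fun w => w ++ v w)).
- by move=> w /hv[].
(* The filling depends on the word, but all products in [X] have the same size, so the word can be
   read off. *)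
- move=> w w'; rewrite !inE => Xw Xw' /eqP.
  by rewrite eqseq_cat ?(catpow_size Gk Xw) ?(catpow_size Gk Xw')// => /andP[/eqP].
move=> w Xw; have [hvw _ hvf] := hv w Xw.
have := lsum_cat_ge Wf (Xr _ Xw).1 hvw.1.
have hC : (2 * rf 0 <= C)%R by rewrite /C; lra.
suff : (A * (n%:R - T w) + A <= e * n%:R)%R by lra.
(* The remaining time consists of the reserve [M], at most one more block, and the uncertainties of
   the [r.+1] blocks. *)
have h1 : (n%:R - T w <= M + H + r.+1%:R * (1 + 4 * C))%R.
  have /andP[h _] := XT _ Xw; move: h hr2; rewrite -[r.+2%:R]natr1 mulrDl mulrBr mul1r; lra.
have h2 : (A * (r.+1%:R * (1 + 4 * C)) <= e / 2 * n%:R)%R.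
  have hQ' : (A * (1 + 4 * C) <= e / 2 * H)%R.
    have : (2 * A * (1 + 4 * C) / e <= H)%R by rewrite /H TcQ; lra.
    by rewrite ler_pdivrMr//; lra.
  have r0 : (0 <= r.+1%:R :> R)%R by [].
  have : (r.+1%:R * (A * (1 + 4 * C)) <= r.+1%:R * (e / 2 * H))%R by rewrite ler_wpM2l.
  have : (e / 2 * (r.+1%:R * H) <= e / 2 * n%:R)%R by rewrite ler_wpM2l//; lra.
  lra.
have h3 : (A * (n%:R - T w) <= A * (M + H + r.+1%:R * (1 + 4 * C)))%R by rewrite ler_wpM2l.
lra.
Unshelve. all: by end_near. Qed.

End window_growth.

Section flow_pressure_limit.
Context {R : realType}.
Variables (B : rel nat) (tau D : borel_seqs -> R).
Hypothesis hmix : topologically_mixing B.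
Hypothesis (tau_gt0 : forall x, Sigma B x -> (0 < tau x)%R).
Variables rT rD : nat -> R.
Hypotheses (WT : walters B tau rT) (WD : walters B D rD).

Let phi (t : R) := fun x => (D x - t * tau x)%R.
Let rt (t : R) := fun L => (rD L + `|t| * rT L)%R.
Let W t : walters B (phi t) (rt t) := waltersB t WD WT.

Lemma Zbase_unbounded t i : 0 < gurevich_pressure B (phi t) ->
  forall L : R, exists2 k, (0 < k)%N & L%:E < Zbase B (phi t) k i.
Proof.
move=> hp L.
have [l [C hC]] := Zbase_transfer hmix (W t) i 0.
apply: contrapT => hN.
have : gurevich_pressure B (phi t) <= 0; last by rewrite leNgt hp.
apply: (gurevich_bounded hmix (W t) (K := expR C * L)%R) => n n0.
rewrite EFinM -lee_pdivrMl ?expR_gt0// -expRN.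
apply: (le_trans (hC n n0)); rewrite leNgt; apply/negP => h.
by apply: hN; exists (n + l)%N => //; rewrite addn_gt0 n0.
Qed.

(** In the [n]-th window the roof sum is [n] up to 1, so the parameter [t] shifts exponents by
    [t * n] up to a constant. *)
Lemma lsum_window i n t w : window B tau i n w ->
  (lsum (phi t) w + t * n%:R - `|t| <= lsum D w <= lsum (phi t) w + t * n%:R + `|t|)%R.
Proof.
move=> [_ hw]; rewrite lsumB.
have : (`|t * (lsum tau w - n%:R)| <= `|t|)%R.
  by rewrite normrM ler_piMr// ler_norml; lra.
by rewrite mulrBr ler_norml; lra.
Qed.

Lemma esum_window_le i n t : \esum_(w in window B tau i n) loop_weight D w <=
  (expR (t * n%:R + `|t|))%:E * (\esum_(w in window B tau i n) loop_weight (phi t) w).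
Proof.
rewrite -esumZl; [|by rewrite lee_fin expR_ge0|by move=> *; exact: loop_weight_ge0].
apply: le_esum => w hw; rewrite -EFinM lee_fin -expRD ler_expR.
by have := lsum_window t hw; lra.
Qed.

Lemma esum_window_ge i n t :
  (expR (t * n%:R - `|t|))%:E * (\esum_(w in window B tau i n) loop_weight (phi t) w) <=
  \esum_(w in window B tau i n) loop_weight D w.
Proof.
rewrite -esumZl; [|by rewrite lee_fin expR_ge0|by move=> *; exact: loop_weight_ge0].
apply: le_esum => w hw; rewrite -EFinM lee_fin -expRD ler_expR.
by have := lsum_window t hw; lra.
Qed.

Let Z i n := \esum_(w in window B tau i n) loop_weight D w.

Let Z0 i n : 0 <= Z i n.
Proof. by apply: esum_ge0 => *; exact: loop_weight_ge0. Qed.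

(** The interval from [a] to [p] is spent in three equal parts: from [p] to [t''] to have positive
    pressure, from [t''] to [t'] to select a window, and from [t'] to [a] for the losses. *)
Lemma window_limit_lower i (p a : R) :
  (forall t, (t < p)%R -> 0 < gurevich_pressure B (phi t)) -> (a < p)%R ->
  \forall n \near \oo, Z i n != 0 -> a%:E < (n%:R^-1)%:E * lne (Z i n).
Proof.
move=> hlt ap.
pose t' := ((2 * a + p) / 3)%R; pose t'' := ((a + 2 * p) / 3)%R.
have d0 : (0 < t'' - t')%R by rewrite /t' /t''; lra.
have e0 : (0 < (t' - a) / 2)%R by rewrite /t'; lra.
have ub : forall L : R, exists2 k, (0 < k)%N &
    L%:E < Zbase B (fun x => phi t' x - (t'' - t') * tau x)%R k i.
  move=> L; have [|k k0 hk] := @Zbase_unbounded t'' i _ L; first by apply: hlt; rewrite /t''; lra.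
  exists k => //; suff -> : (fun x => phi t' x - (t'' - t') * tau x)%R = phi t'' by [].
  by apply/funext => x; rewrite /phi; ring.
have h := window_lower hmix tau_gt0 WT (W t') d0 e0 ub.
near=> n => Zn.
have n0 : (0 < n)%N by near: n; exact: nbhs_infty_gt.
rewrite lt_scaled_lne//.
have [x hx] : exists x, window B tau i n x.
  apply: contrapT => hN; move/eqP: Zn; apply; apply: esum1 => w hw.
  by exfalso; apply: hN; exists w.
apply: lt_le_trans (esum_window_ge _ _ t').
have hn : (exists x, window B tau i n x) -> (expR (- ((t' - a) / 2 * n%:R)))%:E
    <= \esum_(w in window B tau i n) loop_weight (phi t') w by near: n.
apply: (@lt_le_trans _ _ ((expR (t' * n%:R - `|t'|))%:E * (expR (- ((t' - a) / 2 * n%:R)))%:E)).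
  rewrite -EFinM lte_fin -expRD ltr_expR.
  have : (`|t'| / ((t' - a) / 2) < n%:R)%R by near: n; exact: nbhs_infty_gtr.
  by rewrite ltr_pdivrMr//; lra.
by apply: lee_wpmul2l; [rewrite lee_fin expR_ge0|apply: hn; exists x].
Unshelve. all: by end_near. Qed.

(** A window is part of the sum over all loops, which converges at [s2] since the pressure at
    [s1 < s2] is nonpositive; [a - s2] absorbs the constants. *)
Lemma window_limit_upper i (p a : R) :
  (forall t, (p < t)%R -> gurevich_pressure B (phi t) <= 0) -> (p < a)%R ->
  \forall n \near \oo, (n%:R^-1)%:E * lne (Z i n) < a%:E.
Proof.
move=> hgt ap.
pose s1 := ((2 * p + a) / 3)%R; pose s2 := ((p + 2 * a) / 3)%R.
have h1 : gurevich_pressure B (phi s1) <= 0 by apply: hgt; rewrite /s1; lra.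
have hss : (s1 < s2)%R by rewrite /s1 /s2; lra.
have hsa : (0 < a - s2)%R by rewrite /s2; lra.
have := loops_summable hmix tau_gt0 WT WD i h1 hss.
have : 0 <= \esum_(w in loops B i) loop_weight (phi s2) w by apply: esum_ge0 => *; exact: loop_weight_ge0.
have : \esum_(w in loops B i) loop_weight (phi s2) w = \esum_(w in loops B i) loop_weight (phi s2) w by [].
move: {1 3 4}(\esum_(w in loops B i) loop_weight (phi s2) w) => [L| |]// LE _ _.
near=> n.
have n0 : (0 < n)%N by near: n; exact: nbhs_infty_gt.
rewrite scaled_lne_lt//.
apply: le_lt_trans (esum_window_le _ _ s2) _.
apply: (@le_lt_trans _ _ ((expR (s2 * n%:R + `|s2|))%:E * L%:E)).
  apply: lee_wpmul2l; first by rewrite lee_fin expR_ge0.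
  by rewrite LE; apply: sub_esum => w [].
apply: (@le_lt_trans _ _ ((expR (s2 * n%:R + `|s2|))%:E * (expR `|L|)%:E)).
  apply: lee_wpmul2l; rewrite lee_fin ?expR_ge0//.
  by apply: (le_trans (ler_norm L)); have := expR_ge1Dx `|L|%R; lra.
rewrite -EFinM lte_fin -expRD ltr_expR.
have : ((`|s2| + `|L|) / (a - s2) < n%:R)%R by near: n; exact: nbhs_infty_gtr.
by rewrite ltr_pdivrMr//; lra.
Unshelve. all: by end_near. Qed.

Lemma window_limit i (p : R) :
  (forall t, (p < t)%R -> gurevich_pressure B (phi t) <= 0) ->
  (forall t, (t < p)%R -> 0 < gurevich_pressure B (phi t)) ->
  (fun n : nat => (n%:R^-1)%:E * lne (Z i n)) @ within [set n | Z i n != 0] \oo --> p%:E.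
Proof.
move=> hgt hlt; apply: cvge_cuts => a; rewrite lte_fin near_withinE => ap.
  exact: window_limit_lower ap.
by have := window_limit_upper i hgt ap; apply: filterS => n hn _; exact: hn.
Qed.

End flow_pressure_limit.

(** * Sums over words with a given prefix *)

Section word_sums.
Context {R : realType}.
Variable B : rel nat.
Variables (F : borel_seqs -> R) (r : nat -> R) (WF : walters B F r).
Implicit Types (a b v w : seq nat) (x y : borel_seqs).

Definition word_weight v x : \bar R := (expR (wsum F v x))%:E.

Definition extensions w x : set (seq nat) := [set v | Sigma B (glue v x) /\ prefix w v].

(** At [x] in [Sigma B], this is the sum over [n >= size w] of the [n]-th iterate of the transfer
    operator of [F], applied to the indicator of the cylinder of [w]. *)
Definition prefix_sum w x : \bar R := \esum_(v in extensions w x) word_weight v x.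

Lemma word_weight_ge0 v x : 0 <= word_weight v x. Proof. by rewrite lee_fin expR_ge0. Qed.

Lemma prefix_sum_ge0 w x : 0 <= prefix_sum w x. Proof. by apply: esum_ge0 => *; exact: word_weight_ge0. Qed.

Lemma prefix_sum_point w x y L : Sigma B x -> Sigma B y -> (0 < L)%N ->
  (forall j, (j < L)%N -> x j = y j) -> prefix_sum w x <= (expR (r L))%:E * prefix_sum w y.
Proof.
move=> hx hy L0 e; rewrite /prefix_sum -esumZl; [|by rewrite lee_fin expR_ge0|by move=> *; exact: word_weight_ge0].
have sub : extensions w x `<=` extensions w y.
  by move=> v [hv wv]; split=> //; apply: Sigma_glueS hv _ hy; exact: e.
apply: le_trans (sub_esum _ sub); apply: le_esum => v hv; have [hv' _] := sub _ hv.
have [_ _ h] := WF; have := h v x y L hv.1 hv' e.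
by rewrite -EFinM lee_fin -expRD ler_expR ler_norml; lra.
Qed.

Lemma prefix_sum_glue w b x :
  (expR (wsum F b x))%:E * prefix_sum w (glue b x) <= prefix_sum w x.
Proof.
rewrite /prefix_sum -esumZl; [|by rewrite lee_fin expR_ge0|by move=> *; exact: word_weight_ge0].
rewrite (@eq_esum _ _ _ _ (fun v => word_weight (v ++ b) x)); last first.
  by move=> v _; rewrite /word_weight wsum_cat expRD EFinM muleC.
rewrite -(esum_image _ (fun v => v ++ b) (fun v => word_weight v x)); last first.
  move=> v v' _ _ e; have sv : size v = size v'.
    by move: (congr1 size e); rewrite !size_cat => /addIn.
  by move/eqP: e; rewrite eqseq_cat// => /andP[/eqP].
apply: sub_esum => _ [v [hv wv] <-]; split; first by rewrite glue_cat.
by move/prefixP: wv => [t ->]; rewrite -catA prefix_prefix.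
Qed.

Lemma prefix_sum_prefix w w' x : prefix_sum (w ++ w') x <= prefix_sum w x.
Proof.
by apply: sub_esum => v [hv /catl_prefix].
Qed.

Lemma prefix_sum_cat_ge a w x (C : R) :
  (forall v, extensions w x v -> Sigma B (glue (a ++ v) x) /\ (C <= wsum F a (glue v x))%R) ->
  (expR C)%:E * prefix_sum w x <= prefix_sum (a ++ w) x.
Proof.
move=> h; rewrite /prefix_sum -esumZl; [|by rewrite lee_fin expR_ge0|by move=> *; exact: word_weight_ge0].
apply: (@le_trans _ _ (\esum_(v in (cat a) @` extensions w x) word_weight v x)).
  rewrite esum_image; last first.
    by move=> v v' _ _ /eqP; rewrite eqseq_cat// => /andP[_ /eqP].
  apply: le_esum => v /h[_ hC]; rewrite -EFinM lee_fin -expRD ler_expR wsum_cat.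
  by rewrite lerD2r.
apply: sub_esum => _ [v hv <-]; split; first by have [] := h v hv.
by rewrite prefix_catr// eqxx; exact: hv.2.
Qed.

Lemma prefix_sum_cat_le a w x (C : R) :
  (forall v, Sigma B (glue (a ++ v) x) -> prefix w v -> (wsum F a (glue v x) <= C)%R) ->
  prefix_sum (a ++ w) x <= (expR C)%:E * prefix_sum w x.
Proof.
move=> h; rewrite /prefix_sum -esumZl; [|by rewrite lee_fin expR_ge0|by move=> *; exact: word_weight_ge0].
have -> : extensions (a ++ w) x = (cat a) @` [set v | Sigma B (glue (a ++ v) x) /\ prefix w v].
  apply/seteqP; split=> [v [hv /prefixP[t e]]|_ [v [hv wv] <-]].
    by exists (w ++ t); [split; [rewrite catA -e|exact: prefix_prefix]|rewrite e catA].
  by split=> //; rewrite prefix_catr// eqxx.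
rewrite esum_image; last first.
  by move=> v v' _ _ /eqP; rewrite eqseq_cat// => /andP[_ /eqP].
apply: (@le_trans _ _ (\esum_(v in [set v | Sigma B (glue (a ++ v) x) /\ prefix w v])
    ((expR C)%:E * word_weight v x))).
  apply: le_esum => v [hv wv]; rewrite -EFinM lee_fin -expRD ler_expR wsum_cat.
  by rewrite lerD2r h.
by apply: sub_esum => v [hv wv]; split=> //; move: hv; rewrite glue_cat => /Sigma_glue.
Qed.

Lemma extensions_rcons w x : extensions w x =
  (extensions w x `&` [set w]) `|` \bigcup_j extensions (rcons w j) x.
Proof.
apply/seteqP; split=> [v [hv /prefixP[t e]]|v [[]//|[j _ [hv /prefixP[t e]]]]].
  case: t e => [|j t] e; first by left; split; [split=> //; rewrite e prefix_prefix|rewrite e cats0].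
  right; exists j => //; split=> //; rewrite e -cat_rcons; exact: prefix_prefix.
by split=> //; rewrite e -cats1 -catA prefix_prefix.
Qed.

Lemma extensions_triv w x : trivIset setT (fun j => extensions (rcons w j) x).
Proof.
apply/trivIsetP => j k _ _ jk; rewrite -subset0 => v [[_ /prefixP[s e]] [_ /prefixP[t]]].
rewrite e => /eqP; rewrite eqseq_cat ?size_rcons// => /andP[/eqP /rcons_inj[jk' _]].
by move: jk; rewrite jk' eqxx.
Qed.

(** Sorting by the letter after [w] makes prefix sums additive up to the single word [w]. After
    normalization this term vanishes in the limit, and consistent masses of cylinders remain. *)
Lemma prefix_sum_rec w x :
  prefix_sum w x = \esum_(v in extensions w x `&` [set w]) word_weight v x + \sum_(j <oo) prefix_sum (rcons w j) x.
Proof.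
rewrite -(nneseries_sum_bigcup (F := fun j => extensions (rcons w j) x)); last first.
- by move=> v; exact: word_weight_ge0.
- exact: extensions_triv.
rewrite {1}/prefix_sum (@esumID _ _ [set w])//; last by move=> *; exact: word_weight_ge0.
congr (_ + _); congr esum; rewrite {1}extensions_rcons.
apply/seteqP; split=> [v [[[_]//|//]]|v [j _ hv]].
split; first by right; exists j.
move=> e; move: hv => [_ /prefixP[t]]; rewrite e => /(congr1 size).
by rewrite size_cat size_rcons => /eqP; rewrite -[X in X == _]addn0 addSn -addnS eqn_add2l.
Qed.

Lemma esum_self_le w x : \esum_(v in extensions w x `&` [set w]) word_weight v x <= word_weight w x.
Proof.
by rewrite -[leRHS](esum_set1 (t := w) (a := fun v => word_weight v x)) ?word_weight_ge0//; apply: sub_esum => v [].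
Qed.

Definition ending w (a : nat) x : set (seq nat) :=
  [set v | Sigma B (glue (rcons v a) x) /\ prefix w v].

(** Sorting by the last letter instead exhibits one application of the transfer operator, which
    becomes the eigenfunction equation in the limit. *)
Lemma prefix_sum_last i x : prefix_sum [:: i] x = \esum_(v in extensions [:: i] x `&` [set [:: i]]) word_weight v x +
  \sum_(a <oo) \esum_(v in ending [:: i] a x) word_weight (rcons v a) x.
Proof.
have I (a : nat) : set_inj (ending [:: i] a x) (fun v => rcons v a).
  by move=> v v' _ _ /rcons_inj[].
rewrite (@eq_eseriesr _ _ (fun a : nat => \esum_(v in (fun v => rcons v a) @` ending [:: i] a x) word_weight v x));
  last by move=> a _; rewrite esum_image.
rewrite -(nneseries_sum_bigcup (F := fun a : nat => (fun v => rcons v a) @` ending [:: i] a x)); last first.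
- by move=> v; exact: word_weight_ge0.
- apply/trivIsetP => j k _ _ jk; rewrite -subset0 => _ [[v _ <-] [w _ /rcons_inj[_ e]]].
  by move: jk; rewrite e eqxx.
rewrite {1}/prefix_sum (@esumID _ _ [set [:: i]])//; last by move=> *; exact: word_weight_ge0.
congr (_ + _); congr esum; apply/seteqP; split=> [v [[hv wv] vi]|_ [a _ [v [hv wv] <-]]].
  case/lastP: v hv wv vi => // v a hv wv vi; exists a => //; exists v => //; split=> //.
  case: v wv vi {hv} => [|b v] /= /andP[/eqP <- _]; first by move=> /(_ erefl).
  by rewrite eqxx prefix0s.
split; first by split=> //; case: v wv {hv} => //= b v /andP[-> _]; rewrite prefix0s.
by case: v wv {hv} => //= b [|c v].
Qed.

Lemma ending_cons i (a : nat) x : B a (x 0%N) -> Sigma B x ->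
  \esum_(v in ending [:: i] a x) word_weight (rcons v a) x =
  (expR (F (scons a x)))%:E * prefix_sum [:: i] (scons a x).
Proof.
move=> ax hx; rewrite /prefix_sum -esumZl; [|by rewrite lee_fin expR_ge0|by move=> *; exact: word_weight_ge0].
have -> : ending [:: i] a x = extensions [:: i] (scons a x).
  by apply/seteqP; split=> v [h1 h2]; split=> //; move: h1; rewrite -cats1 glue_cat.
by apply: eq_esum => v _; rewrite /word_weight -cats1 wsum_cat /= addr0 expRD EFinM muleC.
Qed.

Lemma ending_empty i (a : nat) x : ~~ B a (x 0%N) ->
  \esum_(v in ending [:: i] a x) word_weight (rcons v a) x = 0.
Proof.
move=> /negP ax; apply: esum1 => v [hv _]; exfalso; apply: ax.
by move: hv; rewrite -cats1 glue_cat => /Sigma_glue /Sigma_scons[].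
Qed.

End word_sums.

Section first_walks.
Variable B : rel nat.
Hypothesis hmix : topologically_mixing B.

(** In a shortest walk, a second visit to [i] would allow the beginning to be cut off. *)
Lemma first_walk_from (i l : nat) : i != l ->
  exists a, walk B i l a /\ i \notin behead a.
Proof.
move=> il; have ex : exists n, `[< exists a, walk B i l a /\ size a = n >].
  by have [a wa] := mixing_walk i l hmix; exists (size a); apply/asboolP; exists a.
case: (ex_minnP ex) => n /asboolP[a [wa sa]] hn; exists a; split=> //.
case: a wa sa => // i' s wa sa; have e : i' = i by case/andP: wa => /eqP[].
subst i'; apply/negP => /= /splitPr h; case: h wa sa => s1 s2 wa sa.
have w2 : walk B i l (i :: s2) by apply: (walk_catr (u := i :: s1) _ _ wa).
have : (n <= size (i :: s2))%N by apply: hn; apply/asboolP; exists (i :: s2).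
by rewrite -sa /= size_cat /=; lia.
Qed.

Lemma first_walk_to (k i : nat) : k != i ->
  exists b, walk B k i b /\ i \notin b.
Proof.
move=> ki; have ex : exists n, `[< exists a, walk B k i a /\ size a = n >].
  by have [a wa] := mixing_walk k i hmix; exists (size a); apply/asboolP; exists a.
case: (ex_minnP ex) => n /asboolP[a [wa sa]] hn; exists a; split=> //.
case: a wa sa => // k' s wa sa; have e : k' = k by case/andP: wa => /eqP[].
subst k'; rewrite inE negb_or eq_sym ki /=; apply/negP => /splitPr h.
case: h wa sa => s1 s2 wa sa.
have w1 : walk B k i (k :: s1).
  by move: wa; rewrite /walk /= !eqxx /= rcons_cat /= -cat_rcons cat_path => /andP[].
have : (n <= size (k :: s1))%N by apply: hn; apply/asboolP; exists (k :: s1).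
by rewrite -sa /= size_cat /=; lia.
Qed.

Lemma last_factor i c w : returns B i c w ->
  primes B i c w \/ exists v p, [/\ returns B i c v, primes B i c p & w = v ++ p].
Proof.
have [n] := ubnP (size w); elim: n w => // n IH w hn hw.
have [hp|hp] := pselect (primes B i c w); first by left.
right; have [u [v [hu hv e]]] : exists u v, [/\ returns B i c u, returns B i c v & w = u ++ v].
  apply: contrapT => h; apply: hp; split=> // u v hu hv e; apply: h.
  by exists u, v.
have [||pv|[v' [p [hv' pp e']]]] := IH v; [|by []|by exists u, v|].
  by have := loop_size hu.1; move: hn; rewrite e size_cat; lia.
by exists (u ++ v'), p; split=> //; [exact: returns_cat|rewrite e e' catA].
Qed.

Lemma loops_returns i w : loop B i w -> returns B i [:: i] w.
Proof. by move=> lw; split=> //; exact: loop_ret lw. Qed.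

Lemma loop_nth0 i w : loop B i w -> nth 0%N w 0 = i.
Proof. by case: w => // a w /andP[/eqP[]]. Qed.

(* The first prime factor of a loop starting with [a' j] contains [a' j] when
   [i] does not occur again in [a' j]. *)
Lemma loop_prime_first i a' j v : i \notin behead a' -> ohead a' = Some i -> j != i ->
  prefix (rcons a' j) v -> loop B i v ->
  exists p, [/\ primes B i [:: i] p, nth 0%N p (size a') = j &
    v = p \/ exists2 w, loop B i w & v = p ++ w].
Proof.
move=> ia ha ji pv lv.
have nv : nth 0%N v (size a') = j.
  by move/prefixP: pv => [t ->]; rewrite -cats1 -catA nth_cat ltnn subnn.
have [pr|[p [w [pp [lw _] e]]]] := returns_factor (loops_returns lv).
  by exists v; split=> //; left.
exists p; split=> //; last by right; exists w.
suff h : (size a' < size p)%N by rewrite -nv e nth_cat h.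
rewrite ltnNge; apply/negP => hp.
have lp := loop_size pp.1.1.
have : nth 0%N v (size p) = i by rewrite e nth_cat ltnn subnn (loop_nth0 lw).
move: hp; rewrite leq_eqVlt => /orP[/eqP ->|hp]; first by rewrite nv => h; rewrite h eqxx in ji.
move/prefixP: pv => [t ->]; rewrite -cats1 -catA nth_cat hp => h.
move/negP: ia; apply; case: (a') ha hp h => // k s _ /= hp <-.
by case: (size p) lp hp => // m _ hp; apply: mem_nth.
Qed.

(** The mirror image of [loop_prime_first]: a prime factor begins with [i], so the last one cannot
    begin inside [a :: b]. It contains [a :: b] and shows the letter [a] at a fixed distance from
    its end. *)
Lemma loop_prime_last i (a : nat) b v : i \notin b -> a != i -> v != [::] ->
  loop B i (v ++ a :: b) ->
  exists p, [/\ primes B i [:: i] p, nth 0%N p (size p - (size b).+1) = a &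
    v ++ a :: b = p \/ exists2 w, loop B i w & v ++ a :: b = w ++ p].
Proof.
move=> ib ai v0 lv; set W := v ++ a :: b in lv *.
have nW : nth 0%N W (size v) = a by rewrite nth_cat ltnn subnn.
have sW : size W = (size v + (size b).+1)%N by rewrite size_cat.
have [pr|[w [p [[lw _] pp e]]]] := last_factor (loops_returns lv).
  by exists W; split=> //; [rewrite sW addnK|left].
exists p; split=> //; last by right; exists w.
have lp := loop_size pp.1.1.
have ni : nth 0%N W (size w) = i by rewrite e nth_cat ltnn subnn (loop_nth0 pp.1.1).
have h : (size w < size v)%N.
  rewrite ltnNge; apply/negP => hv.
  have sw : (size w < size W)%N by rewrite e size_cat -[ltnLHS]addn0 ltn_add2l.
  move: ni; rewrite /W nth_cat ltnNge hv /=.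
  case E : (size w - size v)%N => [|m] /= => [h|h]; first by rewrite h eqxx in ai.
  move/negP: ib; apply; rewrite -h; apply: mem_nth.
  by move: sw; rewrite sW -(subnKC hv) E ltn_add2l ltnS.
have sp : size W = (size w + size p)%N by rewrite e size_cat.
rewrite -nW e nth_cat ltnNge (ltnW h) /=; congr nth.
have eW : (size v + (size b).+1 = size w + size p)%N by rewrite -sW sp.
by move: eW h; move: (size v) (size b) (size w) (size p) => n1 n2 n3 n4; lia.
Qed.

End first_walks.

(** * Domination by prime loops *)

Section domination.
Context {R : realType}.
Variable B : rel nat.
Hypothesis hmix : topologically_mixing B.
Variables (f : borel_seqs -> R) (r : nat -> R) (W : walters B f r).
Variable i : nat.
Variable K : R.
Hypothesis hK : forall n, (0 < n)%N -> Zbase B f n i <= K%:E.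
Hypothesis hdiv : \esum_(w in loops B i) loop_weight f w = +oo.
Variable x0 : borel_seqs.
Hypothesis hx0 : cylinder B i x0.

Let s (n : nat) : R := (n.+1%:R^-1)%R.

Let s0 n : (0 < s n)%R. Proof. by rewrite invr_gt0. Qed.

Let s1 n : (s n <= 1)%R. Proof. by rewrite invf_le1// ler1n. Qed.

(* As in Patterson's construction of conformal measures, the sums over words,
   which diverge for [f], converge for the damped potentials; normalized by
   [loop_mass], they accumulate at the eigendata of the transfer operator. *)
Definition damped (n : nat) : borel_seqs -> R := fun x => (f x - s n)%R.
Notation F := damped.

Lemma wsum_damped n v x : wsum (F n) v x = (wsum f v x - s n * (size v)%:R)%R.
Proof.
elim: v => [|a v IH] /=; first by rewrite mulr0 subr0.
by rewrite IH /F -natr1; ring.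
Qed.

Lemma walters_damped n : walters B (F n) r.
Proof.
have [h1 h2 h3] := W; split=> // v x y L hx hy e; rewrite !wsum_damped.
have -> : (wsum f v x - s n * (size v)%:R - (wsum f v y - s n * (size v)%:R) =
  wsum f v x - wsum f v y)%R by ring.
exact: h3.
Qed.

Let r0 : (0 <= r 0)%R. Proof. by have [_ h _] := W. Qed.

Definition loop_mass n : \bar R := prefix_sum B (F n) [:: i] x0.

Lemma extensions_loops : extensions B [:: i] x0 = loops B i.
Proof.
have [sx x0i] := hx0; apply/seteqP; split=> v.
  case: v => [[]//|a v [hv /=]] /andP[/eqP e _]; rewrite -e in hv *.
  by move: hv => /Sigma_glue_path[+ _]; rewrite x0i /loops /loop /walk /= eqxx.
move=> lv; split; first by have [] := loop_glue lv hx0.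
by case: v lv => // a v /andP[/eqP[->] _] /=; rewrite eqxx prefix0s.
Qed.

Lemma word_weight_loop_weight G v : walters B G r -> loop B i v ->
  (wsum G v x0 - r 0 <= lsum G v <= wsum G v x0 + r 0)%R.
Proof.
move=> [_ _ h] lv.
have : (`|wsum G v x0 - wsum G v (per v)| <= r 0)%R.
  by apply: h; rewrite ?glue_per//; [exact: (loop_glue lv hx0).1|exact: loop_Sigma lv].
by rewrite ler_norml /lsum; lra.
Qed.

Lemma loop_weight_damped_le n v : loop_weight (F n) v <= loop_weight f v.
Proof.
rewrite lee_fin ler_expR /lsum wsum_damped gerBl mulr_ge0// ltW//; exact: s0.
Qed.

(** [Zbase] is bounded, and the damping adds a factor [expR (- s n)] per symbol, so a geometric
    series in the number of symbols dominates. *)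
Lemma loop_mass_lty n : loop_mass n < +oo.
Proof.
rewrite /loop_mass /prefix_sum extensions_loops.
apply: (@le_lt_trans _ _ ((expR (r 0))%:E * (\esum_(w in loops B i) loop_weight (F n) w))).
  rewrite -esumZl; [|by rewrite lee_fin expR_ge0|by move=> *; exact: loop_weight_ge0].
  apply: le_esum => w lw; rewrite -EFinM lee_fin -expRD ler_expR.
  by have := word_weight_loop_weight (walters_damped n) lw; lra.
apply: lte_mul_pinfty; rewrite ?lee_fin ?expR_ge0//.
pose q := expR (- s n).
have q01 : (0 <= q < 1)%R by rewrite expR_ge0 -expR0 ltr_expR oppr_lt0 s0.
have K0 : (0 <= K)%R by have := le_trans (Zbase_ge0 B f 1 i) (hK (ltn0Sn 0)); rewrite lee_fin.
have hZ m : Zbase B (F n) m.+1 i <= K%:E * (q ^+ m)%:E.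
  rewrite ZbaseE//; apply: (@le_trans _ _ ((q ^+ m.+1)%:E * Zbase B f m.+1 i)).
    rewrite ZbaseE// -esumZl; [|by rewrite lee_fin exprn_ge0 ?expR_ge0|by move=> *; exact: loop_weight_ge0].
    apply: le_esum => w [lw sw]; rewrite -EFinM lee_fin -expRM_natr -expRD ler_expR /lsum wsum_damped sw.
    by rewrite mulNr; lra.
  rewrite muleC; apply: lee_pmul; rewrite ?Zbase_ge0 ?lee_fin ?exprn_ge0 ?expR_ge0 ?hK//.
  by rewrite exprS ler_piMl ?exprn_ge0 ?expR_ge0//; case/andP: q01 => _ /ltW.
rewrite -Zbase_series -(@nneseries_addn _ _ 1)//; last by move=> m; exact: Zbase_ge0.
apply: (@le_lt_trans _ _ (\sum_(m <oo) K%:E * (q ^+ m)%:E)).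
  apply: lee_nneseries => m; first by move=> *; exact: Zbase_ge0.
  by move=> _; rewrite addn1.
rewrite nneseriesZl; last by move=> m _; rewrite lee_fin exprn_ge0 ?expR_ge0.
by apply: lte_mul_pinfty => //; exact: geometric_lty.
Qed.

(** Finitely many loops carry an arbitrarily large part of the divergent sum. Once [n] is at least
    their maximal size, the damping costs them at most the factor [expR (-1)]. *)
Lemma loop_mass_infty (L : R) : \forall n \near \oo, L%:E <= loop_mass n.
Proof.
have : (`|L| * expR (1 + r 0))%:E < \esum_(w in loops B i) loop_weight f w by rewrite hdiv ltry.
move=> /esum_gt_fset[X [fX Xl] hX].
have [M hM] : exists M, forall w, X w -> (size w <= M)%N.
  move/finite_seqP: fX => [t ->]; exists (\max_(w <- t) size w).
  by move=> w /= ws; exact: leq_bigmax_seq.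
exists M => // n /= Mn.
rewrite /loop_mass /prefix_sum extensions_loops; apply: le_trans (sub_esum _ Xl).
apply: (@le_trans _ _ ((expR (- (1 + r 0)))%:E * (\esum_(w in X) loop_weight f w))).
  apply: (@le_trans _ _ ((expR (- (1 + r 0)))%:E * (`|L| * expR (1 + r 0))%:E)); last first.
    by apply: lee_wpmul2l; [rewrite lee_fin expR_ge0|exact: ltW].
  rewrite -EFinM lee_fin mulrCA -expRD addNr expR0 mulr1; exact: ler_norm.
rewrite -esumZl; [|by rewrite lee_fin expR_ge0|by move=> *; exact: loop_weight_ge0].
apply: le_esum => w Xw; rewrite -EFinM lee_fin -expRD ler_expR wsum_damped.
have := word_weight_loop_weight W (Xl _ Xw).
have : (s n * (size w)%:R <= 1)%R.
  rewrite mulrC ler_pdivrMr ?mul1r ?ler_nat//; have := hM _ Xw; lia.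
lra.
Qed.

(* Prefixing a word by a path costs a factor that is uniform in the damping. *)
Lemma prefix_sum_le_loop_mass w : w != [::] -> exists2 C : R, (0 <= C)%R &
  forall n, prefix_sum B (F n) w x0 <= C%:E * loop_mass n.
Proof.
case: w => // k w _.
have [a wa] := mixing_walk i k hmix; have [z lz] := mixing_walk k k hmix.
pose c := (wsum f a (per z) - r 0 - (size a)%:R)%R.
exists (expR (- c)); first exact: expR_ge0.
move=> n; rewrite expRN lee_pdivlMl ?expR_gt0//.
apply: (@le_trans _ _ (prefix_sum B (F n) (a ++ k :: w) x0)); last first.
  rewrite (_ : a ++ k :: w = [:: i] ++ (behead a ++ k :: w)); first exact: prefix_sum_prefix.
  by case: a wa {c} => // i' a /andP[/eqP[->]].
apply: prefix_sum_cat_ge => v [hv kv].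
have cv : cylinder B k (glue v x0).
  by split=> //; case: v kv {hv} => //= j v /andP[/eqP <-].
split; first by rewrite glue_cat; exact: (walk_glue wa cv).1.
have : (`|wsum f a (glue v x0) - wsum f a (per z)| <= r 0)%R.
  have [_ _ h] := W; apply: h => //; first exact: (walk_glue wa cv).1.
  exact: (walk_glue wa (cylinder_per lz)).1.
rewrite wsum_damped /c ler_norml.
have : (s n * (size a)%:R <= (size a)%:R)%R by rewrite ler_piMl// s1.
lra.
Qed.

(** This lower bound keeps the mass of each cylinder of length one positive in the limit;
    [loop_mass_le_prefix_sum_point] does the same for the eigenfunction. *)
Lemma loop_mass_le_prefix_sum k : exists2 C : R, (0 < C)%R &
  forall n, C%:E * loop_mass n <= prefix_sum B (F n) [:: k] x0.
Proof.
have [a wa] := mixing_walk k i hmix.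
pose c := (wsum f a x0 - r 0 - (size a)%:R)%R.
exists (expR c); first exact: expR_gt0.
move=> n; apply: (@le_trans _ _ (prefix_sum B (F n) (a ++ [:: i]) x0)); last first.
  rewrite (_ : a ++ [:: i] = [:: k] ++ (behead a ++ [:: i])); first exact: prefix_sum_prefix.
  by case: a wa {c} => // i' a /andP[/eqP[->]].
apply: prefix_sum_cat_ge => v [hv kv].
have cv : cylinder B i (glue v x0).
  by split=> //; case: v kv {hv} => //= j v /andP[/eqP <-].
split; first by rewrite glue_cat; exact: (walk_glue wa cv).1.
have : (`|wsum f a (glue v x0) - wsum f a x0| <= r 0)%R.
  have [_ _ h] := W; apply: h => //; first exact: (walk_glue wa cv).1.
  exact: (walk_glue wa hx0).1.
rewrite wsum_damped /c ler_norml.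
have : (s n * (size a)%:R <= (size a)%:R)%R by rewrite ler_piMl// s1.
lra.
Qed.

Lemma prefix_sum_point_le_loop_mass x : Sigma B x -> exists2 C : R, (0 <= C)%R &
  forall n, prefix_sum B (F n) [:: i] x <= C%:E * loop_mass n.
Proof.
move=> hx; have [b wb] := mixing_walk (x 0%N) i hmix.
pose c := (wsum f b x0 - (size b)%:R)%R.
exists (expR (r 1 - c)); first exact: expR_ge0.
have [hb b0] := walk_glue wb hx0.
move=> n; rewrite expRD EFinM -muleA.
apply: (le_trans (prefix_sum_point (walters_damped n) _ hx hb (ltn0Sn 0) _)).
  by case.
apply: lee_wpmul2l; first by rewrite lee_fin expR_ge0.
rewrite expRN lee_pdivlMl ?expR_gt0//; apply: le_trans (prefix_sum_glue _ _ _ b _).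
apply: lee_wpmul2r; first exact: prefix_sum_ge0.
rewrite lee_fin ler_expR wsum_damped /c.
have : (s n * (size b)%:R <= (size b)%:R)%R by rewrite ler_piMl// s1.
lra.
Qed.

Lemma loop_mass_le_prefix_sum_point x : Sigma B x -> exists2 C : R, (0 < C)%R &
  forall n, C%:E * loop_mass n <= prefix_sum B (F n) [:: i] x.
Proof.
move=> hx; have [a wa] := mixing_walk i (x 0%N) hmix.
pose c := (wsum f a x - (size a)%:R)%R.
exists (expR (c - r 1)); first exact: expR_gt0.
have [hb b0] := walk_glue wa (conj hx erefl).
move=> n; rewrite expRD EFinM -muleA.
apply: (@le_trans _ _ ((expR c)%:E * prefix_sum B (F n) [:: i] (glue a x))).
  apply: lee_wpmul2l; first by rewrite lee_fin expR_ge0.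
  rewrite expRN lee_pdivrMl ?expR_gt0//.
  apply: (prefix_sum_point (walters_damped n) _ hx0.1 hb (ltn0Sn 0)).
  by case=> // _; rewrite b0 hx0.2.
apply: le_trans (prefix_sum_glue _ _ _ a _).
apply: lee_wpmul2r; first exact: prefix_sum_ge0.
rewrite lee_fin ler_expR wsum_damped /c.
have : (s n * (size a)%:R <= (size a)%:R)%R by rewrite ler_piMl// s1.
lra.
Qed.

Section prime_classes.
Variable g : seq nat -> nat.

(** In the applications [g] reads off one letter of a prime, at a fixed position from its start or
    its end; the classes split the convergent sum over primes by this letter. *)
Definition prime_class (j : nat) : set (seq nat) := primes B i [:: i] `&` [set p | g p = j].

Lemma prime_class_summable : \sum_(j <oo) \esum_(p in prime_class j) loop_weight f p < +oo.
Proof.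
rewrite -nneseries_sum_bigcup; last first.
- by move=> w; exact: loop_weight_ge0.
- apply/trivIsetP => j k _ _ /eqP jk; rewrite -subset0 => w [[_ e] [_ e']].
  by apply: jk; rewrite -e -e'.
apply: le_lt_trans (ltry (expR (2 * r (size [:: i])))).
apply: le_trans (primes_le _ W hK); apply: sub_esum => w [j _ []]//.
Qed.

(** Cutting off a prime of class [j] leaves a loop, so the sum over [S] is at most a constant times
    the sum over the class times that over all loops. A prime standing alone is covered by
    [1 <= loop_mass n]. The primes are weighted without damping, which makes the bound uniform in
    [n]. *)
Lemma dominated_loops : exists2 C : R, (0 <= C)%R & forall n j (S : set (seq nat)),
  S `<=` prime_class j `|` (catset (prime_class j) (loops B i) `|`
    catset (loops B i) (prime_class j)) ->
  1 <= loop_mass n ->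
  \esum_(v in S) word_weight (F n) v x0 <= (C%:E * \esum_(p in prime_class j) loop_weight f p) * loop_mass n.
Proof.
pose C1 := expR (r 0); pose C2 := expR (2 * r 0).
have C10 : (0 <= C1)%R by exact: expR_ge0.
have C20 : (0 <= C2)%R by exact: expR_ge0.
exists (C1 * (1 + 2 * C2 * C1))%R.
  by rewrite mulr_ge0// addr_ge0// !mulr_ge0.
move=> n j S hS N1; set P := \esum_(p in _) loop_weight f p.
have P0 : 0 <= P by apply: esum_ge0 => *; exact: loop_weight_ge0.
have PFn : \esum_(p in prime_class j) loop_weight (F n) p <= P by apply: le_esum => p _; exact: loop_weight_damped_le.
have PF0 : 0 <= \esum_(p in prime_class j) loop_weight (F n) p by apply: esum_ge0 => *; exact: loop_weight_ge0.
have lp : prime_class j `<=` loops B i by move=> p [[[lp _] _] _].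
have Sl : S `<=` loops B i.
  by move=> v /hS[/lp//|[|]]; apply: catset_loops.
have N0 : 0 <= loop_mass n by exact: prefix_sum_ge0.
have LN : \esum_(w in loops B i) loop_weight (F n) w <= C1%:E * loop_mass n.
  rewrite /loop_mass /prefix_sum extensions_loops -esumZl//; last by move=> *; exact: word_weight_ge0.
  apply: le_esum => w lw; rewrite -EFinM lee_fin -expRD ler_expR.
  by have := word_weight_loop_weight (walters_damped n) lw; lra.
have L0 : 0 <= \esum_(w in loops B i) loop_weight (F n) w by apply: esum_ge0 => *; exact: loop_weight_ge0.
have cat_le v w : loop B i v -> loop B i w ->
    (lsum (F n) (v ++ w) <= lsum (F n) v + lsum (F n) w + 2 * r 0)%R.
  by move=> lv lw; exact: (lsum_cat_le (walters_damped n) lv lw).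
apply: (@le_trans _ _ (C1%:E * \esum_(v in S) loop_weight (F n) v)).
  rewrite -esumZl//; last by move=> *; exact: loop_weight_ge0.
  apply: le_esum => v Sv; rewrite -EFinM lee_fin -expRD ler_expR.
  by have := word_weight_loop_weight (walters_damped n) (Sl _ Sv); lra.
rewrite EFinM -!muleA; apply: lee_wpmul2l; first by rewrite lee_fin.
apply: le_trans (sub_esum _ hS) _.
apply: le_trans (esumU_le _ _ _) _; first by move=> *; exact: loop_weight_ge0.
have H1 : \esum_(v in catset (prime_class j) (loops B i)) loop_weight (F n) v <= C2%:E * (P * (C1%:E * loop_mass n)).
  apply: le_trans (esum_catset_le (C := 2 * r 0)%R _) _.
    by move=> v w /lp hv hw; exact: cat_le.
  by apply: lee_wpmul2l => //; apply: lee_pmul.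
have H2 : \esum_(v in catset (loops B i) (prime_class j)) loop_weight (F n) v <= C2%:E * (P * (C1%:E * loop_mass n)).
  apply: le_trans (esum_catset_le (C := 2 * r 0)%R _) _.
    by move=> v w hv /lp hw; exact: cat_le.
  by apply: lee_wpmul2l => //; rewrite muleC; apply: lee_pmul.
apply: (@le_trans _ _ (P * loop_mass n + (C2%:E * (P * (C1%:E * loop_mass n)) + C2%:E * (P * (C1%:E * loop_mass n))))).
  apply: leeD.
    by apply: (le_trans PFn); rewrite -[leLHS]mule1; apply: lee_wpmul2l.
  apply: le_trans (esumU_le _ _ _) _; first by move=> *; exact: loop_weight_ge0.
  exact: leeD.
have PN0 : 0 <= P * loop_mass n by rewrite mule_ge0.
have -> : C2%:E * (P * (C1%:E * loop_mass n)) = (C2 * C1)%:E * (P * loop_mass n).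
  by rewrite EFinM -!muleA (muleCA P).
have CC : 0 <= (C2 * C1)%:E by rewrite lee_fin mulr_ge0.
rewrite (_ : 1 + 2 * C2 * C1 = 1 + (C2 * C1 + C2 * C1))%R; last by ring.
by rewrite (EFinD 1) (EFinD (C2 * C1)) !ge0_muleDl ?mul1e// adde_ge0.
Qed.

End prime_classes.

(** After division by [loop_mass n] this is the hypothesis of dominated convergence for series in
    [j]. *)
Definition dominated (a : nat -> nat -> \bar R) : Prop :=
  exists2 b : nat -> \bar R, (forall j, 0 <= b j) /\ \sum_(j <oo) b j < +oo &
  forall n j, 1 <= loop_mass n -> a n j <= b j * loop_mass n.

(** The letter [i] may start a new prime factor, so the classes give no control for [j = i]; this
    single index is bounded by [D] separately. *)
Lemma dominated_classes (g : seq nat -> nat) (C D : R) (a : nat -> nat -> \bar R)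
    (S : nat -> set (seq nat)) : (0 <= C)%R -> (0 <= D)%R ->
  (forall n, a n i <= D%:E * loop_mass n) ->
  (forall n j, j != i -> a n j <= C%:E * \esum_(v in S j) word_weight (F n) v x0) ->
  (forall j, j != i -> S j `<=` prime_class g j `|` (catset (prime_class g j) (loops B i) `|`
    catset (loops B i) (prime_class g j))) ->
  dominated a.
Proof.
move=> C0 D0 hi hj hS; have [M M0 hM] := dominated_loops g.
pose e j := (C * M)%:E * \esum_(p in prime_class g j) loop_weight f p.
have e0 j : 0 <= e j.
  by rewrite mule_ge0 ?lee_fin ?mulr_ge0//; apply: esum_ge0 => *; exact: loop_weight_ge0.
have d0 j : 0 <= (if j == i then D%:E else 0) by case: ifP; rewrite ?lee_fin.
exists (fun j => (if j == i then D%:E else 0) + e j).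
  split; first by move=> j; rewrite adde_ge0.
  rewrite nneseriesD//; apply: lte_add_pinfty.
    rewrite (nneseries_split _ i.+1)// add0n eseries0 ?adde0; last first.
      by move=> k hk _; rewrite ifF//; apply/eqP; lia.
    by apply: lte_sum_pinfty => k _; case: ifP; rewrite ?ltry.
  rewrite nneseriesZl; last by move=> j _; apply: esum_ge0 => *; exact: loop_weight_ge0.
  apply: lte_mul_pinfty; rewrite ?lee_fin ?mulr_ge0//; exact: prime_class_summable.
move=> n j N1; have N0 : 0 <= loop_mass n by exact: le_trans N1.
have [->|ji] := eqVneq j i.
  by apply: (le_trans (hi n)); apply: lee_wpmul2r => //; rewrite leeDl.
rewrite add0e; apply: (le_trans (hj n j ji)).
rewrite /e EFinM -!muleA; apply: lee_wpmul2l; first by rewrite lee_fin.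
by rewrite muleA; apply: hM => //; exact: hS.
Qed.

(** Up to factors uniform in [n] and [j], the prefix [w] is replaced by a path [a'] from [i] to the
    last letter of [w] that does not return to [i]. The next letter [j] then lies in the first prime
    factor, at position [size a']. *)
Lemma dominated_extensions w : w != [::] ->
  dominated (fun n j => prefix_sum B (F n) (rcons w j) x0).
Proof.
case/lastP: w => // w l _.
have [[y [hy y0]]|ny] := pselect (exists y : borel_seqs, Sigma B (glue w y) /\ y 0%N = l); last first.
  exists (fun=> 0); first by split=> //; rewrite eseries0// ltry.
  move=> n j _; rewrite mul0e /prefix_sum esum1// => v [hv /prefixP[t e]]; exfalso; apply: ny.
  exists (glue ([:: l; j] ++ t) x0); split=> //.
  by move: hv; rewrite e -glue_cat -cats1 -cats1 -!catA.
have [a' [ha ia wa]] : exists a', [/\ ohead a' = Some i, i \notin behead a' &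
    exists a, a' = rcons a l /\ (a = [::] \/ walk B i l a)].
  have [->|il] := eqVneq i l; first by exists [:: l]; split=> //; exists [::]; split=> //; left.
  have [a [wa ia]] := first_walk_from hmix il.
  exists (rcons a l); case: a wa ia => // i' a wa ia; split.
  - by case/andP: wa => /eqP[->].
  - by rewrite /= mem_rcons inE negb_or il.
  - by exists (i' :: a); split=> //; right.
have [a [ea wal]] := wa.
have [D D0 hD] : exists2 D : R, (0 <= D)%R & forall n, prefix_sum B (F n) (rcons (rcons w l) i) x0 <= D%:E * loop_mass n.
  by apply: prefix_sum_le_loop_mass; case: w {hy}.
pose c1 := (wsum f w y + r 0)%R.
have h1 n j : prefix_sum B (F n) (rcons (rcons w l) j) x0 <= (expR c1)%:E * prefix_sum B (F n) [:: l; j] x0.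
  rewrite -2!cats1 -catA; apply: prefix_sum_cat_le => v hv pv.
  have [_ _ h] := walters_damped n.
  have v0 : glue v x0 0%N = l by case: v pv {hv} => //= k v /andP[/eqP <-].
  have : (`|wsum (F n) w (glue v x0) - wsum (F n) w y| <= r 0)%R.
    by apply: h => //; move: hv; rewrite glue_cat.
  have : (wsum (F n) w y <= wsum f w y)%R.
    by rewrite wsum_damped gerBl mulr_ge0// ltW// s0.
  by rewrite /c1 ler_norml; lra.
have [c2 h2] : exists c2 : R, forall n j, prefix_sum B (F n) [:: l; j] x0 <= (expR c2)%:E * prefix_sum B (F n) (rcons a' j) x0.
  case: wal => [a0|wal].
    by exists 0%R => n j; rewrite ea a0 expR0 mul1e.
  have [z lz] := mixing_walk l l hmix.
  pose c := (wsum f a (per z) - r 0 - (size a)%:R)%R.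
  exists (- c)%R => n j; rewrite expRN lee_pdivlMl ?expR_gt0// ea.
  rewrite -2!cats1 -catA; apply: prefix_sum_cat_ge => v [hv kv].
  have cv : cylinder B l (glue v x0).
    by split=> //; case: v kv {hv} => //= k v /andP[/eqP <-].
  split; first by rewrite glue_cat; exact: (walk_glue wal cv).1.
  have : (`|wsum f a (glue v x0) - wsum f a (per z)| <= r 0)%R.
    have [_ _ h] := W; apply: h => //; first exact: (walk_glue wal cv).1.
    exact: (walk_glue wal (cylinder_per lz)).1.
  rewrite wsum_damped /c ler_norml.
  have : (s n * (size a)%:R <= (size a)%:R)%R by rewrite ler_piMl// s1.
  lra.
apply: (@dominated_classes (fun p => nth 0%N p (size a')) (expR (c1 + c2)) D _
  (fun j => extensions B (rcons a' j) x0)); rewrite ?expR_ge0//.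
- move=> n j ji; apply: (le_trans (h1 n j)); rewrite expRD EFinM -muleA.
  by apply: lee_wpmul2l; [rewrite lee_fin expR_ge0|exact: h2].
move=> j ji v [hv pv].
have lv : loops B i v.
  rewrite -extensions_loops; split=> //.
  apply: (prefix_trans _ pv); case: (a') ha => // i' t [->] /=; by rewrite eqxx prefix0s.
have [p [pp np [->|[u lu ->]]]] := loop_prime_first ia ha ji pv lv; first by left.
by right; left; exists (p, u).
Qed.

(** Dually, the words are continued by a path [b] from [x 0] to [i] that avoids [i]. The letter [a]
    before it then lies in the last prime factor, at a distance from the end that depends on [b]
    only. *)
Lemma dominated_endings x : Sigma B x ->
  dominated (fun n a => \esum_(v in ending B [:: i] a x) word_weight (F n) (rcons v a) x).
Proof.
move=> hx.
have [b [ib [hb b0]]] : exists b, i \notin b /\ cylinder B (x 0%N) (glue b x0).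
  have [e|xi] := eqVneq (x 0%N) i; first by exists [::]; rewrite e.
  have [b [wb ib]] := first_walk_to hmix xi.
  by exists b; split=> //; exact: walk_glue wb hx0.
have [D D0 hD] := prefix_sum_point_le_loop_mass hx.
pose c := (wsum f b x0 - (size b)%:R)%R.
apply: (@dominated_classes (fun p => nth 0%N p (size p - (size b).+1)) (expR (r 0 - c)) D _
  (fun a => [set w | exists2 v, ending B [:: i] a (glue b x0) v & w = v ++ a :: b])); rewrite ?expR_ge0//.
- move=> n; apply: le_trans (hD n); rewrite /prefix_sum.
  rewrite -(esum_image _ (fun v => rcons v i) (fun v => word_weight (F n) v x)); last first.
    by move=> v v' _ _ /rcons_inj[].
  apply: sub_esum => _ [v [hv pv] <-]; split=> //.
  by rewrite -cats1; move/prefixP: pv => [t ->]; rewrite -catA prefix_prefix.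
- move=> n a ai.
  have sub : ending B [:: i] a x `<=` ending B [:: i] a (glue b x0).
    by move=> v [hv pv]; split=> //; apply: Sigma_glueS hv _ hb.
  apply: (@le_trans _ _ (\esum_(v in ending B [:: i] a (glue b x0))
      ((expR (r 0 - c))%:E * word_weight (F n) (v ++ a :: b) x0))).
    apply: le_trans (sub_esum _ sub); apply: le_esum => v hv.
    rewrite -EFinM lee_fin -expRD ler_expR -cat_rcons [in leRHS]wsum_cat.
    have [_ _ h] := walters_damped n.
    have : (`|wsum (F n) (rcons v a) x - wsum (F n) (rcons v a) (glue b x0)| <= r 0)%R.
      by apply: h => //; [exact: hv.1|exact: (sub _ hv).1].
    have : (c <= wsum (F n) b x0)%R.
      rewrite wsum_damped /c lerD2l lerN2 ler_piMl// s1//.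
    by rewrite ler_norml; lra.
  rewrite esumZl; [|by rewrite lee_fin expR_ge0|by move=> *; exact: word_weight_ge0].
  apply: lee_wpmul2l; first by rewrite lee_fin expR_ge0.
  rewrite -(esum_image _ (fun v => v ++ a :: b) (fun v => word_weight (F n) v x0)); last first.
    move=> v v' _ _ e; have sv : size v = size v'.
      by move: (congr1 size e); rewrite !size_cat => /addIn.
    by move/eqP: e; rewrite eqseq_cat// => /andP[/eqP].
  by apply: sub_esum => _ [v hv <-]; exists v.
move=> a ai _ [v [hv pv] ->].
have lv : loops B i (v ++ a :: b).
  rewrite -extensions_loops; split.
    by rewrite -cat_rcons glue_cat.
  by move/prefixP: pv => [t ->]; rewrite -catA prefix_prefix.
have v0 : v != [::] by case: (v) pv.
have [p [pp np [->|[u lu ->]]]] := loop_prime_last ib ai v0 lv; first by left.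
by right; right; exists (u, p).
Qed.

End domination.

(** * Eigendata as ultralimits *)

Section ultralimits.
Context {R : realType}.
Variable U : set_system nat.
Hypothesis UU : UltraFilter U.

Let UF : ProperFilter U := @ultra_proper _ _ UU.
Existing Instance UF.

Lemma ultralimit (a : nat -> R) (C : R) : (\forall n \near U, (`|a n| <= C)%R) ->
  exists l : R, a @ U --> l.
Proof.
move=> aC; have aU : UltraFilter (a @ U).
  apply: Build_UltraFilter => G FG hG.
  apply/seteqP; split=> [A GA|//]; have [//|h] := in_ultra_setVsetC (a @^-1` A) UU.
  have GnA : G (~` A) by apply: hG; exact: h.
  have G0 : G set0 by rewrite -(setICr A); exact: filterI.
  by case: (@filter_not_empty _ G _ G0).
have := @segment_compact R (- C) C; rewrite compact_ultra => /(_ _ aU).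
case; first by move: aC; apply: filterS => n /=; rewrite in_itv/= ler_norml.
by move=> l [_ hl]; exists l.
Qed.

Lemma cvg_partial_sum (a : nat -> nat -> R) (l : nat -> R) N :
  (forall j, (fun n => a n j) @ U --> l j) ->
  (fun n => \sum_(0 <= j < N) a n j)%R @ U --> (\sum_(0 <= j < N) l j)%R.
Proof.
move=> h; elim: N => [|N IH].
  rewrite big_nil; rewrite (_ : (fun n => _) = fun=> 0%R); first exact: cvg_cst.
  by apply/funext => n; rewrite big_nil.
rewrite big_nat_recr//= (_ : (fun n => _) = fun n => (\sum_(0 <= j < N) a n j + a n N)%R).
  exact: cvgD.
by apply/funext => n; rewrite big_nat_recr.
Qed.

(** Dominated convergence for series along an ultrafilter. Partial sums give one inequality; the
    other uses the tail of [b], which prevents mass from escaping to large [j]. *)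
Lemma dominated_sum (a : nat -> nat -> R) (l : nat -> R) (b : nat -> \bar R)
    (A err : nat -> R) (A0 : R) :
  (forall j, (fun n => a n j) @ U --> l j) -> (forall n j, (0 <= a n j)%R) ->
  (forall j, 0 <= b j) -> \sum_(j <oo) b j < +oo ->
  (\forall n \near U, forall j, (a n j)%:E <= b j) ->
  (\forall n \near U, (A n)%:E = (err n)%:E + \sum_(j <oo) (a n j)%:E) ->
  err @ U --> 0%R -> A @ U --> A0 ->
  \sum_(j <oo) (l j)%:E = A0%:E.
Proof.
move=> al a0 b0 bfin ab hA herr hA0.
have l0 j : (0 <= l j)%R.
  by apply: (ler_cvg_to (cvg_cst 0%R) (al j)); exact: nearW.
have dE : (fun n => A n - err n)%R @ U --> A0.
  by rewrite -[A0 in X in _ --> X]subr0; exact: cvgB.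
apply/eqP; rewrite eq_le; apply/andP; split.
  apply: lime_le; first by apply: is_cvg_nneseries => n _ _; rewrite lee_fin.
  apply: nearW => N; rewrite sumEFin lee_fin.
  have H0 := cvg_partial_sum (N := N) al.
  apply: (ler_cvg_to H0 dE).
  apply: filterS hA => n hn; rewrite -lee_fin EFinB hn addeAC subee// add0e -sumEFin.
  by apply: nneseries_lim_ge => j _ _; rewrite lee_fin.
have tail0 := nneseries_tail_cvg bfin (fun k _ => b0 k).
apply/lee_addgt0Pr => e e0.
have e0' : 0 < e%:E by rewrite lte_fin.
have [N _ hN] := cvge_lt tail0 e0'.
have {}hN := ltW (hN N (leqnn N)).
have : (A0 <= \sum_(0 <= j < N) l j + e)%R.
  have c2 : (fun n => \sum_(0 <= j < N) a n j + e)%R @ U --> (\sum_(0 <= j < N) l j + e)%R.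
    by apply: cvgD; [exact: cvg_partial_sum|exact: cvg_cst].
  apply: (ler_cvg_to dE c2).
  apply: filterS2 hA ab => n hn abn; rewrite -lee_fin EFinB hn addeAC subee// add0e.
  rewrite (nneseries_split _ N)//; last by move=> k _; rewrite lee_fin.
  rewrite add0n EFinD -sumEFin leeD2l//; apply: le_trans hN.
  by apply: lee_nneseries => k _; rewrite ?lee_fin.
rewrite -lee_fin EFinD => /le_trans; apply; rewrite leeD2r// -sumEFin.
by apply: nneseries_lim_ge => j _ _; rewrite lee_fin.
Qed.

End ultralimits.

Section eigendata.
Context {R : realType}.
Variable B : rel nat.
Hypothesis hmix : topologically_mixing B.
Variables (f : borel_seqs -> R) (r : nat -> R) (W : walters B f r).
Variable i : nat.
Variable K : R.
Hypothesis hK : forall n, (0 < n)%N -> Zbase B f n i <= K%:E.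
Hypothesis hdiv : \esum_(w in loops B i) loop_weight f w = +oo.
Notation F := (damped f).

Section ultrafilter.
Variable U : set_system nat.
Hypothesis UU : UltraFilter U.
Hypothesis Uoo : \oo `<=` U.
Variable x0 : borel_seqs.
Hypothesis hx0 : cylinder B i x0.

Let UF : ProperFilter U := @ultra_proper _ _ UU.
Existing Instance UF.

Notation N n := (loop_mass B f i x0 n).
Let NR n : R := fine (N n).

Let NE n : (NR n)%:E = N n.
Proof. by rewrite /NR fineK// ge0_fin_numE ?prefix_sum_ge0//; exact: (loop_mass_lty W hK hx0). Qed.

Let N_large (L : R) : \forall n \near U, (L <= NR n)%R.
Proof.
have := loop_mass_infty W hdiv hx0 L => /Uoo; apply: filterS => n.
by rewrite -NE lee_fin.
Qed.

Let N_ge0 n : (0 <= NR n)%R. Proof. by rewrite -lee_fin NE prefix_sum_ge0. Qed.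

Let NV0 : (fun n => (NR n)^-1)%R @ U --> (0 : R)%R.
Proof.
apply/cvgrPdist_lt => e e0.
have := N_large (e^-1 + 1)%R; apply: filterS => n hn.
have ei : (0 < e^-1)%R by rewrite invr_gt0.
rewrite sub0r normrN ger0_norm ?invr_ge0// invf_plt ?posrE//; lra.
Qed.

Let damping0 : (fun n : nat => n.+1%:R^-1)%R @ U --> (0 : R)%R.
Proof.
have h : (fun n : nat => n.+1%:R^-1)%R @ \oo --> (0 : R)%R by exact: cvg_harmonic.
by move=> A /h /Uoo.
Qed.

(** The single word that the recursions split off has a weight bounded in [n], which is negligible
    against the loop mass. *)
Let self0 w x G : (forall n, G n <= word_weight (F n) w x) -> (forall n, 0 <= G n) ->
  (fun n => fine (G n) / NR n)%R @ U --> (0 : R)%R.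
Proof.
move=> GC G0; pose c := expR (wsum f w x).
have hc n : (fine (G n) <= c)%R.
  have h : G n <= c%:E.
    apply: (le_trans (GC n)); rewrite lee_fin ler_expR wsum_damped gerBl.
    by rewrite mulr_ge0// invr_ge0.
  by rewrite -lee_fin fineK// ge0_fin_numE//; exact: le_lt_trans h (ltry _).
apply: (@squeeze_cvgr _ _ _ _ (fun=> 0%R) (fun n => c * (NR n)^-1)%R).
- apply: nearW => n; apply/andP; split; first by apply: divr_ge0 => //; exact: fine_ge0.
  by apply: ler_wpM2r => //; rewrite invr_ge0.
- exact: cvg_cst.
- by rewrite -[X in _ --> X](mulr0 c); apply: cvgM => //; exact: cvg_cst.
Qed.

Section weights.

Let E n w : R := fine (prefix_sum B (F n) w x0).

Let EfE n w : w != [::] -> (E n w)%:E = prefix_sum B (F n) w x0.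
Proof.
move=> w0; have [C C0 hC] := prefix_sum_le_loop_mass hmix W i x0 w0.
rewrite /E fineK// ge0_fin_numE ?prefix_sum_ge0//; apply: (le_lt_trans (hC n)).
by rewrite -NE -EFinM ltry.
Qed.

Let E_ge0 n w : (0 <= E n w)%R. Proof. by rewrite fine_ge0// prefix_sum_ge0. Qed.

Let pn n w : R := (E n w / NR n)%R.

Let pn_ge0 n w : (0 <= pn n w)%R. Proof. by rewrite divr_ge0. Qed.

(** The empty word is excluded: its mass would be that of the whole space, which may be infinite. *)
Lemma weights_cvg w : exists l : R, w != [::] -> (fun n => pn n w) @ U --> l.
Proof.
have [->|w0] := eqVneq w [::]; first by exists 0%R.
have [C C0 hC] := prefix_sum_le_loop_mass hmix W i x0 w0.
have [|l hl] := @ultralimit _ U UU (fun n => pn n w) C; last by exists l.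
have := N_large 1; apply: filterS => n N1.
rewrite ger0_norm// ler_pdivrMr ?(lt_le_trans _ N1)//.
by rewrite -lee_fin EfE// EFinM NE; exact: hC.
Qed.

Let q w := projT1 (cid (weights_cvg w)).

Let qE w : w != [::] -> (fun n => pn n w) @ U --> q w.
Proof. exact: (projT2 (cid (weights_cvg w))). Qed.

Lemma weights_ge0 w : w != [::] -> (0 <= q w)%R.
Proof.
by move=> w0; have H := qE w0; apply: (ler_cvg_to (cvg_cst 0%R) H); exact: nearW.
Qed.

Lemma weights_gt0 j : (0 < q [:: j])%R.
Proof.
have [C C0 hC] := loop_mass_le_prefix_sum hmix W hx0 j; apply: (lt_le_trans C0).
have H : (fun n => pn n [:: j]) @ U --> q [:: j] by exact: qE.
apply: (ler_cvg_to (cvg_cst C) H).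
have := N_large 1; apply: filterS => n N1.
rewrite ler_pdivlMr ?(lt_le_trans _ N1)//.
by rewrite -lee_fin EFinM NE EfE.
Qed.

Lemma weights_sum w : w != [::] -> \sum_(j <oo) (q (rcons w j))%:E = (q w)%:E.
Proof.
move=> w0; have wj j : rcons w j != [::] by case: (w).
have [b [b0 bfin] hb] := dominated_extensions hmix W hK hx0 w0.
pose self n := \esum_(v in extensions B w x0 `&` [set w]) word_weight (F n) v x0.
have self_ge0 n : 0 <= self n by apply: esum_ge0 => *; exact: word_weight_ge0.
have self_le n : self n <= word_weight (F n) w x0 by exact: esum_self_le.
have self_fin n : self n \is a fin_num.
  by rewrite ge0_fin_numE//; apply: (le_lt_trans (self_le n)); exact: ltry.
apply: (@dominated_sum _ U UU (fun n j => pn n (rcons w j)) _ b (fun n => pn n w)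
  (fun n => fine (self n) / NR n)%R) => //.
- by move=> j; exact: qE.
- have := N_large 1; apply: filterS => n N1 j.
  have N0 : (0 < NR n)%R by lra.
  have N1' : 1 <= N n by rewrite -NE lee_fin.
  rewrite /pn mulrC EFinM lee_pdivrMl// EfE// muleC NE; exact: hb.
- have := N_large 1; apply: filterS => n N1.
  have N0 : (0 < NR n)%R by lra.
  have iN0 : (0 <= (NR n)^-1)%R by rewrite invr_ge0.
  rewrite /pn mulrC EFinM EfE// prefix_sum_rec -/(self n) ge0_muleDr//; last first.
    by apply: nneseries_ge0 => *; exact: prefix_sum_ge0.
  congr (_ + _); first by rewrite -(fineK (self_fin n)) -EFinM mulrC.
  rewrite -nneseriesZl//; last by move=> *; exact: prefix_sum_ge0.
  by apply: eq_eseriesr => j _; rewrite -EfE// -EFinM mulrC.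
- exact: self0 self_le self_ge0.
- exact: qE.
Qed.

Lemma weights_inadmissible w : w != [::] -> (forall y, ~ Sigma B (glue w y)) -> q w = 0%R.
Proof.
move=> w0 hw; have H : (fun n => pn n w) @ U --> (0 : R)%R.
  rewrite (_ : (fun n => pn n w) = fun=> 0%R); first exact: cvg_cst.
  apply/funext => n; rewrite /pn /E /prefix_sum esum1 ?mul0r// => v [hv /prefixP[t e]].
  by exfalso; apply: (hw (glue t x0)); rewrite -glue_cat -e.
by apply: (@cvg_unique _ _ (fmap (fun n => pn n w) U)) => //; exact: qE.
Qed.

(** Prefixing [a] multiplies each weight by [expR] of [f] at a point of the cylinder of
    [a :: k :: w], where [f] varies by at most [r (size (k :: w))]; the damping disappears in the
    limit. This is conformality on cylinders up to an error that is small for long cylinders. *)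
Lemma weights_cons a k w y : Sigma B (glue (a :: k :: w) y) ->
  (expR (f (glue (a :: k :: w) y) - r (size (k :: w))) * q (k :: w) <= q (a :: k :: w)
   <= expR (f (glue (a :: k :: w) y) + r (size (k :: w))) * q (k :: w))%R.
Proof.
move=> hy; pose z := glue (a :: k :: w) y; pose L := size (k :: w).
have H1 : (fun n => pn n (k :: w)) @ U --> q (k :: w) by exact: qE.
have H2 : (fun n => pn n (a :: k :: w)) @ U --> q (a :: k :: w) by exact: qE.
have hz v x : Sigma B (glue (a :: v) x) -> prefix (k :: w) v ->
    (`|f (glue (a :: v) x) - f z| <= r L)%R.
  move=> hv /prefixP[t e]; have [_ _ h] := W.
  have ag j : (j < L)%N -> glue v x j = glue (k :: w) y j.
    by move=> hj; rewrite e glue_cat glueE [RHS]glueE hj.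
  by have := h [:: a] (glue v x) (glue (k :: w) y) L; rewrite /= !addr0; apply.
have aB : B a k by have [] := (Sigma_scons B a (glue (k :: w) y)).1 hy.
pose c1 n := expR (f z - r L - n.+1%:R^-1)%R.
pose c2 n := expR (f z + r L - n.+1%:R^-1)%R.
have cvgc (d : R) : (fun n : nat => expR (d - n.+1%:R^-1)) @ U --> expR d.
  have H : (fun n : nat => d - n.+1%:R^-1)%R @ U --> (d - 0)%R.
    by apply: cvgB => //; exact: cvg_cst.
  by have := cvg_comp _ _ H (@continuous_expR R _); rewrite subr0.
have damped1 n v x : wsum (F n) [:: a] (glue v x) = (f (glue (a :: v) x) - n.+1%:R^-1)%R.
  by rewrite /= addr0.
apply/andP; split.
  have H3 : (fun n => c1 n * pn n (k :: w))%R @ U --> (expR (f z - r L) * q (k :: w))%R.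
    exact: (cvgM (cvgc _) H1).
  apply: (ler_cvg_to H3 H2); apply: nearW => n.
  rewrite /pn mulrA ler_wpM2r ?invr_ge0// -lee_fin EFinM !EfE//.
  apply: (@prefix_sum_cat_ge _ _ _ [:: a]) => v [hv pv].
  have hav : Sigma B (glue (a :: v) x0).
    by apply/Sigma_scons; split=> //; case: v pv {hv} => //= j v /andP[/eqP <-].
  split=> //; rewrite damped1 lerD2r.
  by have := hz v x0 hav pv; rewrite ler_norml; lra.
have H3 : (fun n => c2 n * pn n (k :: w))%R @ U --> (expR (f z + r L) * q (k :: w))%R.
  exact: (cvgM (cvgc _) H1).
apply: (ler_cvg_to H2 H3); apply: nearW => n.
rewrite /pn mulrA ler_wpM2r ?invr_ge0// -lee_fin EFinM !EfE//.
apply: (@prefix_sum_cat_le _ _ _ [:: a]) => v hav pv; rewrite damped1 lerD2r.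
by have := hz v x0 hav pv; rewrite ler_norml; lra.
Qed.

Lemma weights_exist : exists p : seq nat -> R, [/\ forall w, (0 <= p w)%R,
  forall j, (0 < p [:: j])%R,
  forall w, w != [::] -> \sum_(j <oo) (p (rcons w j))%:E = (p w)%:E,
  forall w, w != [::] -> (forall y, ~ Sigma B (glue w y)) -> p w = 0%R &
  forall a k w y, Sigma B (glue (a :: k :: w) y) ->
   (expR (f (glue (a :: k :: w) y) - r (size (k :: w))) * p (k :: w) <= p (a :: k :: w)
    <= expR (f (glue (a :: k :: w) y) + r (size (k :: w))) * p (k :: w))%R].
Proof.
exists (fun w => if w is [::] then 0%R else q w); split.
- by move=> [//|a w]; exact: weights_ge0.
- exact: weights_gt0.
- move=> [//|a w] _; rewrite -(weights_sum (w := a :: w))//.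
- by move=> [//|a w] _; exact: weights_inadmissible.
- exact: weights_cons.
Qed.

End weights.

Section eigenfunction.

Let E n x : R := fine (prefix_sum B (F n) [:: i] x).

Let EfE n x : Sigma B x -> (E n x)%:E = prefix_sum B (F n) [:: i] x.
Proof.
move=> hx; have [C C0 hC] := prefix_sum_point_le_loop_mass hmix W hx0 hx.
rewrite /E fineK// ge0_fin_numE ?prefix_sum_ge0//; apply: (le_lt_trans (hC n)).
by rewrite -NE -EFinM ltry.
Qed.

Let E_ge0 n x : (0 <= E n x)%R. Proof. by rewrite fine_ge0// prefix_sum_ge0. Qed.

Let hn n x : R := (E n x / NR n)%R.

Let hn_ge0 n x : (0 <= hn n x)%R. Proof. by rewrite divr_ge0. Qed.

Lemma eigen_cvg x : exists l : R, Sigma B x -> (fun n => hn n x) @ U --> l.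
Proof.
have [hx|nx] := pselect (Sigma B x); last by exists 0%R.
have [C C0 hC] := prefix_sum_point_le_loop_mass hmix W hx0 hx.
have [|l hl] := @ultralimit _ U UU (fun n => hn n x) C; last by exists l.
have := N_large 1; apply: filterS => n N1.
rewrite ger0_norm// ler_pdivrMr ?(lt_le_trans _ N1)//.
by rewrite -lee_fin EfE// EFinM NE; exact: hC.
Qed.

Let h x := projT1 (cid (eigen_cvg x)).

Let hE x : Sigma B x -> (fun n => hn n x) @ U --> h x.
Proof. exact: (projT2 (cid (eigen_cvg x))). Qed.

Lemma eigen_gt0 x : Sigma B x -> (0 < h x)%R.
Proof.
move=> hx; have [C C0 hC] := loop_mass_le_prefix_sum_point hmix W hx0 hx; apply: (lt_le_trans C0).
have H := hE hx; apply: (ler_cvg_to (cvg_cst C) H).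
have := N_large 1; apply: filterS => n N1.
rewrite ler_pdivlMr ?(lt_le_trans _ N1)//.
by rewrite -lee_fin EFinM NE EfE.
Qed.

Lemma eigen_ratio x y L : Sigma B x -> Sigma B y -> (0 < L)%N ->
  (forall j, (j < L)%N -> x j = y j) -> (h x <= expR (r L) * h y)%R.
Proof.
move=> hx hy L0 e; have H1 := hE hx.
have H2 : (fun n => expR (r L) * hn n y)%R @ U --> (expR (r L) * h y)%R.
  by apply: cvgM; [exact: cvg_cst|exact: hE].
apply: (ler_cvg_to H1 H2); apply: nearW => n.
rewrite /hn mulrA ler_wpM2r ?invr_ge0// -lee_fin EFinM !EfE//.
exact: (prefix_sum_point (walters_damped W n)).
Qed.

Lemma eigen_sum x : Sigma B x ->
  \sum_(a <oo) (if B a (x 0%N) then expR (f (scons a x)) * h (scons a x) else 0)%:E = (h x)%:E.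
Proof.
move=> hx; have [b [b0 bfin] hb] := dominated_endings hmix W hK hx0 hx.
pose self n := \esum_(v in extensions B [:: i] x `&` [set [:: i]]) word_weight (F n) v x.
have self_ge0 n : 0 <= self n by apply: esum_ge0 => *; exact: word_weight_ge0.
have self_le n : self n <= word_weight (F n) [:: i] x by exact: esum_self_le.
have self_fin n : self n \is a fin_num.
  by rewrite ge0_fin_numE//; apply: (le_lt_trans (self_le n)); exact: ltry.
have sa a : B a (x 0%N) -> Sigma B (scons a x) by move=> ax; apply/Sigma_scons.
pose T n a : R := (if B a (x 0%N) then expR (f (scons a x) - n.+1%:R^-1) * E n (scons a x) else 0)%R.
have TE n a : (T n a)%:E = \esum_(v in ending B [:: i] a x) word_weight (F n) (rcons v a) x.
  rewrite /T; case: ifPn => ax; last by rewrite ending_empty.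
  by rewrite ending_cons// EFinM EfE//; exact: sa.
have T0 n a : (0 <= T n a)%R by rewrite -lee_fin TE; apply: esum_ge0 => *; exact: word_weight_ge0.
apply: (@dominated_sum _ U UU (fun n a => T n a / NR n)%R _ b (fun n => hn n x)
  (fun n => fine (self n) / NR n)%R) => //.
- move=> a; rewrite /T; case: ifPn => ax; last first.
    by under [X in X @ _]eq_fun do rewrite mul0r; exact: cvg_cst.
  under [X in X @ _]eq_fun do rewrite -mulrA.
  apply: cvgM; last exact/hE/sa.
  have H : (fun n : nat => f (scons a x) - n.+1%:R^-1)%R @ U --> (f (scons a x) - 0)%R.
    by apply: cvgB => //; exact: cvg_cst.
  by have := cvg_comp _ _ H (@continuous_expR R _); rewrite subr0.
- by move=> n a; rewrite divr_ge0.
- have := N_large 1; apply: filterS => n N1 a.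
  have N0 : (0 < NR n)%R by lra.
  have N1' : 1 <= N n by rewrite -NE lee_fin.
  rewrite mulrC EFinM lee_pdivrMl// TE muleC NE; exact: hb.
- have := N_large 1; apply: filterS => n N1.
  have N0 : (0 < NR n)%R by lra.
  have iN0 : (0 <= (NR n)^-1)%R by rewrite invr_ge0.
  rewrite /hn mulrC EFinM EfE// prefix_sum_last -/(self n) ge0_muleDr//; last first.
    by apply: nneseries_ge0 => *; rewrite -TE lee_fin.
  congr (_ + _); first by rewrite -(fineK (self_fin n)) -EFinM mulrC.
  rewrite -nneseriesZl//; last by move=> *; rewrite -TE lee_fin.
  by apply: eq_eseriesr => j _; rewrite -TE -EFinM mulrC.
- exact: self0 self_le self_ge0.
- exact: hE.
Qed.

Lemma eigenfunction_exists : exists h : borel_seqs -> R,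
  [/\ forall x, Sigma B x -> (0 < h x)%R,
   forall x y L, Sigma B x -> Sigma B y -> (0 < L)%N ->
    (forall j, (j < L)%N -> x j = y j) -> (h x <= expR (r L) * h y)%R &
   forall x, Sigma B x ->
    \sum_(a <oo) (if B a (x 0%N) then expR (f (scons a x)) * h (scons a x) else 0)%:E
      = (h x)%:E].
Proof. by exists h; split; [exact: eigen_gt0|exact: eigen_ratio|exact: eigen_sum]. Qed.

End eigenfunction.

End ultrafilter.
End eigendata.

(** * Measures on the sequence space *)

Section sequence_space.
Implicit Types (w : seq nat) (x y : borel_seqs).

Definition cyl w : set borel_seqs := [set x | mkseq x (size w) = w].

Lemma cyl_glue w y : cyl w (glue w y).
Proof.
apply: (@eq_from_nth _ 0%N); rewrite size_mkseq// => k hk.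
by rewrite nth_mkseq// glueE hk.
Qed.

Lemma cyl1 k x : cyl [:: k] x <-> x 0%N = k.
Proof. by split=> [[]//|<-]. Qed.

Lemma cylP w x : cyl w x <-> exists y, x = glue w y.
Proof.
split=> [h|[y ->]]; last exact: cyl_glue.
by exists (iter (size w) left_shift x); rewrite -{1}h glue_mkseq.
Qed.

Lemma cyl_mkseq x n : cyl (mkseq x n) x.
Proof. by rewrite /cyl /= size_mkseq. Qed.

Lemma cyl_agree x y n : cyl (mkseq x n) y <-> forall j, (j < n)%N -> x j = y j.
Proof.
rewrite /cyl /= size_mkseq; split=> [h j jn|h].
  by have := congr1 (fun s => nth 0%N s j) h; rewrite !nth_mkseq.
apply: (@eq_from_nth _ 0%N); rewrite ?size_mkseq// => j jn.
by rewrite !nth_mkseq ?h.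
Qed.

(** The sets that contain a cylinder around [x] form a filter that converges to [x] in every
    coordinate, hence in the product topology, so all neighborhoods of [x] belong to it. *)
Lemma nbhs_cyl x (O : set nat_seqs) : open O -> O x -> exists n, cyl (mkseq x n) `<=` O.
Proof.
move=> oO Ox.
pose F : set_system nat_seqs := [set A | exists n, cyl (mkseq x n) `<=` A].
have FF : Filter F.
  split; first by exists 0%N.
  - move=> P Q [m hm] [n hn]; exists (maxn m n) => y /cyl_agree h; split.
      by apply/hm/cyl_agree => j jm; apply: h; rewrite leq_max jm.
    by apply/hn/cyl_agree => j jm; apply: h; rewrite leq_max jm orbT.
  - by move=> P Q PQ [n hn]; exists n; apply: subset_trans PQ.
have : {ptws, F --> (x : nat_seqs)}.
  apply/pointwise_cvgP => t A /nbhs_singleton At; exists t.+1 => y /cyl_agree h /=.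
  by rewrite -h.
by move=> /(_ O); apply; apply: open_nbhs_nbhs; split.
Qed.

Lemma coord_open k (A : set nat) : open [set x : nat_seqs | A (x k)].
Proof.
rewrite openE => x /= Ax.
apply: (@proj_continuous _ (fun _ : nat => nat) k x).
by apply: open_nbhs_nbhs; split=> //; exact: discrete_open.
Qed.

Lemma cyl_open w : open (cyl w : set nat_seqs).
Proof.
rewrite openE => x xw.
have H n : nbhs (x : nat_seqs) [set y : nat_seqs | forall k, (k < n)%N -> x k = y k].
  elim: n => [|n IH]; first by apply: filterS filterT => y _ k.
  have Hn : nbhs (x : nat_seqs) [set y : nat_seqs | [set x n] (y n)].
    by apply: open_nbhs_nbhs; split=> //; exact: coord_open.
  apply: filterS2 IH Hn => y h hn k; rewrite ltnS leq_eqVlt => /orP[/eqP ->|]; last exact: h.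
  exact: esym.
apply: filterS (H (size w)) => y /cyl_agree; rewrite /cyl /= size_mkseq => ->.
exact: xw.
Qed.

Lemma measurable_cyl w : measurable (cyl w).
Proof. by apply: sub_sigma_algebra; exact: cyl_open. Qed.

(** The empty set makes the family closed under intersection. The empty word is left out since its
    cylinder may have infinite measure. *)
Definition cyls : set (set borel_seqs) :=
  [set A | A = set0 \/ exists2 w, w != [::] & A = cyl w].

Lemma open_cyls (O : set nat_seqs) : open O ->
  O = \bigcup_w (if `[< w != [::] /\ cyl w `<=` O >] then cyl w else set0).
Proof.
move=> oO; apply/seteqP; split=> [x Ox|x [w _]].
  have [n hn] := nbhs_cyl oO Ox; exists (mkseq x n.+1) => //.
  rewrite asboolT; first exact: cyl_mkseq.
  split=> // y /cyl_agree h; apply: hn; apply/cyl_agree => j jn; apply: h; exact: ltnW.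
by case: asboolP => [[_ h] /h|].
Qed.

Lemma cyls_generate : @measurable _ borel_seqs = <<s cyls >>.
Proof.
apply/seteqP; split; last first.
  apply: smallest_sub; first exact: sigma_algebra_measurable.
  by move=> _ [->|[w _ ->]]; [exact: measurable0|exact: measurable_cyl].
apply: smallest_sub; first exact: smallest_sigma_algebra.
move=> O /open_cyls ->.
pose T := g_sigma_algebraType cyls.
apply: (@countable_bigcupT_measurable _ T (seq nat)); first exact: countableP.
move=> w; case: asboolP => [[w0 _]|_]; apply: sub_sigma_algebra; last by left.
by right; exists w.
Qed.

Lemma measurable_seq_fun d (T : measurableType d) (D : set T) (f : T -> borel_seqs) :
  (forall w, w != [::] -> measurable (D `&` f @^-1` cyl w)) -> measurable_fun D f.
Proof.
move=> h; apply: (measurability cyls); first exact: cyls_generate.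
move=> _ [A [->|[w w0 ->]] <-]; last exact: h.
by rewrite preimage_set0 setI0.
Qed.

Lemma measurable_prefix (P : seq nat -> Prop) n : measurable [set x : borel_seqs | P (mkseq x n)].
Proof.
have -> : [set x : borel_seqs | P (mkseq x n)] =
    \bigcup_w (if `[< P w /\ size w = n >] then cyl w else set0).
  apply/seteqP; split=> [x Px|x [w _]].
    exists (mkseq x n) => //; rewrite asboolT; first exact: cyl_mkseq.
    by rewrite size_mkseq.
  by case: asboolP => // -[Pw sw] h; rewrite /= -sw h.
apply: (@countable_bigcupT_measurable _ _ (seq nat)); first exact: countableP.
by move=> w; case: asboolP => _; [exact: measurable_cyl|exact: measurable0].
Qed.

Lemma measurable_Sigma (B : rel nat) : measurable (Sigma B).
Proof.
have -> : Sigma B = \bigcap_n [set x : borel_seqs |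
    B (nth 0%N (mkseq x n.+2) n) (nth 0%N (mkseq x n.+2) n.+1)].
  apply/seteqP; split=> x h n.
    by move=> _; rewrite /mkset !nth_mkseq ?ltnS ?leqnSn//; exact: (h n).
  by have := h n I; rewrite /mkset !nth_mkseq ?ltnS ?leqnSn.
by apply: bigcap_measurableType => n _; exact: (measurable_prefix (fun s => B (nth 0%N s n) (nth 0%N s n.+1))).
Qed.

Lemma measurable_cylinder (B : rel nat) i : measurable (cylinder B i).
Proof.
have -> : cylinder B i = Sigma B `&` cyl [:: i].
  by apply/seteqP; split=> x [h1 h2]; split=> //; exact/cyl1.
by apply: measurableI; [exact: measurable_Sigma|exact: measurable_cyl].
Qed.

Lemma measurable_left_shift : measurable_fun setT left_shift.
Proof.
apply: measurable_seq_fun => w _; rewrite setTI.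
rewrite (_ : _ @^-1` _ = [set x : borel_seqs | behead (mkseq x (size w).+1) = w]).
  exact: (measurable_prefix (fun s => behead s = w)).
have E x n : behead (mkseq x n.+1) = mkseq (left_shift x) n.
  by rewrite /mkseq /= (iotaDl 1 0) -map_comp.
by apply/seteqP; split=> x; rewrite /cyl /mkset /preimage /mkset E.
Qed.

Lemma measurable_scons a : measurable_fun setT (scons a).
Proof.
apply: measurable_seq_fun => w _; rewrite setTI.
rewrite (_ : _ @^-1` _ = [set x : borel_seqs | mkseq (scons a (fun k => nth 0%N (mkseq x (size w)) k)) (size w) = w]).
  exact: (measurable_prefix (fun s => mkseq (scons a (fun k => nth 0%N s k)) (size w) = w)).
apply/seteqP; split=> x; rewrite /cyl /= => h; rewrite -[RHS]h;
  apply/eq_in_map => k; rewrite mem_iota add0n => /andP[_ hk]; case: k hk => //= k hk;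
  by rewrite nth_mkseq// ltnW.
Qed.

(** Within [Sigma B], the preimage of an open ray is a union of cylinders, of which there are only
    countably many. *)
Lemma measurable_regular {R : realType} (B : rel nat) (phi : borel_seqs -> R) :
  (forall x (e : R), Sigma B x -> (0 < e)%R -> exists n, forall y, Sigma B y ->
    (forall j, (j < n)%N -> x j = y j) -> (`|phi x - phi y| < e)%R) ->
  measurable_fun (Sigma B) phi.
Proof.
move=> h; apply: (measurability _ (RGenOInfty.measurableE R)).
move=> _ [_ [a ->] <-].
have -> : Sigma B `&` phi @^-1` `]a, +oo[%classic = Sigma B `&`
    \bigcup_w (if `[< Sigma B `&` cyl w `<=` phi @^-1` `]a, +oo[%classic >] then cyl w else set0).
  apply/seteqP; split=> [x [hx /=]|x [hx [w _]]].
    rewrite in_itv/= andbT => ax; split=> //.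
    have e0 : (0 < phi x - a)%R by rewrite subr_gt0.
    have [n hn] := h x _ hx e0.
    exists (mkseq x n) => //; rewrite asboolT; first exact: cyl_mkseq.
    move=> y [hy /cyl_agree xy]; rewrite /= in_itv/= andbT.
    by have := hn y hy xy; rewrite ltr_norml; lra.
  by case: asboolP => // h' xw; split=> //; exact: h'.
apply: measurableI; first exact: measurable_Sigma.
apply: (@countable_bigcupT_measurable _ _ (seq nat)); first exact: countableP.
by move=> w; case: asboolP => _; [exact: measurable_cyl|exact: measurable0].
Qed.

Lemma cyls_setI : setI_closed cyls.
Proof.
suff H v w : (size v <= size w)%N -> v != [::] -> w != [::] -> cyls (cyl v `&` cyl w).
  move=> _ _ [->|[v v0 ->]] [->|[w w0 ->]]; rewrite ?set0I ?setI0; try by left.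
  have [vw|/ltnW wv] := leqP (size v) (size w); first exact: H.
  by rewrite setIC; exact: H.
move=> vw v0 w0; have [e|ne] := eqVneq (take (size v) w) v.
  right; exists w => //; apply/seteqP; split=> [x []//|x xw]; split=> //.
  rewrite /cyl /= -[RHS]e -[in RHS]xw /mkseq -map_take take_iota.
  by rewrite (minn_idPl vw).
left; rewrite -subset0 => x [xv xw]; move/eqP: ne; apply.
by rewrite -[RHS]xv -[in LHS]xw /mkseq -map_take take_iota (minn_idPl vw).
Qed.

Lemma seq_measure_unique {R : realType} (m1 m2 : {measure set borel_seqs -> \bar R}) :
  (forall w, w != [::] -> m1 (cyl w) = m2 (cyl w)) ->
  (forall k, m1 (cyl [:: k]) < +oo) -> forall A, measurable A -> m1 A = m2 A.
Proof.
move=> h fin; apply: (measure_unique cyls (fun k => cyl [:: k])) => //.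
- exact: cyls_generate.
- exact: cyls_setI.
- by move=> k; right; exists [:: k].
- by apply/seteqP; split=> // x _; exists (x 0%N).
- by move=> _ [->|[w w0 ->]]; [rewrite !measure0|exact: h].
Qed.

End sequence_space.

(** * Measures with prescribed masses of cylinders *)

Section weights_measure.
Context {R : realType}.
Variable p : seq nat -> R.
Hypothesis p_ge0 : forall w, (0 <= p w)%R.
Hypothesis p_rcons : forall w, w != [::] -> \sum_(j <oo) (p (rcons w j))%:E = (p w)%:E.

Implicit Types (w : seq nat) (y : R).

(* The measure is the image of Lebesgue measure under the map that reads off
   the nested intervals [I w] of length [p w] containing a given point. *)
Let lo (w : seq nat) : R :=
  (\sum_(n < size w) \sum_(l < nth 0%N w n) p (rcons (take n w) l))%R.

Let lo_rcons w j : lo (rcons w j) = (lo w + \sum_(l < j) p (rcons w l))%R.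
Proof.
rewrite /lo size_rcons big_ord_recr /= nth_rcons ltnn eqxx; congr (_ + _)%R.
  apply: eq_bigr => n _; rewrite nth_rcons ltn_ord -[rcons w j]cats1 takel_cat//.
  exact: ltnW.
by apply: eq_bigr => l _; rewrite -[rcons w j]cats1 take_size_cat.
Qed.

Let I (w : seq nat) : set R := [set y | (lo w <= y < lo w + p w)%R].

Let partial_le w j : w != [::] -> (\sum_(l < j) p (rcons w l) <= p w)%R.
Proof.
move=> w0; rewrite -lee_fin -(p_rcons w0) -sumEFin -(big_mkord xpredT (fun l => (p (rcons w l))%:E)).
by apply: nneseries_lim_ge => k _ _; rewrite lee_fin.
Qed.

Let I_sub w j : w != [::] -> I (rcons w j) `<=` I w.
Proof.
move=> w0 y; rewrite /I /= lo_rcons => /andP[h1 h2].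
have h0 : (0 <= \sum_(l < j) p (rcons w l))%R by apply: sumr_ge0 => l _; exact: p_ge0.
have := partial_le j.+1 w0; rewrite big_ord_recr /=; lra.
Qed.

Let I_inj w j l y : I (rcons w j) y -> I (rcons w l) y -> j = l.
Proof.
suff H j' l' : (j' < l')%N -> I (rcons w j') y -> I (rcons w l') y -> False.
  by move=> h1 h2; case: (ltngtP j l) => // h; [case: (H _ _ h h1 h2)|case: (H _ _ h h2 h1)].
move=> jl; rewrite /I /= !lo_rcons => h1 h2.
have : (\sum_(i < j'.+1) p (rcons w i) <= \sum_(i < l') p (rcons w i))%R.
  rewrite -!(big_mkord xpredT (fun i => p (rcons w i))) [leRHS](big_cat_nat (n := j'.+1))//=.
  by rewrite lerDl; apply: sumr_ge0 => i _.
rewrite big_ord_recr /=; lra.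
Qed.

Let I_cover w y : w != [::] -> I w y -> exists j, I (rcons w j) y.
Proof.
move=> w0 /andP[h1 h2].
have [n hn] : exists n, (y < lo w + \sum_(l < n) p (rcons w l))%R.
  have h : ((y - lo w)%:E < \sum_(j <oo) (p (rcons w j))%:E).
    by rewrite p_rcons// lte_fin; lra.
  apply: contrapT => hN; move: h; rewrite ltNge => /negP; apply.
  apply: lime_le.
    by apply: is_cvg_nneseries => k _ _; rewrite lee_fin.
  near=> n; rewrite sumEFin lee_fin big_mkord.
  have /negP : ~ (y < lo w + \sum_(l < n) p (rcons w l))%R by move=> ?; apply: hN; exists n.
  by rewrite -leNgt; lra.
pose P n := (y < lo w + \sum_(l < n) p (rcons w l))%R.
have exP : exists n, P n by exists n.
case: (ex_minnP exP) => -[|j] hj jmin.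
  by move: hj; rewrite /P big_ord0; lra.
exists j; rewrite /I /= !lo_rcons.
have : ~~ P j by apply/negP => /jmin; rewrite ltnn.
move: hj; rewrite /P big_ord_recr /=; lra.
Unshelve. all: by end_near. Qed.

Let next (w : seq nat) y := xget 0%N [set j | I (rcons w j) y].
Let word y n : seq nat := iter n (fun w => rcons w (next w y)) [::].
Let Dom : set R := [set y | exists k, I [:: k] y].
(** The constant value outside [Dom] keeps [X] total and measurable; Lebesgue measure is restricted
    to [Dom] before it is transported. *)
Let X (y : R) : borel_seqs := fun n => if `[< Dom y >] then next (word y n) y else 0%N.

Let size_word y n : size (word y n) = n.
Proof. by elim: n => //= n IH; rewrite size_rcons IH. Qed.

Let I_word y n : Dom y -> I (word y n.+1) y.
Proof.
move=> Dy; elim: n => [|n IH]; first exact: (@xgetPex _ 0%N [set j | I [:: j] y] Dy).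
have w0 : word y n.+1 != [::] by rewrite -size_eq0 size_word.
exact: (@xgetPex _ 0%N [set j | I (rcons (word y n.+1) j) y] (I_cover w0 IH)).
Qed.

Let mkseq_X y n : Dom y -> mkseq (X y) n = word y n.
Proof.
move=> Dy; elim: n => // n IH; rewrite -addn1 /mkseq iotaD map_cat -/(mkseq _ _) IH addn1 /=.
by rewrite cats1 add0n /X asboolT.
Qed.

Let I_Dom w y : w != [::] -> I w y -> Dom y.
Proof.
elim/last_ind: w => // w j IH _; have [->|w0] := eqVneq w [::]; first by exists j.
by move/(I_sub w0); exact: IH.
Qed.

Let X_cyl w y : w != [::] -> Dom y -> cyl w (X y) <-> I w y.
Proof.
move=> w0 Dy; rewrite /cyl /= mkseq_X//; split=> [e|].
  by rewrite -[X in I X]e; case: (w) w0 => // a s _; exact: I_word.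
move=> h; have {w0 h}: (w != [::] -> I w y) by [].
elim/last_ind: w => // w j IH /(_ _); rewrite -size_eq0 size_rcons /= => /(_ isT) Iy.
rewrite IH; last by move=> w0; exact: I_sub Iy.
congr rcons; apply: I_inj (Iy).
exact: (@xgetPex _ 0%N [set j | I (rcons w j) y] (ex_intro _ j Iy)).
Qed.

Let measurable_I w : measurable (I w : set (measurableTypeR R)).
Proof.
rewrite (_ : I w = `[lo w, (lo w + p w)%R[%classic); first exact: measurable_itv.
by apply/seteqP; split=> y /=; rewrite in_itv.
Qed.

Let measurable_Dom : measurable (Dom : set (measurableTypeR R)).
Proof.
rewrite (_ : Dom = \bigcup_k I [:: k]); first by apply: bigcupT_measurable => k; exact: measurable_I.
by apply/seteqP; split=> y [k]; exists k.
Qed.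

Let measurable_X : measurable_fun setT (X : measurableTypeR R -> borel_seqs).
Proof.
apply: measurable_seq_fun => w w0; rewrite setTI.
have -> : X @^-1` cyl w = I w `|` (~` Dom `&` [set _ | cyl w (fun=> 0%N)]).
  apply/seteqP; split=> y; have [Dy|nDy] := pselect (Dom y).
  - by move/(X_cyl w0 Dy); left.
  - move=> h; right; split => //; move: h; rewrite /preimage /mkset; congr (cyl w).
    by apply/funext => n; rewrite /X asboolF.
  - by case=> [/(X_cyl w0 Dy)|[]].
  - case=> [/(I_Dom w0)//|[_]]; rewrite /preimage /mkset; congr (cyl w).
    by apply/funext => n; rewrite /X asboolF.
apply: measurableU; first exact: measurable_I.
apply: measurableI; first exact: measurableC measurable_Dom.
have [h|h] := pselect (cyl w (fun=> 0%N)).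
  by rewrite (_ : [set _ | _] = setT)//; apply/seteqP; split.
by rewrite (_ : [set _ | _] = set0)//; apply/seteqP; split.
Qed.

Lemma weights_measure : exists m : {measure set borel_seqs -> \bar R},
  forall w, w != [::] -> m (cyl w) = (p w)%:E.
Proof.
exists (measure_function_pushforward__canonical__measure_function_Measure
  (mrestr (@lebesgue_measure R) measurable_Dom) measurable_X).
move=> w w0.
transitivity (@lebesgue_measure R (X @^-1` cyl w `&` Dom)) => //.
have -> : X @^-1` cyl w `&` Dom = `[lo w, (lo w + p w)%R[%classic.
  apply/seteqP; split=> y; rewrite [X in _ -> X]/= [X in X -> _]/= in_itv/=.
    by case=> h Dy; move/(X_cyl w0 Dy): h.
  by move=> h; have Dy : Dom y := I_Dom w0 h; split=> //; exact/X_cyl.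
rewrite lebesgue_measure_itv /= lte_fin; case: ltP => h.
  by rewrite -EFinB; congr EFin; ring.
by congr EFin; apply/eqP; rewrite eq_le p_ge0; lra.
Qed.

End weights_measure.

(** * The transfer operator *)

Section densities.
Context d (T : measurableType d) {R : realType}.
Variable m : {measure set T -> \bar R}.
Variable k : T -> R.
Hypothesis mk : measurable_fun setT k.
Hypothesis k_ge0 : forall x, (0 <= k x)%R.

Let mkE : measurable_fun setT (fun x => (k x)%:E).
Proof. exact/measurable_EFinP. Qed.

Let kE_ge0 x : 0 <= (k x)%:E. Proof. by rewrite lee_fin. Qed.

Lemma density_measure : exists mu : {measure set T -> \bar R},
  forall A, measurable A -> mu A = \int[m]_(x in A) (k x)%:E.
Proof.
have h0 : \int[m]_(x in set0) (k x)%:E = 0 by exact: integral_set0.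
have h1 A : 0 <= \int[m]_(x in A) (k x)%:E by apply: integral_ge0 => x _; exact: kE_ge0.
have h2 : semi_sigma_additive (fun A => \int[m]_(x in A) (k x)%:E).
  exact: semi_sigma_additive_nng_induced.
pose mu : {measure set T -> \bar R} :=
  HB.pack (fun A => \int[m]_(x in A) (k x)%:E) (isMeasure.Build _ _ _ (fun A => \int[m]_(x in A) (k x)%:E) h0 h1 h2).
by exists mu.
Qed.

Variable mu : {measure set T -> \bar R}.
Hypothesis muE : forall A, measurable A -> mu A = \int[m]_(x in A) (k x)%:E.

Import HBNNSimple.

Let density_nnsfun (h : {nnsfun T >-> R}) :
  \int[mu]_x (h x)%:E = \int[m]_x ((k x)%:E * (h x)%:E).
Proof.
have hP r : measurable (h @^-1` [set r]) by exact: measurable_funPTI.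
under [LHS]eq_integral do rewrite fimfunE -fsumEFin//.
rewrite [LHS]ge0_integral_fsum//; last 2 first.
  - by move=> r; exact/measurable_EFinP/measurableT_comp.
  - by move=> n x _; rewrite EFinM nnfun_muleindic_ge0.
under [RHS]eq_integral.
  move=> x xD; rewrite fimfunE -fsumEFin// ge0_mule_fsumr; last first.
    by move=> r; rewrite EFinM nnfun_muleindic_ge0.
  over.
have m1 r : measurable_fun setT (fun x => (r * \1_(h @^-1` [set r]) x)%:E).
  by apply/measurable_EFinP/measurable_funM => //.
rewrite [RHS]ge0_integral_fsum//; last 2 first.
  - by move=> r; apply: emeasurable_funM.
  - by move=> n x _; rewrite mule_ge0// EFinM nnfun_muleindic_ge0.
apply: eq_fsbigr => r /[!inE] -[z _ hz]; rewrite integralZl_indic_nnsfun// integral_indic// setIT.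
rewrite muE//.
under [RHS]eq_integral do rewrite EFinM muleCA.
rewrite ge0_integralZl//; last 3 first.
- by apply: emeasurable_funM => //; exact/measurable_EFinP.
- by move=> x _; rewrite mule_ge0// lee_fin.
- by rewrite lee_fin -hz.
congr (_ * _); rewrite integral_mkcond; apply: eq_integral => x _.
by rewrite patchE indicE; case: ifP => _; rewrite ?mule1 ?mule0.
Qed.

Lemma integral_density (u : T -> \bar R) : measurable_fun setT u -> (forall x, 0 <= u x) ->
  \int[mu]_x u x = \int[m]_x ((k x)%:E * u x).
Proof.
move=> mu_ u0; pose f_ := nnsfun_approx measurableT mu_.
transitivity (limn (fun n => \int[mu]_x (f_ n x)%:E)).
  rewrite -monotone_convergence//=.
  - apply: eq_integral => x /[!inE] xD; apply/esym/cvg_lim => //=.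
    exact: cvg_nnsfun_approx.
  - by move=> n; exact/measurable_EFinP.
  - by move=> n x _; rewrite lee_fin.
  - by move=> x _ a b ab; rewrite lee_fin//; exact/lefP/nd_nnsfun_approx.
transitivity (limn (fun n => \int[m]_x ((k x)%:E * (f_ n x)%:E))).
  by congr (limn _); apply/funext => n; exact: density_nnsfun.
rewrite -monotone_convergence//=.
- apply: eq_integral => x /[!inE] xD; apply/cvg_lim => //.
  apply: cvgeZl => //.
  exact: cvg_nnsfun_approx.
- by move=> n; apply: emeasurable_funM => //; exact/measurable_EFinP.
- by move=> n x _; rewrite mule_ge0// lee_fin.
- move=> x _ a b ab; apply: lee_wpmul2l => //; rewrite lee_fin; exact/lefP/nd_nnsfun_approx.
Qed.

End densities.

Section transfer_operator.
Context {R : realType}.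
Variables (B : rel nat) (f : borel_seqs -> R).

(** The weight of the inverse branch [scons a], extended by zero, so that the transfer operator
    becomes a series of functions that are measurable on the whole space. *)
Definition branch (a : nat) : borel_seqs -> R :=
  (fun x => expR (f (scons a x))) \_ (Sigma B `&` [set x | B a (x 0%N)]).

Lemma branch_ge0 a x : (0 <= branch a x)%R.
Proof. by rewrite /branch patchE; case: ifP => // _; exact: expR_ge0. Qed.

Lemma branchE a x : Sigma B x -> B a (x 0%N) -> branch a x = expR (f (scons a x)).
Proof. by move=> hx ax; rewrite /branch patchE mem_set. Qed.

Lemma branch0 a x : ~ Sigma B (scons a x) -> branch a x = 0%R.
Proof.
move=> h; rewrite /branch patchE memNset// => -[hx ax]; apply: h.
by apply/Sigma_scons.
Qed.

Lemma transferE u x : (forall y, 0 <= u y) ->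
  transfer B f u x = \sum_(a <oo) ((branch a x)%:E * u (scons a x)).
Proof.
move=> u0; rewrite nneseries_esumT; last by move=> a; rewrite mule_ge0// lee_fin branch_ge0.
have -> : \esum_(a in [set: nat]) ((branch a x)%:E * u (scons a x)) =
    \esum_(a in [set a | Sigma B (scons a x)]) ((expR (f (scons a x)))%:E * u (scons a x)).
  rewrite [RHS]esum_mkcond; apply: eq_esum => a _; case: ifPn; rewrite ?inE ?notin_setE /=.
    by move=> /Sigma_scons[ax hx]; rewrite branchE.
  by move=> h; rewrite branch0// mul0e.
rewrite /transfer; apply: (@reindex_esum _ _ _ [set a | Sigma B (scons a x)] _ (fun a => scons a x)).
split.
- by move=> a /= h; split=> //; apply/funext.
- by move=> a b _ _ /(congr1 (fun s => s 0%N)).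
- by move=> y [hy <-]; exists (y 0%N); rewrite /mkset scons_shift.
Qed.

Lemma transfer_ge0 u x : (forall y, 0 <= u y) -> 0 <= transfer B f u x.
Proof. by move=> u0; apply: esum_ge0 => y _; rewrite mule_ge0// lee_fin expR_ge0. Qed.

Hypothesis mf : measurable_fun (Sigma B) f.

Let measurable_fiber a : measurable (Sigma B `&` [set x | B a (x 0%N)]).
Proof.
apply: measurableI; first exact: measurable_Sigma.
exact: (measurable_prefix (fun s => B a (nth 0%N s 0)) 1).
Qed.

Lemma measurable_branch a : measurable_fun setT (branch a).
Proof.
apply/(measurable_restrictT _ (measurable_fiber a)).
apply: measurableT_comp => //; apply: (measurable_comp (F := Sigma B)) => //.
- exact: measurable_Sigma.
- by move=> _ [x [hx ax] <-]; apply/Sigma_scons.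
- by apply: measurable_funTS; exact: measurable_scons.
Qed.

Lemma measurable_transfer u : measurable_fun setT u -> (forall y, 0 <= u y) ->
  measurable_fun setT (transfer B f u).
Proof.
move=> mu u0; rewrite (_ : transfer B f u = fun x => \sum_(a <oo) ((branch a x)%:E * u (scons a x))).
  apply: ge0_emeasurable_sum => [a x _ _|a _]; first by rewrite mule_ge0// lee_fin branch_ge0.
  apply: emeasurable_funM; first (apply/measurable_EFinP; exact: measurable_branch).
  by apply: measurableT_comp => //; exact: measurable_scons.
by apply/funext => x; exact: transferE.
Qed.

Section conformal_weights.
Variables (r : nat -> R) (W : walters B f r).
Variable p : seq nat -> R.
Hypothesis p_ge0 : forall w, (0 <= p w)%R.
Hypothesis p_rcons : forall w, w != [::] -> \sum_(j <oo) (p (rcons w j))%:E = (p w)%:E.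
Hypothesis p_inadmissible : forall w, w != [::] -> (forall y, ~ Sigma B (glue w y)) -> p w = 0%R.
Hypothesis p_cons : forall a k w y, Sigma B (glue (a :: k :: w) y) ->
  (expR (f (glue (a :: k :: w) y) - r (size (k :: w))) * p (k :: w) <= p (a :: k :: w) <=
   expR (f (glue (a :: k :: w) y) + r (size (k :: w))) * p (k :: w))%R.
Variable m : {measure set borel_seqs -> \bar R}.
Hypothesis m_cyl : forall w, w != [::] -> m (cyl w) = (p w)%:E.

(** A sequence outside [Sigma B] has a finite prefix that cannot occur; there are countably many
    such prefixes, each of mass zero. *)
Lemma null_Sigma : m (~` Sigma B) = 0.
Proof.
apply: measure_negligible; first exact: measurableC (measurable_Sigma B).
pose N (w : seq nat) : set borel_seqs :=
  if `[< w != [::] /\ forall y, ~ Sigma B (glue w y) >] then cyl w else set0.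
pose M k := if @unpickle (seq nat) k is Some w then N w else set0.
apply: (@negligibleS _ _ _ _ (\bigcup_k M k)).
  move=> x /existsNP[n hn]; pose w := mkseq x n.+2.
  exists (pickle w) => //; rewrite /M pickleK /N asboolT; first exact: cyl_mkseq.
  split=> // y /(_ n); rewrite !glueE size_mkseq leqnn ltnW//.
  by rewrite !nth_mkseq.
apply: negligible_bigcup => k; rewrite /M; case: unpickle => [w|]; last exact: negligible_set0.
rewrite /N; case: asboolP => [[w0 h]|_]; last exact: negligible_set0.
have e : m (cyl w) = 0 by rewrite m_cyl// p_inadmissible.
by apply/negligibleP; [exact: measurable_cyl|exact: e].
Qed.

Lemma cyl_Sigma w : w != [::] -> m (cyl w `&` Sigma B) = (p w)%:E.
Proof.
move=> w0; rewrite -m_cyl//.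
have e : cyl w = (cyl w `&` Sigma B) `|` (cyl w `&` ~` Sigma B) by rewrite -setIUr setUv setIT.
rewrite [in RHS]e measureU; last 3 first.
- by apply: measurableI; [exact: measurable_cyl|exact: measurable_Sigma].
- by apply: measurableI; [exact: measurable_cyl|exact: measurableC (measurable_Sigma B)].
- by rewrite -subset0 => x [[_ ?] []].
rewrite [X in _ + X](_ : _ = 0) ?adde0//.
apply: (@subset_measure0 _ _ _ _ _ (~` Sigma B)).
- by apply: measurableI; [exact: measurable_cyl|exact: measurableC (measurable_Sigma B)].
- exact: measurableC (measurable_Sigma B).
- exact: subIsetr.
- exact: null_Sigma.
Qed.

(** The mass that the branch [a] sends to the cylinder of [a :: w]. Conformality on cylinders means
    that it equals [p (a :: w)]. *)
Let J a w := \int[m]_(x in cyl w) (branch a x)%:E.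

Let J_ge0 a w : 0 <= J a w.
Proof. by apply: integral_ge0 => x _; rewrite lee_fin branch_ge0. Qed.

Let cyl_rcons w : cyl w = \bigcup_j cyl (rcons w j).
Proof.
apply/seteqP; split=> [x xw|x [j _]].
  exists (x (size w)) => //; rewrite /cyl /mkset size_rcons -addn1 /mkseq iotaD map_cat.
  by rewrite -/(mkseq _ _) xw cats1.
rewrite /cyl /mkset size_rcons -addn1 /mkseq iotaD map_cat cats1 => /eqP.
by rewrite eqseq_rcons => /andP[/eqP].
Qed.

Let cyl_rcons_triv w : trivIset setT (fun j => cyl (rcons w j)).
Proof.
by move=> j l _ _ [x []]; rewrite /cyl /mkset !size_rcons => -> /rcons_inj[].
Qed.

Let J_rcons a w : J a w = \sum_(j <oo) J a (rcons w j).
Proof.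
rewrite /J [in LHS]cyl_rcons ge0_integral_bigcup//.
- by move=> k; exact: measurable_cyl.
- by apply: measurable_funTS; (apply/measurable_EFinP; exact: measurable_branch).
- by move=> x _; rewrite lee_fin branch_ge0.
- exact: cyl_rcons_triv.
Qed.

(** On the admissible part of [cyl w] the density is constant up to the variation of [f], and
    [p_cons] relates the masses up to the same error; hence the factor 2 in the exponent. *)
Let J_bounds0 a w : w != [::] ->
  J a w <= (expR (2 * r (size w)))%:E * (p (a :: w))%:E /\
  (p (a :: w))%:E <= (expR (2 * r (size w)))%:E * J a w.
Proof.
case: w => // k w _; have [[y hy]|/forallNP hN] := pselect (exists y, Sigma B (glue (a :: k :: w) y)); last first.
  rewrite p_inadmissible// mule0 (_ : J _ _ = 0) ?mule0//.
  apply: integral0_eq => x /cylP[y ->]; rewrite branch0//; exact: hN.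
set n := size (k :: w); set z := glue (a :: k :: w) y.
have [/= h1 h2] := andP (p_cons hy); rewrite -/n -/z in h1 h2.
have [_ r0 Wf] := W.
have near x : cyl (k :: w) x -> Sigma B x -> (f z - r n <= f (scons a x) <= f z + r n)%R.
  move=> /cylP[y' ->] hx.
  have hx' : Sigma B (glue [:: a] (glue (k :: w) y')) .
    apply/Sigma_scons; split=> //.
    by have /Sigma_scons[] := hy.
  have := Wf [:: a] (glue (k :: w) y) (glue (k :: w) y') n hy hx'.
  rewrite /= !addr0 => /(_ _)/ler_normlP -[|].
    move=> j jn; have := jn; rewrite /n => jn'.
    by rewrite -![scons _ _]/(glue (k :: w) _) !glueE jn'.
  rewrite /z /=; lra.
have mc : measurable (cyl (k :: w)) by exact: measurable_cyl.
have mb : measurable_fun (cyl (k :: w)) (fun x => (branch a x)%:E).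
  by apply: measurable_funTS; (apply/measurable_EFinP; exact: measurable_branch).
have up : J a (k :: w) <= (expR (f z + r n) * p (k :: w))%:E.
  apply: (@le_trans _ _ (\int[m]_(x in cyl (k :: w)) cst (expR (f z + r n))%:E x)).
    apply: ge0_le_integral => //.
    - by move=> x _; rewrite lee_fin branch_ge0.

    move=> x hx; rewrite lee_fin; have [sx|sx] := pselect (Sigma B (scons a x)).
      have /Sigma_scons[ax hx'] := sx.
      by rewrite branchE// ler_expR; case/andP: (near x hx hx').
    by rewrite branch0// expR_ge0.
  by rewrite integral_cst// m_cyl.
have mcs : measurable (cyl (k :: w) `&` Sigma B).
  by apply: measurableI => //; exact: measurable_Sigma.
have low : (expR (f z - r n) * p (k :: w))%:E <= J a (k :: w).
  apply: (@le_trans _ _ (\int[m]_(x in cyl (k :: w) `&` Sigma B) (branch a x)%:E)); last first.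
    apply: ge0_subset_integral => //.
    by move=> x _; rewrite lee_fin branch_ge0.
  apply: (@le_trans _ _ (\int[m]_(x in cyl (k :: w) `&` Sigma B) cst (expR (f z - r n))%:E x)).
    by rewrite integral_cst// cyl_Sigma.
  apply: ge0_le_integral => //.
  - by move=> x _; rewrite lee_fin expR_ge0.
  - by apply: measurable_funS mb => //; exact: subIsetl.
  move=> x [xw hx]; rewrite lee_fin branchE//.
    by rewrite ler_expR; case/andP: (near x xw hx).
  have /Sigma_scons[ax _] := hy; move: ax => /=.
  by have /cylP[y' ->] := xw.
split.
  apply: le_trans up _; rewrite -EFinM lee_fin.
  apply: (@le_trans _ _ (expR (2 * r n) * (expR (f z - r n) * p (k :: w)))%R).
    by rewrite mulrA -expRD (_ : 2 * r n + (f z - r n) = f z + r n)%R//; ring.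
  by rewrite ler_wpM2l ?expR_ge0.
apply: (@le_trans _ _ ((expR (2 * r n))%:E * (expR (f z - r n) * p (k :: w))%:E)); last first.
  by apply: lee_wpmul2l => //; rewrite lee_fin expR_ge0.
rewrite -EFinM lee_fin mulrA -expRD (_ : 2 * r n + (f z - r n) = f z + r n)%R//; ring.
Qed.

(* Splitting [cyl w] into cylinders of length [size w + d] improves the error. *)
Let J_bounds d a w : w != [::] ->
  J a w <= (expR (2 * r (size w + d)))%:E * (p (a :: w))%:E /\
  (p (a :: w))%:E <= (expR (2 * r (size w + d)))%:E * J a w.
Proof.
elim: d w => [|d IH] w w0; first by rewrite addn0; exact: J_bounds0.
have e (j : nat) : (size w + d.+1 = size (rcons w j) + d)%N by rewrite size_rcons addnS.
have wj (j : nat) : rcons w j != [::] by rewrite -size_eq0 size_rcons.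
have E0 : 0 <= (expR (2 * r (size w + d.+1)))%:E by rewrite lee_fin expR_ge0.
rewrite J_rcons -(p_rcons (w := a :: w))//.
rewrite -!nneseriesZl//; last by move=> j _; rewrite lee_fin.
split; apply: lee_nneseries => [j _|j _].
- by move=> _; exact: J_ge0.
- by have [] := IH _ (wj j); rewrite -e.
- by rewrite lee_fin.
- by have [_] := IH _ (wj j); rewrite -e.
Qed.

Let J_cyl a w : w != [::] -> J a w = (p (a :: w))%:E.
Proof.
move=> w0; have [r0 _ _] := W.
have c1 : (fun n => expR (2 * r n)) @ \oo --> (1 : R)%R.
  rewrite -[X in _ --> X]expR0; apply: continuous_cvg; first exact: continuous_expR.
  by rewrite -[X in _ --> X](mulr0 2%R); apply: cvgM => //; exact: cvg_cst.
have c2 (x : R) : (fun n => (expR (2 * r n))%:E * x%:E) @ \oo --> x%:E.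
  rewrite -[X in _ --> X]mul1e; apply: cvgeZr => //; apply: cvg_EFin c1; exact: nearW.
have Jfin : J a w \is a fin_num.
  rewrite ge0_fin_numE//; have [h _] := J_bounds 0 a w0; apply: le_lt_trans h _.
  by rewrite -EFinM ltry.
apply/eqP; rewrite eq_le; apply/andP; split.
  apply: (cvge_to_ge (c2 (p (a :: w)))); exists (size w) => // n /= hn.
  by have [] := J_bounds (n - size w) a w0; rewrite subnKC.
rewrite -(fineK Jfin); apply: (cvge_to_ge (c2 (fine (J a w)))); exists (size w) => // n /= hn.
by rewrite fineK//; have [_] := J_bounds (n - size w) a w0; rewrite subnKC.
Qed.

Let J_nil a : J a [::] = (p [:: a])%:E.
Proof.
by rewrite J_rcons -(p_rcons (w := [:: a]))//; apply: eq_eseriesr => j _; exact: J_cyl.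
Qed.

(** Both sides split over the letter [a]. On [cyl [:: a]] the measure [m] is the image under
    [scons a] of the measure with density [branch a]: the two agree on cylinders by [J_cyl] and
    [J_nil], hence everywhere by uniqueness. *)
Lemma weights_conformal : conformal B f 1%R m.
Proof.
move=> u mu u0; rewrite mul1e.
have m0 := null_Sigma.
have mS : measurable (Sigma B) := measurable_Sigma B.
have full (v : borel_seqs -> \bar R) : measurable_fun setT v -> (forall x, 0 <= v x) ->
    \int[m]_(x in Sigma B) v x = \int[m]_x v x.
  move=> mv v0; rewrite [RHS](@ge0_negligible_integral _ _ _ _ setT (~` Sigma B))//.
    by rewrite setTD setCK.
  exact: measurableC.
rewrite !full//; last 2 first.
- exact: measurable_transfer.
- by move=> x; exact: transfer_ge0.
under eq_integral do rewrite transferE//.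
rewrite integral_nneseries//; last 2 first.
- move=> a; apply: emeasurable_funM; first (apply/measurable_EFinP; exact: measurable_branch).
  by apply: measurableT_comp => //; exact: measurable_scons.
- by move=> a x _; rewrite mule_ge0// lee_fin branch_ge0.
have cov : \bigcup_a cyl [:: a] = setT.
  by apply/seteqP; split=> // x _; exists (x 0%N) => //; exact/cyl1.
rewrite -[in RHS]cov ge0_integral_bigcup//; last 3 first.
- by move=> k; exact: measurable_cyl.
- exact: measurable_funTS.
- by move=> j l _ _ [x [/cyl1 <- /cyl1 <-]].
apply: eq_eseriesr => a _.
have [ma hma] := density_measure m (measurable_branch a) (branch_ge0 a).
have msa := measurable_scons a.
pose na : {measure set borel_seqs -> \bar R} := 
  measure_function_pushforward__canonical__measure_function_Measure ma msa.
have ua_m : measurable_fun (cyl [:: a]) u by exact: measurable_funTS.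
have -> : \int[m]_(x in cyl [:: a]) u x = \int[na]_(x in cyl [:: a]) u x.
  apply: eq_measure_integral => A mA Aa.
  pose ra : {measure set borel_seqs -> \bar R} := mrestr m (measurable_cyl [:: a]).
  have -> : m A = ra A by rewrite /ra /= /mrestr setIidl.
  apply: seq_measure_unique mA.
    case=> // b w _; rewrite /ra /na /= /mrestr /pushforward hma; last first.
      by rewrite -[_ @^-1` _]setTI; apply: (msa) => //; exact: measurable_cyl.
    have [<-|ab] := eqVneq a b.
      rewrite setIidl; last first.
        by move=> x /cylP[y ->]; apply/cyl1.
      rewrite m_cyl// (_ : _ @^-1` _ = cyl w).
        by case: (w) => [|k v]; [rewrite -J_nil|rewrite -J_cyl].
      apply/seteqP; split=> x /cylP[y].
        by move=> /(congr1 left_shift) e; apply/cylP; exists y.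
      by move=> ->; apply/(cylP (a :: w)); exists y.
    rewrite (_ : _ `&` _ = set0) ?measure0; last first.
      by rewrite -subset0 => x [/cylP[y ->] /cyl1 e]; move: ab; rewrite -e /= eqxx.
    rewrite (_ : _ @^-1` _ = set0) ?integral_set0//.
    by rewrite -subset0 => x /cylP[y] /(congr1 (fun s => s 0%N)) e; move: ab; rewrite -[a]/(scons a x 0%N) e /= eqxx.
  move=> k; apply: (@le_lt_trans _ _ (m (cyl [:: k]))); last by rewrite m_cyl// ltry.
  by apply: measureIl; exact: measurable_cyl.
rewrite [RHS]integral_mkcond.
have mu' : measurable_fun setT (u \_ (cyl [:: a])).
  by apply/(measurable_restrictT _ (measurable_cyl [:: a])).
have u'0 x : 0 <= (u \_ (cyl [:: a])) x by rewrite patchE; case: ifP.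
have -> : \int[na]_x (u \_ (cyl [:: a])) x = \int[ma]_x ((u \_ (cyl [:: a])) \o scons a) x.
  by apply: (ge0_integral_pushforward msa) => // x _; exact: u'0.
rewrite (integral_density (measurable_branch a) (branch_ge0 a) hma)//; last 2 first.
- exact: measurableT_comp.
- by move=> x; exact: u'0.
apply: eq_integral => x _ /=; rewrite patchE mem_set//; exact/cyl1.
Qed.

End conformal_weights.
End transfer_operator.

(** * Conservativity of the conformal measure *)

Section conservativity.
Context {R : realType}.
Variable B : rel nat.
Hypothesis hmix : topologically_mixing B.
Variables (f : borel_seqs -> R) (r : nat -> R) (W : walters B f r).
Hypothesis mf : measurable_fun (Sigma B) f.
Variable i : nat.
Hypothesis hdiv : \esum_(w in loops B i) loop_weight f w = +oo.

Let L := transfer B f.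

(** A walk from [i] to the first letter of [x] links [x] to a point of [cylinder B i], where the
    prefix sum is comparable to the divergent sum over loops. *)
Lemma prefix_sum_infty x : Sigma B x -> prefix_sum B f [:: i] x = +oo.
Proof.
move=> hx; have [a wa] := mixing_walk i (x 0%N) hmix.
have ha := walk_glue wa (conj hx erefl).
have h : prefix_sum B f [:: i] (glue a x) = +oo.
  have : +oo <= (expR (r 0))%:E * prefix_sum B f [:: i] (glue a x).
    rewrite -hdiv /prefix_sum (extensions_loops ha) -esumZl; [|by rewrite lee_fin expR_ge0|by move=> *; exact: word_weight_ge0].
    apply: le_esum => v lv; rewrite /loop_weight /word_weight -EFinM lee_fin -expRD ler_expR.
    by have /andP[_] := word_weight_loop_weight ha W lv; lra.
  by have := prefix_sum_ge0 B f [:: i] (glue a x); case: (prefix_sum B f _ _).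
have := prefix_sum_glue B f [:: i] a x; rewrite h gt0_muley ?lte_fin ?expR_gt0// leye_eq.
by move/eqP.
Qed.

Let iterL_ge0 n u : (forall y, 0 <= u y) -> forall x, 0 <= iter n L u x.
Proof. by move=> u0; elim: n => //= n IH x; exact: transfer_ge0. Qed.

Let measurable_iterL n u : measurable_fun setT u -> (forall y, 0 <= u y) ->
  measurable_fun setT (iter n L u).
Proof.
by move=> mu u0; elim: n => //= n IH; apply: measurable_transfer => //; exact: iterL_ge0.
Qed.

Let iterL_ge n u x : (forall y, 0 <= u y) ->
  \esum_(w in [set w | Sigma B (glue w x) /\ size w = n]) (word_weight f w x * u (glue w x)) <= iter n L u x.
Proof.
elim: n u => [|n IH] u u0.
  apply: (@le_trans _ _ (\esum_(w in [set [::]]) (word_weight f w x * u (glue w x)))).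
    by apply: sub_esum => w [_ /size0nil].
  by rewrite esum_set1 ?mule_ge0 ?lee_fin ?expR_ge0// /word_weight /= expR0 mul1e.
rewrite iterSr; apply: le_trans (IH (L u) _); last by move=> y; exact: transfer_ge0.
pose c (w : seq nat) (a : nat) := word_weight f (a :: w) x * u (glue (a :: w) x).
have c0 w a : 0 <= c w a by rewrite mule_ge0// lee_fin expR_ge0.
have -> : \esum_(w in [set w | Sigma B (glue w x) /\ size w = n]) (word_weight f w x * L u (glue w x)) =
   \esum_(w in [set w | Sigma B (glue w x) /\ size w = n])
     \esum_(a in [set a | Sigma B (glue (a :: w) x)]) c w a.
  apply: eq_esum => w [hw _]; rewrite /L transferE// nneseries_esumT; last first.
    by move=> a; rewrite mule_ge0// lee_fin branch_ge0.
  rewrite -esumZl ?lee_fin ?expR_ge0//; last first.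
    by move=> a _; rewrite mule_ge0// lee_fin branch_ge0.
  rewrite [RHS]esum_mkcond; apply: eq_esum => a _; case: ifPn; rewrite ?inE ?notin_setE /=.
    move=> /Sigma_scons[ha _]; rewrite branchE// /c /word_weight /= muleA -EFinM -expRD.
    by rewrite [(_ + wsum _ _ _)%R]addrC.
  by move=> ha; rewrite branch0// mul0e mule0.
rewrite esum_esum; last by [].
rewrite -(esum_image _ (fun p : seq nat * nat => p.2 :: p.1)
  (fun w => word_weight f w x * u (glue w x))); last by move=> [w a] [w' a'] _ _ [-> ->].
apply: sub_esum => -[|a w] [hw]//= [sw]; exists (w, a) => //; split=> //=.
by split=> //; have /Sigma_scons[] := hw.
Qed.

Let C : set borel_seqs := cylinder B i.
Let one_C x : \bar R := (\1_C x)%:E.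

Lemma transfer_series_infty x : Sigma B x -> \sum_(n <oo) iter n L one_C x = +oo.
Proof.
move=> hx; apply/eqP; rewrite -leye_eq -[leLHS](prefix_sum_infty hx) /prefix_sum.
have -> : extensions B [:: i] x = \bigcup_n (extensions B [:: i] x `&` [set v | size v = n]).
  by apply/seteqP; split=> [v hv|v [n _ []]//]; exists (size v).
rewrite nneseries_sum_bigcup; first last.
- by move=> *; exact: word_weight_ge0.
- by apply/trivIsetP => a b _ _ ab; rewrite -subset0 => w [[_ sa] [_ sb]];
    move: ab; rewrite -sa -sb eqxx.
apply: lee_nneseries => [n _|n _]; first by move=> _; apply: esum_ge0 => v _; exact: word_weight_ge0.
apply: le_trans (@iterL_ge n one_C x _); last by move=> y; rewrite lee_fin.
apply: (@le_trans _ _ (\esum_(v in extensions B [:: i] x `&` [set v | size v = n])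
   (word_weight f v x * one_C (glue v x)))); last first.
  by apply: sub_esum => v [[hv _] sv].
apply: le_esum => v [[hv iv] _]; rewrite /one_C indicE mem_set ?mule1//.
by split=> //; case: (v) iv => //= a w /andP[/eqP].
Qed.

Variable m : {measure set borel_seqs -> \bar R}.
Hypothesis m_conf : conformal B f 1%R m.
Hypothesis m_fin : m C < +oo.

Let mS : measurable (Sigma B) := measurable_Sigma B.

(** Conformality is applied to the product of [w \o left_shift] and [u]: the first factor equals
    [w x] at all preimages of [x], so it comes out of the transfer operator. *)
Let dual w u : measurable_fun setT w -> (forall x, 0 <= w x) ->
  measurable_fun setT u -> (forall x, 0 <= u x) ->
  \int[m]_(x in Sigma B) (w x * L u x) = \int[m]_(x in Sigma B) (w (left_shift x) * u x).
Proof.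
move=> mw w0 mu u0; rewrite -[RHS]mul1e -m_conf; last 2 first.
- apply: emeasurable_funM => //; apply: measurableT_comp => //; exact: measurable_left_shift.
- by move=> x; rewrite mule_ge0.
apply: eq_integral => x _; rewrite /L /transfer -esumZl//; last first.
  by move=> y _; rewrite mule_ge0// lee_fin expR_ge0.
by apply: eq_esum => y [_ <-]; rewrite muleCA.
Qed.

Let dual_iter n w u : measurable_fun setT w -> (forall x, 0 <= w x) ->
  measurable_fun setT u -> (forall x, 0 <= u x) ->
  \int[m]_(x in Sigma B) (w x * iter n L u x) =
  \int[m]_(x in Sigma B) (w (iter n left_shift x) * u x).
Proof.
move=> mw w0 mu u0; elim: n w mw w0 => // n IH w mw w0.
rewrite iterS dual//; last 2 first.
- exact: measurable_iterL.
- exact: iterL_ge0.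
rewrite (IH (w \o left_shift))//; last first.
  by move=> x; exact: w0.
by apply: measurableT_comp => //; exact: measurable_left_shift.
Qed.

(* By duality, the sum over [n] of the integrals of [L^n 1_C] over a wandering
   set is at most [m C], although the [L^n 1_C] sum up to [+oo] everywhere. *)
Lemma conformal_conservative : conservative (Sigma B) left_shift m.
Proof.
move=> A mA [AS tA].
have mC : measurable C by exact: measurable_cylinder.
have mshift n : measurable_fun setT (iter n left_shift).
  elim: n => [|n IH]; first exact: measurable_id.
  by apply: measurableT_comp => //; exact: measurable_left_shift.
pose one_A x : \bar R := (\1_A x)%:E.
have m1A : measurable_fun setT one_A by apply/measurable_EFinP; exact: measurable_indic.
have m1C : measurable_fun setT one_C by apply/measurable_EFinP; exact: measurable_indic.
have p1A x : 0 <= one_A x by rewrite lee_fin.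
have p1C x : 0 <= one_C x by rewrite lee_fin.
have mpre n : measurable (Sigma B `&` iter n left_shift @^-1` A).
  by apply: measurableI => //; rewrite -[_ @^-1` _]setTI; exact: mshift.
have E n : \int[m]_(x in Sigma B) (one_A x * iter n L one_C x) =
    m (C `&` (Sigma B `&` iter n left_shift @^-1` A)).
  set D := C `&` _; have mD : measurable D by exact: measurableI.
  have DS : D `<=` Sigma B by move=> x [_ []].
  rewrite dual_iter// -[in RHS](setIidl DS) -integral_indic//.
  apply: eq_integral => x /[!inE] hx; rewrite /one_A /one_C -EFinM !indicE /D !in_setI (mem_set hx).
  rewrite (_ : (x \in iter n left_shift @^-1` A) = (iter n left_shift x \in A)).
    by rewrite -natrM mulnb andbC.
  by apply/idP/idP; rewrite !inE.
have total : \sum_(n <oo) \int[m]_(x in Sigma B) (one_A x * iter n L one_C x) <= m C.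
  rewrite (eq_eseriesr (fun n _ => E n)).
  rewrite -measure_semi_bigcup; last 3 first.
  - by move=> n; exact: measurableI.
  - exact: trivIset_setIl.
  - by apply: bigcupT_measurable => n; exact: measurableI.
  apply: le_measure; rewrite ?inE//; last by move=> x [n _ []].
  by apply: bigcupT_measurable => n; exact: measurableI.
move: total; rewrite -integral_nneseries//; last 2 first.
- by move=> n; apply: measurable_funTS; apply: emeasurable_funM => //; exact: measurable_iterL.
- by move=> n x _; rewrite mule_ge0// iterL_ge0.
have -> : \int[m]_(x in Sigma B) \sum_(n <oo) (one_A x * iter n L one_C x) =
    \int[m]_(x in Sigma B) (+oo * one_A x).
  apply: eq_integral => x /[!inE] hx; rewrite nneseriesZl ?transfer_series_infty// 1?muleC//.
  by move=> n _; exact: iterL_ge0.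
rewrite ge0_integralZl//; last exact: measurable_funTS.
rewrite integral_indic// setIidl// => h; apply/eqP; rewrite eq_le measure_ge0 andbT leNgt.
by apply/negP => A0; move: h; rewrite gt0_mulye// leye_eq => /eqP h; move: m_fin; rewrite h.
Qed.

End conservativity.

(** * Conservativity of the semi-flow *)

Section flow_conservativity.
Context {R : realType}.
Variables (B : rel nat) (tau : borel_seqs -> R).
Hypotheses (tau_gt0 : forall x, Sigma B x -> (0 < tau x)%R)
  (tau_div : forall x, Sigma B x ->
    \sum_(0 <= i <oo) (tau (iter i left_shift x))%:E = +oo).
Notation leb := (@lebesgue_measure R).
Notation phase := (borel_seqs * measurableTypeR R)%type.

Lemma measurable_iter_shift n : measurable_fun setT (iter n left_shift).
Proof.
elim: n => [|n IH]; first exact: measurable_id.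
by apply: measurableT_comp => //; exact: measurable_left_shift.
Qed.

Lemma measurable_suspension : measurable_fun (Sigma B) tau ->
  measurable (suspension B tau).
Proof.
move=> mtau; pose tau' := tau \_ (Sigma B).
have mtau' : measurable_fun setT tau'.
  by apply/(measurable_restrictT _ (measurable_Sigma B)).
have m1 : measurable_fun setT (fun p : phase => (tau' p.1 - p.2)%R).
  apply: measurable_funB; last exact: measurable_snd.
  by apply: measurableT_comp => //; exact: measurable_fst.
rewrite (_ : suspension B tau =
    (snd @^-1` `[0%R, +oo[%classic) `&` ((fun p : phase => tau' p.1 - p.2)%R @^-1` `]0%R, +oo[%classic)).
  apply: measurableI.
    by rewrite -[_ @^-1` _]setTI; apply: measurable_snd => //; exact: measurable_itv.
  by rewrite -[_ @^-1` _]setTI; apply: m1 => //; exact: measurable_itv.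
apply/seteqP; split=> -[x s]; rewrite /suspension /preimage /mkset /= !in_itv /= !andbT subr_gt0 /tau' patchE.
  by move=> [hx /andP[-> h]]; rewrite mem_set.
case: ifPn => [/set_mem hx [-> ->]//|_ [s0 s1]].
by have := lt_le_trans s1 s0; rewrite ltxx.
Qed.

Section wandering_set.
Variables (t : R) (W : set phase).
Hypotheses (t_gt0 : (0 < t)%R) (mW : measurable W)
  (wW : wandering (suspension B tau) (flow tau t) W).

Let w x : \bar R := leb (xsection W x).

(* The orbit of [x] cannot be in [W] at two times that differ by a multiple of
   [t], so modulo [t] the times spent in [W] do not overlap. *)
Lemma visit_time_le x : Sigma B x -> \sum_(k <oo) w (iter k left_shift x) <= t%:E.
Proof.
move=> hx; have [WY tW] := wW.
pose S k := birkhoff tau k x.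
have mws k : measurable (xsection W (iter k left_shift x) : set (measurableTypeR R)).
  exact: measurable_xsection.
pose P k : set (measurableTypeR R) := shiftr (S k) @^-1` xsection W (iter k left_shift x).
have mP k : measurable (P k).
  by rewrite -[P k]setTI; apply: measurable_shiftr.
have Pk k s : P k s -> (S k <= s < S k.+1)%R /\ W (flow tau s (x, 0%R)).
  rewrite /P /preimage /mkset /shiftr => /xsectionP Ws; have [_ /= h] := WY _ Ws.
  have hs : (S k <= s < S k.+1)%R by rewrite /S birkhoffSr -/(S k); move: h; lra.
  by split=> //; rewrite (flow_block tau_gt0 hx hs).
have tP : trivIset setT P.
  move=> j k _ _ [s [/Pk[hj _] /Pk[hk _]]].
  by rewrite -(hits_unique tau_gt0 hx hj) -(hits_unique tau_gt0 hx hk).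
have -> : \sum_(k <oo) w (iter k left_shift x) = leb (\bigcup_k P k).
  rewrite measure_semi_bigcup//; last exact: bigcupT_measurable.
  by apply: eq_eseriesr => k _; rewrite /w -(lebesgue_shift (S k)).
set Q := \bigcup_k P k.
have mQ : measurable Q by exact: bigcupT_measurable.
have QW s : Q s -> (0 <= s)%R /\ W (flow tau s (x, 0%R)).
  move=> [k _ /Pk[/andP[h _] h']]; split=> //; apply: le_trans h.
  by rewrite -(birkhoff0 tau x); apply: (birkhoff_nd tau_gt0).
pose I n : set (measurableTypeR R) := [set s | (n%:R * t <= s < n.+1%:R * t)%R].
have IE n : I n = `[(n%:R * t)%R, (n.+1%:R * t)%R[%classic.
  by apply/seteqP; split=> s /=; rewrite in_itv.
have mI n : measurable (I n) by rewrite IE; exact: measurable_itv.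
have QI : Q = \bigcup_n (Q `&` I n).
  apply/seteqP; split=> [s Qs|s [n _ []]//].
  have [s0 _] := QW s Qs.
  exists (Num.truncn (s / t)) => //; split=> //.
  have := truncn_itv (divr_ge0 s0 (ltW t_gt0)).
  by rewrite /I /= ler_pdivlMr// ltr_pdivrMr.
have tI : trivIset setT I.
  have lt a b : (a < b)%N -> I a `&` I b = set0.
    move=> ab; rewrite -subset0 => s [/andP[_ h1] /andP[h2 _]].
    have : (a.+1%:R * t <= b%:R * t)%R by rewrite ler_wpM2r ?ler_nat// ltW.
    by lra.
  apply/trivIsetP => a b _ _; rewrite neq_ltn => /orP[/lt//|/lt].
  by rewrite setIC.
pose T n : set (measurableTypeR R) := shiftr (- (n%:R * t))%R @^-1` (Q `&` I n).
have mT n : measurable (T n).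
  by rewrite -[T n]setTI; apply: measurable_shiftr => //; exact: measurableI.
have tT : trivIset setT T.
  move=> a b _ _ [s []]; rewrite /T /preimage /mkset /shiftr !opprK => -[Qa /andP[ha ha']] [Qb _].
  have [_ Wa] := QW _ Qa; have [_ Wb] := QW _ Qb.
  have s0 : (0 <= s)%R by lra.
  apply: tW => //; exists (flow tau s (x, 0%R)); split; (split; first exact: flow_suspension).
    by rewrite /preimage /mkset (flow_iter tau_gt0 tau_div)// ltW.
  by rewrite /preimage /mkset (flow_iter tau_gt0 tau_div)// ltW.
rewrite QI measure_semi_bigcup//; last 3 first.
- by move=> n; exact: measurableI.
- exact: trivIset_setIl.
- by apply: bigcupT_measurable => n; exact: measurableI.
rewrite (eq_eseriesr (g := fun n => leb (T n))); last first.
  by move=> n _; apply/esym/lebesgue_shift; exact: measurableI.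
rewrite -measure_semi_bigcup//; last exact: bigcupT_measurable.
have -> : t%:E = leb `[0%R, t[ by rewrite lebesgue_measure_itv /= lte_fin t_gt0 sube0.
apply: le_measure; rewrite ?inE.
- exact: bigcupT_measurable.
- exact: measurable_itv.
move=> s [n _]; rewrite /T /preimage /mkset /shiftr opprK => -[_ /andP[h1 h2]] /=.
by rewrite in_itv /=; move: h2; rewrite -natr1; lra.
Qed.

Variable mu : {measure set borel_seqs -> \bar R}.
Hypothesis mu_cons : conservative (Sigma B) left_shift mu.

Let mw : measurable_fun setT w.
Proof. exact: measurable_fun_xsection. Qed.

Let w_out x : ~ Sigma B x -> w x = 0.
Proof.
move=> hx; rewrite /w (_ : xsection W x = set0) ?measure0//.
rewrite -subset0 => s /xsectionP /(wW.1 _)[/= h _]; exact: hx.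
Qed.

(* Orbits visit [[set x | e < w x]] finitely often, and the points of this set
   that do not return to it form a wandering set. *)
Let null_above (e : R) : (0 < e)%R -> mu [set x | e%:E < w x] = 0.
Proof.
move=> e0; set A := [set x | _].
have mA : measurable A.
  by rewrite -[A]setTI; exact: emeasurable_fun_o_infty.
have AS : A `<=` Sigma B.
  move=> x Ax; apply: contrapT => hx; move: Ax; rewrite /A /= w_out// lte_fin; lra.
have mpre n V : measurable V -> measurable (iter n left_shift @^-1` V).
  by move=> mV; rewrite -[_ @^-1` _]setTI; exact: measurable_iter_shift.
pose Alast := A `\` \bigcup_k (iter k.+1 left_shift @^-1` A).
have mAlast : measurable Alast.
  by apply: measurableD => //; apply: bigcupT_measurable => k; exact: mpre.
pose V n := Sigma B `&` iter n left_shift @^-1` Alast.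
have mV n : measurable (V n).
  by apply: measurableI; [exact: measurable_Sigma|exact: mpre].
have tAlast : trivIset setT (fun n => iter n left_shift @^-1` Alast).
  have lt a b : (a < b)%N ->
      iter a left_shift @^-1` Alast `&` iter b left_shift @^-1` Alast = set0.
    move=> ab; rewrite -subset0 => x [[_ h1] [h2 _]]; apply: h1.
    exists (b - a).-1 => //; rewrite /preimage /mkset -iterD.
    by rewrite prednK ?subn_gt0// subnK// ltnW.
  apply/trivIsetP => a b _ _; rewrite neq_ltn => /orP[/lt//|/lt].
  by rewrite setIC.
have muV n : mu (V n) = 0.
  apply: mu_cons => //; split; first exact: subIsetl.
  move=> j k _ _ [x [[_ [_ h1]] [_ [_ h2]]]].
  have {}h1 : (iter (n + j) left_shift @^-1` Alast) x by rewrite /preimage /mkset iterD.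
  have {}h2 : (iter (n + k) left_shift @^-1` Alast) x by rewrite /preimage /mkset iterD.
  by have /addnI := tAlast _ _ I I (ex_intro _ x (conj h1 h2)).
apply: measure_negligible => //; apply: (@negligibleS _ _ _ _ (\bigcup_n V n)); last first.
  by apply: negligible_bigcup => n; apply/negligibleP; [exact: mV|exact: muV].
move=> x Ax; have hx := AS _ Ax.
have fin : \sum_(k <oo) w (iter k left_shift x) < +oo.
  by apply: le_lt_trans (visit_time_le hx) _; rewrite ltry.
have w0 k : 0 <= w (iter k left_shift x) by exact: measure_ge0.
have e0' : 0 < e%:E by rewrite lte_fin.
have [N _ hN] := cvge_lt (nneseries_tail_cvg fin (fun k _ => w0 k)) e0'.
have out k : A (iter k left_shift x) -> (k <= N)%N.
  move=> Ak; rewrite leqNgt; apply/negP => Nk; have := hN N (leqnn N); apply/negP; rewrite -leNgt.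
  apply: le_trans (ltW Ak) _.
  apply: (@le_trans _ _ (\sum_(N <= j < k.+1) w (iter j left_shift x))); last exact: nneseries_lim_ge.
  by rewrite big_nat_recr ?leeDr ?sume_ge0//= ltnW.
pose P k := `[< A (iter k left_shift x) >].
have exP : exists k, P k by exists 0%N; exact/asboolP.
have bP k : P k -> (k <= N)%N by move=> /asboolP /out.
case: (ex_maxnP exP bP) => n /asboolP An nmax.
exists n => //; split=> //; split=> // -[k _] h.
have /nmax : P (k.+1 + n)%N by apply/asboolP; rewrite iterD.
by rewrite addSn ltnNge leq_addl.
Qed.

(** The product measure integrates the fiber masses [w], and the set where [w] is positive is the
    union over [n] of the null sets where [w] exceeds [1 / (n + 1)]. *)
Lemma wandering_null : (mu \x leb) W = 0.
Proof.
rewrite /product_measure1 /=.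
have -> : \int[mu]_x (leb \o xsection W) x = \int[mu]_x `|w x|.
  by apply: eq_integral => x _; rewrite gee0_abs.
apply/ae_eq_integral_abs => //; rewrite /ae_eq.
pose A (n : nat) := [set x | (n.+1%:R^-1)%:E < w x].
apply: (@negligibleS _ _ _ _ (\bigcup_n A n)); last first.
  apply: negligible_bigcup => n; apply/negligibleP; last by apply: null_above; rewrite invr_gt0.
  by rewrite -[A n]setTI; exact: emeasurable_fun_o_infty.
move=> x /= hx; have wx : w x != 0 by apply/eqP => e; apply: hx.
have wx0 : 0 < w x by rewrite lt0e wx measure_ge0.
have [r [r0 rw]] : exists r : R, (0 < r)%R /\ r%:E <= w x.
  by case: (w x) wx0 => [r|_|]//; [exists r|exists 1%R; rewrite leey].
exists (Num.truncn r^-1) => //; apply: lt_le_trans rw.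
by rewrite lte_fin invf_plt ?posrE// truncnS_gt.
Qed.

End wandering_set.

(** Conservativity concerns null sets only, so a scaling factor [c] covers both the normalized and
    the infinite case of [lift_measure]. *)
Lemma lift_conservative (mu : {measure set borel_seqs -> \bar R}) :
  measurable_fun (Sigma B) tau -> conservative (Sigma B) left_shift mu ->
  exists nu : {measure set phase -> \bar R}, conservative_flow B tau nu /\
    forall A, measurable A -> nu A = lift_measure B tau mu A.
Proof.
move=> mtau mu_cons; have mY := measurable_suspension mtau.
pose c : R := if \int[mu]_(x in Sigma B) (tau x)%:E < +oo
  then (fine ((mu \x leb) (suspension B tau)))^-1%R else 1%R.
have c0 : (0 <= c)%R.
  by rewrite /c; case: ifP => // _; rewrite invr_ge0 fine_ge0.
pose nu : {measure set phase -> \bar R} := mscale (NngNum c0) (mrestr (mu \x leb) mY).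
have nuE A : nu A = (mu \x leb) (A `&` suspension B tau) * c%:E by rewrite muleC.
exists nu; split=> [t t0 W mW wW|A mA]; last first.
  by rewrite nuE /lift_measure /c; case: ifP => // _; rewrite mule1.
rewrite nuE setIidl; last exact: wW.1.
by rewrite (wandering_null t0 mW wW mu_cons) mul0e.
Qed.

End flow_conservativity.

(** * Recurrence and the RPF measure *)

Section RPF_measure.
Context {R : realType}.
Variable B : rel nat.

Lemma walters_regular (f : borel_seqs -> R) r : walters B f r ->
  forall x (e : R), Sigma B x -> (0 < e)%R -> exists n, forall y, Sigma B y ->
    (forall j, (j < n)%N -> x j = y j) -> (`|f x - f y| < e)%R.
Proof.
move=> W x e hx e0; have [r0 _ _] := W.
have /cvgrPdist_lt/(_ e e0)[N _ hN] := r0.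
exists N.+1 => y hy xy; apply: le_lt_trans (walters_prefix W hx hy xy) _.
by have := hN N (leqnn N); rewrite /= sub0r normrN; apply: le_lt_trans; exact: ler_norm.
Qed.

(** For points that agree in [n] coordinates, the ratio bound in both directions yields
    [1 <= expR (r n)] and bounds the difference by [(expR (r n) - 1) * (expR (r n) * h x)], which
    tends to zero for fixed [x]. *)
Lemma ratio_regular (r : nat -> R) (h : borel_seqs -> R) : r @ \oo --> (0 : R)%R ->
  (forall x, Sigma B x -> (0 < h x)%R) ->
  (forall x y L, Sigma B x -> Sigma B y -> (0 < L)%N ->
    (forall j, (j < L)%N -> x j = y j) -> (h x <= expR (r L) * h y)%R) ->
  forall x (e : R), Sigma B x -> (0 < e)%R -> exists n, forall y, Sigma B y ->
    (forall j, (j < n)%N -> x j = y j) -> (`|h x - h y| < e)%R.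
Proof.
move=> r0 h0 hr x e hx e0.
have c1 : (fun n => expR (r n)) @ \oo --> (1 : R)%R.
  by rewrite -[X in _ --> X]expR0; exact: cvg_comp _ _ r0 (@continuous_expR R _).
have c2 : (fun n => (expR (r n) - 1) * (expR (r n) * h x))%R @ \oo --> (0 : R)%R.
  rewrite -[X in _ --> X](mul0r (1 * h x)%R) -[X in (X * _)%R](subrr 1%R).
  by apply: cvgM; [apply: cvgB => //; exact: cvg_cst|apply: cvgM => //; exact: cvg_cst].
have /cvgrPdist_lt/(_ e e0)[N _ hN] := c2.
exists N.+1 => y hy xy.
have h1 := hr x y N.+1 hx hy isT xy.
have h2 := hr y x N.+1 hy hx isT (fun j jn => esym (xy j jn)).
have := hN N.+1 (leqnSn N); rewrite /= sub0r normrN => /(le_lt_trans (ler_norm _)) h3.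
have hx0 := h0 x hx; have hy0 := h0 y hy.
have E1 : (1 <= expR (r N.+1))%R.
  have := le_trans h1 (ler_wpM2l (expR_ge0 (r N.+1)) h2).
  rewrite mulrA -[X in (X <= _)%R]mul1r ler_pM2r// => E2.
  have := expR_gt0 (r N.+1); nra.
set E := expR (r N.+1) in E1 h1 h2 h3.
rewrite ltr_norml; apply/andP; split; nra.
Qed.

Lemma regular_continuous (h : borel_seqs -> R) :
  (forall x (e : R), Sigma B x -> (0 < e)%R -> exists n, forall y, Sigma B y ->
    (forall j, (j < n)%N -> x j = y j) -> (`|h x - h y| < e)%R) ->
  {within (Sigma B : set nat_seqs), continuous (h : nat_seqs -> R)}.
Proof.
move=> reg; apply/subspace_continuousP => x hx; apply/cvgrPdist_lt => e e0.
have [n hn] := reg x e hx e0.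
rewrite near_withinE.
have : nbhs (x : nat_seqs) (cyl (mkseq x n) : set nat_seqs).
  by apply: open_nbhs_nbhs; split; [exact: cyl_open|exact: cyl_mkseq].
by apply: filterS => y /cyl_agree xy hy; exact: hn.
Qed.

Hypothesis hmix : topologically_mixing B.
Variables (f : borel_seqs -> R) (r : nat -> R) (W : walters B f r).
Hypothesis P0 : gurevich_pressure B f = 0.
Variable i : nat.
Hypothesis hdiv : \esum_(w in loops B i) loop_weight f w = +oo.

Lemma RPF_measure_exists : exists mu : {measure set borel_seqs -> \bar R},
  is_RPF_measure B f mu /\ conservative (Sigma B) left_shift mu.
Proof.
have mf : measurable_fun (Sigma B) f by exact: measurable_regular (walters_regular W).
have [r0 _ _] := W.
have [K hK] : exists K : R, forall n, (0 < n)%N -> Zbase B f n i <= K%:E.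
  have [l [C hC]] := Zbase_transfer hmix W 0 i.
  exists (expR (C + 2 * r 0)) => n n0; rewrite expRD EFinM -lee_pdivrMl ?expR_gt0// -expRN.
  apply: (le_trans (hC n n0)); apply: (gurevich_le0 hmix W); first by rewrite P0.
  by rewrite addn_gt0 n0.
(* The eigenfunction needs limits at uncountably many points, beyond the reach of a diagonal
   subsequence; one ultrafilter serves for all of them. *)
have [U [UU Uoo]] := ultraFilterLemma (@eventually_filter).
have [u lu] := loop_exists hmix i.
have hx0 := cylinder_per lu.
have [p [p_ge0 p_gt0 p_rcons p_inadm p_cons]] := weights_exist hmix W hK hdiv UU Uoo hx0.
have [h [h_gt0 h_ratio h_sum]] := eigenfunction_exists hmix W hK hdiv UU Uoo hx0.
have [m m_cyl] := weights_measure p_ge0 p_rcons.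
have m0 := null_Sigma p_inadm m_cyl.
have conf := weights_conformal mf W p_ge0 p_rcons p_inadm p_cons m_cyl.
have cylE j : m (cylinder B j) = (p [:: j])%:E.
  rewrite -(cyl_Sigma p_inadm m_cyl (w := [:: j]))//; congr (m _).
  by apply/seteqP; split=> x; [move=> [hx xj]; split=> //; exact/cyl1|move=> [/cyl1 xj hx]].
have m_cons : conservative (Sigma B) left_shift m.
  by apply: (conformal_conservative hmix W mf hdiv conf); rewrite cylE ltry.
have h_reg := ratio_regular r0 h_gt0 h_ratio.
have mh := measurable_regular h_reg.
pose k := h \_ (Sigma B).
have k_ge0 x : (0 <= k x)%R.
  by rewrite /k patchE; case: ifPn => // /set_mem /h_gt0 /ltW.
have mk : measurable_fun setT k by apply/(measurable_restrictT _ (measurable_Sigma B)).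
have [mu muE] := density_measure m mk k_ge0.
have muE' A : measurable A -> mu A = \int[m]_(x in A `&` Sigma B) (h x)%:E.
  move=> mA; rewrite muE// integral_mkcondr; apply: eq_integral => x _.
  by rewrite /k !patchE; case: ifP.
(* [mu] has a density with respect to [m], so wandering sets are null for it as well. *)
exists mu; split; last first.
  move=> A mA wA; rewrite muE//; apply: null_set_integral => //; last exact: m_cons.
  by apply: measurable_funTS; exact/measurable_EFinP.
rewrite /is_RPF_measure P0 /= expR0; exists m, h; split=> //.
- by split=> // j; rewrite cylE lte_fin p_gt0 ltry.
- split=> //; first exact: regular_continuous.
  move=> x hx; rewrite mul1r -h_sum//.
  pose h' y := (k y)%:E.
  have -> : transfer B f (EFin \o h) x = transfer B f h' x.
    by apply: eq_esum => y [hy _]; rewrite /h' /k patchE mem_set.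
  rewrite transferE; last by move=> y; rewrite lee_fin.
  apply: eq_eseriesr => a _; rewrite /h' -EFinM; congr EFin.
  case: ifPn => ax; last by rewrite branch0 ?mul0r// => /Sigma_scons[bx _]; move: ax; rewrite bx.
  by rewrite branchE// /k patchE mem_set//; exact/Sigma_scons.
Qed.

End RPF_measure.

Section recurrence.
Context {R : realType}.
Variables (B : rel nat) (tau : borel_seqs -> R) (g : borel_seqs * measurableTypeR R -> R).
Hypotheses (hmix : topologically_mixing B)
  (tau_gt0 : forall x, Sigma B x -> (0 < tau x)%R)
  (tau_div : forall x, Sigma B x ->
    \sum_(0 <= i <oo) (tau (iter i left_shift x))%:E = +oo)
  (g_int : fiber_integrable B tau g).

Lemma recurrent_flowE i : recurrent_flow B tau g i <->
  \esum_(w in loops B i) loop_weight (normalized_potential B tau g) w = +oo.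
Proof.
rewrite /recurrent_flow (Zflow_series tau_gt0 tau_div); last exact: fiber_integrableB.
rewrite (@eq_esum _ _ _ _ (loop_weight (normalized_potential B tau g)))// => w lw.
rewrite /loop_weight (eq_lsum (B := B) (i := i) (f2 := normalized_potential B tau g))// => y hy.
exact: (DeltaB tau_gt0 _ g_int hy).
Qed.

(** Powers of one loop have arbitrarily large periods. It follows that the limit in (b) is taken
    along a proper filter. *)
Lemma Zflow_neq0 i N : exists2 n, (N <= n)%N & Zflow B tau g n i != 0.
Proof.
have [u lu] := loop_exists hmix i.
have T0 := lsum_gt0 tau_gt0 lu; set T := lsum tau u in T0.
pose k := Num.truncn (N%:R / T).
have lw := loop_wpow k lu.
have : loops B i (wpow u k.+1) by [].
rewrite (window_cover tau_gt0) => -[n _ wn].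
have Tw : (N%:R < lsum tau (wpow u k.+1))%R.
  by rewrite lsum_wpow -ltr_pdivrMr//; exact: truncnS_gt.
have Nn : (N < n)%N.
  by have [_] := wn; rewrite -(ltr_nat R); move: Tw; lra.
exists n; first exact: ltnW.
rewrite (ZflowE tau_gt0 tau_div)//; last exact: leq_ltn_trans Nn.
rewrite gt_eqF//; apply: lt_le_trans (esum_ge1 wn _); first exact: loop_weight_gt0.
by move=> *; exact: loop_weight_ge0.
Qed.

End recurrence.

Unset Implicit Arguments.
Set Strict Implicit.

Theorem theorem5p2 (R : realType) (B : rel nat)
    (tau : borel_seqs -> R)
    (g : borel_seqs * measurableTypeR R -> R)
    (hB : no_zero_row_or_column B)
    (hmix : topologically_mixing B)
    (tau_gt0 : forall x, Sigma B x -> (0 < tau x)%R)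
    (tau_var : summable_variations B tau)
    (tau_div : forall x, Sigma B x ->
       \sum_(0 <= i <oo) (tau (iter i left_shift x))%:E = +oo)
    (g_int : fiber_integrable B tau g)
    (Delta_var : summable_variations B (Delta tau g))
    (hP : flow_pressure B tau g < +oo) :
  [/\ (* (a) *)
      forall i j : nat, recurrent_flow B tau g i <-> recurrent_flow B tau g j,
      (* (b), the limit being taken over the n for which the logarithm is not
         that of an empty sum: for tau = 2, odd n give empty sums *)
      forall i : nat,
        (forall N : nat, exists2 n, (N <= n)%N & Zflow B tau g n i != 0) /\
        (fun n : nat => (n%:R^-1)%:E * lne (Zflow B tau g n i))
          @ within [set n | Zflow B tau g n i != 0] \oo
          --> flow_pressure B tau g,
      (* (c) *)
      forall i j : nat, recurrent_flow B tau g i <->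
        recurrent_base B (normalized_potential B tau g) j /\
        gurevich_pressure B (normalized_potential B tau g) = 0
    & (* (d) *)
      forall i : nat, recurrent_flow B tau g i ->
        exists nu : {measure set (borel_seqs * measurableTypeR R)
                       -> \bar R},
          conservative_flow B tau nu /\
          exists mu : {measure set borel_seqs -> \bar R},
            is_RPF_measure B (normalized_potential B tau g) mu /\
            forall A, measurable A -> nu A = lift_measure B tau mu A].
Proof.
have [u0 lu0] := loop_exists hmix 0.
have Sigma0 : Sigma B !=set0 by exists (per u0); exact: loop_Sigma lu0.
have [rT WT] := summable_variations_walters Sigma0 tau_var.
have [rD WD] := summable_variations_walters Sigma0 Delta_var.
have pE := pressureE hmix tau_gt0 WT WD hP.
have W := waltersB (fine (flow_pressure B tau g)) WD WT.
have recE := recurrent_flowE tau_gt0 tau_div g_int.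
have rec0 i : recurrent_flow B tau g i ->
    gurevich_pressure B (normalized_potential B tau g) = 0.
  by move=> /recE; exact: (recurrent_gurevich hmix tau_gt0 WT WD hP).
have baseE j P0 := recurrent_baseE (B := B) (f := normalized_potential B tau g) j P0.
have rec_transfer i j : recurrent_flow B tau g i -> recurrent_flow B tau g j.
  by move=> /recE h; apply/recE; exact: (loops_infinite hmix W) h.
split.
- by move=> i j; split; exact: rec_transfer.
- move=> i; split; first by move=> N; exact: Zflow_neq0.
  have hgt := gt_pressure hmix tau_gt0 WT WD hP.
  have hlt := lt_pressure hmix tau_gt0 WT WD hP.
  have lim := window_limit hmix tau_gt0 WT WD i hgt hlt.
  rewrite -[X in _ --> X]pE; apply: cvg_trans lim => P.
  (* [ZflowE] applies from [n = 1] on, which is enough for the limit. *)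
  have n1 : \forall n \near \oo, (0 < n)%N by exact: nbhs_infty_gt.
  apply: filterS2 n1 => n n0.
  by rewrite /preimage /mkset (ZflowE tau_gt0 tau_div _ g_int n0).
- move=> i j; split=> [h|[h P0]].
    have P0 := rec0 i h; split=> //.
    by apply/(baseE j P0)/recE; exact: rec_transfer h.
  apply: (rec_transfer j); apply/recE.
  exact/(baseE j P0).
- move=> i h; have P0 := rec0 i h.
  have [mu [rpf mu_cons]] := RPF_measure_exists hmix W P0 ((recE i).1 h).
  have mtau := measurable_regular (walters_regular WT).
  have [nu [nu_cons nuE]] := lift_conservative tau_gt0 tau_div mtau mu_cons.
  by exists nu; split=> //; exists mu.
Qed.
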